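(* Let $p\ge1$ be an integer, $r\ge2$, $p+1\ge r$. Let $F=f+g$ be an $r$-uniformly convex function on $\mathbb{R}^d$ with constant $\sigma_r>0$, where $f$ and $g$ are convex functions whose $p$-th derivatives are Lipschitz with constants $L_{p,f}$ and $L_{p,g}$ respectively, with $L_{p,f}<L_{p,g}$. Let $x^*$ be the minimizer of $F$ and $R=\|x_0-x^*\|$. Then the Tensor Methods Combination framework (described in the context) with $H_{p,f}=2L_{p,f}$ reaches a point $x_N$ with $F(x_N)-F(x^* )\le\varepsilon$ using $N_f$ computations of derivatives of $f$ and $N_g$ computations of derivatives of $g$, where $$N_f=\tilde O\left[\left(\frac{L_{p,f}R^{p+1-r}}{\sigma_r}\right)^{\frac2{3p+1}}\right],\qquad N_g=\tilde O\left[\left(\frac{L_{p,g}R^{p+1-r}}{\sigma_r}\right)^{\frac2{3p+1}}\right].$$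
   Context: $\|\cdot\|$ is the Euclidean norm. A function $\Phi$ is $s$-uniformly convex with constant $\sigma$ if $\Phi(y)\ge\Phi(x)+\langle\nabla\Phi(x),y-x\rangle+\frac{\sigma}{s}\|y-x\|^s$ for all $x,y$. $\tilde O$ means up to logarithmic factors (including in $1/\varepsilon$). The Taylor model is $\Omega_p(\phi,x;y)=\phi(x)+\sum_{k=1}^p\frac1{k!}D^k\phi(x)[y-x]^k$. A ''computation of derivatives'' of a function is one call, at one point, to an oracle returning its derivatives up to order $p$. CATD with parameter $H$ applied to a sum $\phi+\gamma$ ($\phi$ convex with Lipschitz $p$-th derivative, $\gamma$ proper closed convex, the composite part) from $x_0$: set $A_0=0$, $y_0=x_0$. For $k=0,1,\dots$, compute a pair $\lambda_{k+1}>0$, $y_{k+1}$ with $$\frac12\le\lambda_{k+1}\frac{H\|y_{k+1}-\tilde x_k\|^{p-1}}{(p-1)!}\le\frac p{p+1},\quad y_{k+1}=\operatorname{argmin}_y\Big\{\Omega_p(\phi,\tilde x_k;y)+\frac H{p!}\|y-\tilde x_k\|^{p+1}+\gamma(y)\Big\},$$ $$a_{k+1}=\frac{\lambda_{k+1}+\sqrt{\lambda_{k+1}^2+4\lambda_{k+1}A_k}}2,\quad A_{k+1}=A_k+a_{k+1},\quad\tilde x_k=\frac{A_k}{A_{k+1}}y_k+\frac{a_{k+1}}{A_{k+1}}x_k,$$ and set $x_{k+1}=x_k-a_{k+1}(\nabla\phi(y_{k+1})+\gamma'(y_{k+1}))$, with $\gamma'(y_{k+1})$ a subgradient of $\gamma$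 at $y_{k+1}$ (the gradient if $\gamma$ is differentiable). CATD with restarts, for an objective $\phi+\gamma$ that is $s$-uniformly convex with constant $\sigma$ and has minimizer $x_*$: from a starting point $z_0$, with $R_0=\|z_0-x_*\|$ and $R_k=R_02^{-k}$, let $z_{k+1}$ be the output $y_{N_k}$ of CATD started at $z_k$ and run for $$N_k=\max\Big\{\Big\lceil\Big(\tfrac{s\,c_p L\,2^s}{\sigma}R_k^{p+1-s}\Big)^{2/(3p+1)}\Big\rceil,1\Big\}$$ steps, where $c_p=2^{p-1}(p+1)^{(3p+1)/2}/(p-1)!$ and $L$ is the constant $H$ used in CATD (a constant multiple of the Lipschitz constant of the $p$-th derivative of $\phi$). Tensor Methods Combination: (outer) run CATD with restarts for $F=f+g$ from $x_0$ with $\phi=f$, composite part $\gamma=g$, $s=r$, $\sigma=\sigma_r$ and $H=H_{p,f}$; (inner) each outer subproblem $$\min_y\Big(\Omega_p(f,\tilde x_k;y)+\frac{H_{p,f}}{p!}\|y-\tilde x_k\|^{p+1}+g(y)\Big)$$ is itself solved by CATD with restarts, applied to the whole subproblem objective (which is $(p+1)$-uniformly convex with Lipschitz $p$-th derivative), up to the desired accuracy, namely until the norm of the gradient of the subproblem objective at the returned point $\tilde y$ is at most $\frac1{4p(p+1)}\|\nabla F(\tilde y)\|$. Derivatives of $f$ are computed only at outer iterations; derivatives of $g$ are computed at the inner iterations.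
   Formalization: Both bounds carry the extra factor max(1, X^{-2/(3p+1)}) with X = L_{p,f}R^{p+1-r}/σ_r (equal to 1 if X ≥ 1), since the stated bounds fail as X → 0: every outer step costs at least one call of f and one full inner restart. Also L_{p,f} > 0 is assumed. *)

(* Defs.v *)
From HB Require Import structures.
From mathcomp Require Import all_boot all_order all_algebra.
From mathcomp Require Import all_classical all_reals all_analysis.

Set Implicit Arguments.
Unset Strict Implicit.
Unset Printing Implicit Defensive.

Import Order.TTheory GRing.Theory Num.Theory.
Import numFieldNormedType.Exports.

Local Open Scope classical_set_scope.
Local Open Scope ring_scope.

(* R^d is 'rV[R]_d. The norm that the library puts on 'rV[R]_d is the sup norm;
   it is used only through the topology, which is the Euclidean one. *)
Section Euclidean.
Context {R : realType} {d : nat}.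
Local Notation V := 'rV[R]_d.

Definition dotp (u v : V) : R := \sum_(i < d) u 0 i * v 0 i.

Definition enorm (u : V) : R := Num.sqrt (dotp u u).

Definition grad (phi : V -> R) (x : V) : V :=
  \row_(i < d) 'D_(delta_mx 0 i) phi x.

(* [Dk phi [:: h1; ...; hk] x] is D^k phi(x)[h1, ..., hk]. *)
Fixpoint Dk (phi : V -> R) (hs : seq V) : V -> R :=
  if hs is h :: hs' then 'D_h (Dk phi hs') else phi.

(* phi is p times (Frechet) differentiable and D^p phi is L-Lipschitz for the
   operator norm of p-linear forms. *)
Definition lip_deriv (p : nat) (L : R) (phi : V -> R) : Prop :=
  (forall hs x, (size hs < p)%N -> differentiable (Dk phi hs) x) /\
  (forall hs x y, size hs = p ->
     `|Dk phi hs x - Dk phi hs y| <= L * enorm (x - y) * \prod_(h <- hs) enorm h).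

Definition unif_convex (s sigma : R) (phi : V -> R) : Prop :=
  forall x y,
    phi x + dotp (grad phi x) (y - x) + sigma / s * enorm (y - x) `^ s <= phi y.

Definition minimizer (phi : V -> R) (x : V) : Prop := forall y, phi x <= phi y.

Definition taylor (p : nat) (phi : V -> R) (x y : V) : R :=
  phi x + \sum_(1 <= k < p.+1) (k`!%:R)^-1 * Dk phi (nseq k (y - x)) x.

(* Objective of the tensor step at xt for the sum phi + gamma. *)
Definition step_obj (p : nat) (H : R) (phi gamma : V -> R) (xt y : V) : R :=
  taylor p phi xt y + H / p`!%:R * enorm (y - xt) ^+ p.+1 + gamma y.

End Euclidean.

Section CATD.
Context {R : realType} {d : nat}.
Local Notation V := 'rV[R]_d.

(* N steps of CATD from z0 with output yN. [G] is the gradient of the objective;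
   [solve k xt y] says that y is accepted as the solution of the subproblem of
   step k, centred at xt: the exact minimizer or, for the outer loop, the output
   of the inner solver. *)
Definition catd (p : nat) (H : R) (solve : nat -> V -> V -> Prop) (G : V -> V)
    (z0 : V) (N : nat) (yN : V) : Prop :=
  exists (lambda a A : nat -> R) (x y xt : nat -> V),
    [/\ A 0%N = 0, x 0%N = z0, y 0%N = z0, yN = y N &
      forall k, (k < N)%N ->
        [/\ 0 < lambda k.+1
              /\ a k.+1 = (lambda k.+1
                   + Num.sqrt (lambda k.+1 ^+ 2 + 4 * lambda k.+1 * A k)) / 2,
            A k.+1 = A k + a k.+1
              /\ xt k = (A k / A k.+1) *: y k + (a k.+1 / A k.+1) *: x k,
            solve k (xt k) (y k.+1),
            2^-1 <= lambda k.+1 * (H * enorm (y k.+1 - xt k) ^+ p.-1 / (p.-1)`!%:R)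
                 <= p%:R / p.+1%:R
          & x k.+1 = x k - a k.+1 *: G (y k.+1)]].

Definition c_const (p : nat) : R :=
  2 ^+ p.-1 * p.+1%:R `^ ((3 * p + 1)%:R / 2) / (p.-1)`!%:R.

(* The step count N_k of the k-th restart. *)
Definition nsteps (p : nat) (H s sigma R0 : R) (k : nat) : nat :=
  maxn `|Num.ceil ((s * c_const p * H * 2 `^ s / sigma
                     * (R0 / 2 ^+ k) `^ (p.+1%:R - s)) `^ (2 / (3 * p + 1)%:R))|%N
       1.

(* z 0, ..., z K are produced by K restarts of CATD; [xs] is the minimizer of
   the objective. *)
Definition catd_restarts (p : nat) (H s sigma : R) (xs : V)
    (solve : nat -> nat -> V -> V -> Prop) (G : V -> V)
    (z : nat -> V) (K : nat) : Prop :=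
  forall k, (k < K)%N ->
    catd p H (solve k) G (z k)
      (nsteps p H s sigma (enorm (z 0%N - xs)) k) (z k.+1).

End CATD.

Section Combination.
Context {R : realType} {d : nat}.
Local Notation V := 'rV[R]_d.
Implicit Types f g : V -> R.

Definition composite_problem (p : nat) (r : R) f g (Lf Lg sigma : R) (xs : V) :=
  [/\ convex_function setT f /\ lip_deriv p Lf f,
      convex_function setT g /\ lip_deriv p Lg g,
      0 < Lf < Lg,
      0 < sigma /\ unif_convex r sigma (fun x => f x + g x)
    & minimizer (fun x => f x + g x) xs].

Definition gradF f g (y : V) : V := grad f y + grad g y.

(* Parameters of the inner solver: Hin is the regularization constant of inner
   CATD and sigmain its (p+1)-uniform convexity constant. They are valid for
   every outer subproblem, and comparable up to the factor kappa to the Lipschitz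
   constants Lg and Lf, which are the orders of magnitude of the optimal ones. *)
Definition inner_constants (p : nat) (kappa : R) f g (Lf Lg Hin sigmain : R) :=
  [/\ 0 < sigmain, Lf <= kappa * sigmain, Hin <= kappa * Lg
    & forall xt, lip_deriv p Hin (step_obj p (2 * Lf) f g xt)
              /\ unif_convex p.+1%:R sigmain (step_obj p (2 * Lf) f g xt)].

Definition accurate (p : nat) f g (Hf : R) (xt y : V) : Prop :=
  enorm (grad (step_obj p Hf f g xt) y)
    <= (4 * p * p.+1)%:R^-1 * enorm (gradF f g y).

(* The inner solver on the outer subproblem centred at xt, after J restarts none
   of whose earlier points passed the accuracy test. Its own tensor steps are
   exact, on the whole subproblem objective (no composite part). *)
Definition inner_loop (p : nat) f g (Hf Hin sigmain : R) (xt : V)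
    (z : nat -> V) (J : nat) : Prop :=
  let m := step_obj p Hf f g xt in
  exists ys,
    [/\ minimizer m ys, z 0%N = xt,
        catd_restarts p Hin p.+1%:R sigmain ys
          (fun _ _ xt' => minimizer (step_obj p Hin m (cst 0) xt')) (grad m) z J
      & forall j, (j < J)%N -> ~ accurate p f g Hf xt (z j)].

Definition inner_solve (p : nat) f g (Hf Hin sigmain : R) (J : nat) (xt y : V) :=
  exists z, [/\ inner_loop p f g Hf Hin sigmain xt z J, y = z J
              & accurate p f g Hf xt y].

(* K outer restarts; [J k i] is the number of inner restarts used in step i of
   the outer restart k. *)
Definition combination (p : nat) (r : R) f g (sigma : R) (xs : V)
    (Hf Hin sigmain : R) (x0 : V)
    (z : nat -> V) (J : nat -> nat -> nat) (K : nat) : Prop :=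
  z 0%N = x0 /\
  catd_restarts p Hf r sigma xs
    (fun k i => inner_solve p f g Hf Hin sigmain (J k i)) (gradF f g) z K.

(* Oracle calls of f: in every outer step, one at the centre xt and one at each
   of the J k i points returned by the inner restarts, for the accuracy test; the
   last of these is y_{i+1}, so its gradient is reused to update x. *)
Definition calls_f (p : nat) (r sigma Hf R0 : R) (J : nat -> nat -> nat)
    (K : nat) : nat :=
  (\sum_(k < K) \sum_(i < nsteps p Hf r sigma R0 k) (1 + J k i))%N.

(* Oracle calls of g: in every outer step, one at xt for the first accuracy test,
   and two in every inner step (Taylor model, and gradient at the new y). For
   s = p + 1 the exponent of R_k in the step count is 0, so all inner restarts
   have the same length and the arguments R0 := 1, k := 0 are immaterial. *)
Definition calls_g (p : nat) (r sigma Hf Hin sigmain R0 : R)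
    (J : nat -> nat -> nat) (K : nat) : nat :=
  (\sum_(k < K) \sum_(i < nsteps p Hf r sigma R0 k)
     (1 + J k i * (2 * nsteps p Hin p.+1%:R sigmain 1 0)))%N.

(* Correction of the O-tilde bounds for small arguments, equal to 1 as soon as
   X >= 1. Each restart makes at least one step, whose inner solver makes at least
   of the order of (Lg / Lf)^(2/(3p+1)) steps however small Lf is, so that no
   bound of the form C * polylog * X can hold for the oracle calls as X -> 0. *)
Definition small_arg (X : R) : R := Num.max 1 X^-1.

End Combination.

(* Main.v *)
From HB Require Import structures.
Require Import Defs.
From mathcomp Require Import all_boot all_order all_algebra.
From mathcomp Require Import all_classical all_reals all_analysis.
From mathcomp Require Import ring lra zify.
Import Order.TTheory GRing.Theory Num.Theory.
Import numFieldNormedType.Exports.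
Local Open Scope ring_scope.

(** The outer objective and every inner one are uniformly convex, so both loops
    are the same argument. A CATD step is a Monteiro-Svaiter step with relative
    error 1/2: at an exact minimizer of the tensor model this is the Taylor
    estimate for the gradient, and the tolerance 1/(4p(p+1)) of the inexact outer
    steps is absorbed by the slack of H = 2 L. The Monteiro-Svaiter energy then
    gives F(y_N) - F* <= R^2 / (2 A_N) and a bound on the sum of the
    A_k |y_k - xt_(k-1)|^2 / lambda_k, which forces A_N >= c N^((3p+1)/2); hence
    each restart halves the distance to the minimizer.

    The inner subproblem is (p+1)-uniformly convex because the regularization with
    constant L dominates the second-order Taylor error of the convex function f, and
    the other half of the regularization is a power of the norm. After j inner
    restarts the gradient of the subproblem is O(Hin (Rin / 2^j)^p), while the
    gradient of F there is at least of order Lf Rin^p; so the accuracy test succeeds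
    once 2^j is of order Lg / Lf. The oracle calls are counted up to the first
    restart whose output is eps-accurate. *)

(** The constants [C] and [m] are chosen before the dimension, so every quantitative estimate has to
    be dimension-free. The critical one is the Lipschitz constant of the p-th derivative of
    |x|^(p+1), which enters the inner step count: coordinates or the sup norm would bring in d, and
    this is why the derivatives of that function are tracked inside a class of explicit functions
    carrying a numerical bound.

    The exponent (3p+1)/2 reflects a trade-off. The step condition makes lambda large when the step
    y - xt is short, and the energy limits how often it can be long.

    The bound for g is a product. An inner objective has s = p + 1, so the length of an inner
    restart does not depend on its radius and is of order (Lg / Lf)^(2/(3p+1)). An outer restart has
    of order (Lf R^(p+1-r) / sigma)^(2/(3p+1)) steps, and Lf cancels. Each of the two numbers of
    restarts contributes one logarithm. *)

Lemma ler_eq {R : realType} (x y : R) : x = y -> x <= y.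
Proof. by move=> ->. Qed.

(** * The Euclidean norm *)

Section Euclid.
Context {R : realType} {d : nat}.
Local Notation V := 'rV[R]_d.
Implicit Types (u v w x y : V) (c : R).

Lemma dotpC u v : dotp u v = dotp v u.
Proof. by apply: eq_bigr => i _; rewrite mulrC. Qed.

Lemma dotpDl u v w : dotp (u + v) w = dotp u w + dotp v w.
Proof. by rewrite -big_split; apply: eq_bigr => i _; rewrite mxE mulrDl. Qed.

Lemma dotpZl c u w : dotp (c *: u) w = c * dotp u w.
Proof. by rewrite /dotp mulr_sumr; apply: eq_bigr => i _; rewrite mxE mulrA. Qed.

Lemma dotpDr u v w : dotp w (u + v) = dotp w u + dotp w v.
Proof. by rewrite dotpC dotpDl !(dotpC w). Qed.

Lemma dotpZr c u w : dotp w (c *: u) = c * dotp w u.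
Proof. by rewrite dotpC dotpZl dotpC. Qed.

Lemma dotpNl u w : dotp (- u) w = - dotp u w.
Proof. by rewrite -scaleN1r dotpZl mulN1r. Qed.

Lemma dotpNr u w : dotp w (- u) = - dotp w u.
Proof. by rewrite dotpC dotpNl dotpC. Qed.

Lemma dotpBl u v w : dotp (u - v) w = dotp u w - dotp v w.
Proof. by rewrite dotpDl dotpNl. Qed.

Lemma dotpBr u v w : dotp w (u - v) = dotp w u - dotp w v.
Proof. by rewrite dotpDr dotpNr. Qed.

Lemma dot0p w : dotp 0 w = 0.
Proof. by rewrite -(scale0r 0) dotpZl mul0r. Qed.

Lemma dotp0 w : dotp w 0 = 0.
Proof. by rewrite dotpC dot0p. Qed.

Lemma dotp_ge0 u : 0 <= dotp u u.
Proof. by apply: sumr_ge0 => i _; rewrite -expr2 sqr_ge0. Qed.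

Lemma dotp_eq0 u : dotp u u = 0 -> u = 0.
Proof.
move=> /eqP; rewrite psumr_eq0 => [/allP h|i _]; last by rewrite -expr2 sqr_ge0.
apply/rowP => i; rewrite mxE; have /= := h i (mem_index_enum _).
by rewrite mulf_eq0 orbb => /eqP.
Qed.

Lemma enorm_ge0 u : 0 <= enorm u. Proof. exact: sqrtr_ge0. Qed.

Lemma enormE u : enorm u ^+ 2 = dotp u u.
Proof. by rewrite sqr_sqrtr // dotp_ge0. Qed.

Lemma enorm0 : enorm (0 : V) = 0.
Proof. by rewrite /enorm dot0p sqrtr0. Qed.

Lemma enorm_eq0 u : enorm u = 0 -> u = 0.
Proof. by move=> h; apply: dotp_eq0; rewrite -enormE h expr0n. Qed.

Lemma enorm_gt0 u : u != 0 -> 0 < enorm u.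
Proof.
move=> u0; rewrite lt_neqAle enorm_ge0 andbT eq_sym.
by apply: contra u0 => /eqP /enorm_eq0 ->.
Qed.

Lemma enormZ c u : enorm (c *: u) = `|c| * enorm u.
Proof.
by rewrite /enorm dotpZl dotpZr mulrA -expr2 sqrtrM ?sqr_ge0 // sqrtr_sqr.
Qed.

Lemma enormN u : enorm (- u) = enorm u.
Proof. by rewrite -scaleN1r enormZ normrN1 mul1r. Qed.

Lemma enormB u v : enorm (u - v) = enorm (v - u).
Proof. by rewrite -enormN opprB. Qed.

Lemma dotp_le u v : dotp u v <= enorm u * enorm v.
Proof.
have [->|v0] := eqVneq v 0; first by rewrite dotp0 enorm0 mulr0.
have [->|u0] := eqVneq u 0; first by rewrite dot0p enorm0 mul0r.
have a0 := enorm_gt0 _ u0; have b0 := enorm_gt0 _ v0.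
have := dotp_ge0 (enorm v *: u - enorm u *: v).
rewrite !dotpBl !dotpBr !dotpZl !dotpZr -!enormE (dotpC v u).
set a := enorm u in a0 *; set b := enorm v in b0 *; set s := dotp u v.
have -> : b * (b * a ^+ 2) - b * (a * s) - (a * (b * s) - a * (a * b ^+ 2)) =
  2 * (a * b) * (a * b - s) by ring.
by rewrite pmulr_rge0 ?subr_ge0 // !mulr_gt0.
Qed.

Lemma normr_dotp_le u v : `|dotp u v| <= enorm u * enorm v.
Proof. by rewrite ler_norml dotp_le andbT lerNl -dotpNl -(enormN u) dotp_le. Qed.

Lemma enorm_triangle u v : enorm (u + v) <= enorm u + enorm v.
Proof.
rewrite -(ler_pXn2r (n := 2)) ?nnegrE ?addr_ge0 ?enorm_ge0 //.
rewrite sqrrD !enormE dotpDl !dotpDr (dotpC v u).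
have := dotp_le u v; lra.
Qed.

Lemma enorm_triangleB u v : enorm u - enorm v <= enorm (u - v).
Proof. by rewrite lerBlDr -{1}(subrK v u) enorm_triangle. Qed.

Lemma coord_le_normr u i : `|u 0 i| <= `|u|.
Proof.
by rewrite -[`|u|]/(mx_norm u) mx_normrE; apply: (le_bigmax _ _ (0, i)).
Qed.

Lemma enorm_le_normr u : enorm u <= Num.sqrt d%:R * `|u|.
Proof.
rewrite -(ler_pXn2r (n := 2)) ?nnegrE ?mulr_ge0 ?enorm_ge0 ?sqrtr_ge0 // enormE.
rewrite exprMn sqr_sqrtr ?ler0n //.
apply: le_trans (_ : \sum_(i < d) `|u| ^+ 2 <= _); last first.
  by rewrite sumr_const card_ord mulr_natl.
apply: ler_sum => i _; rewrite -expr2 -real_normK ?num_real //.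
by rewrite ler_pXn2r ?nnegrE // coord_le_normr.
Qed.

Lemma dotp_delta u (i : 'I_d) : dotp u (delta_mx 0 i) = u 0 i.
Proof.
rewrite /dotp (bigD1 i) //= mxE !eqxx mulr1 big1 ?addr0 // => j /negPf ji.
by rewrite mxE ji andbF mulr0.
Qed.

End Euclid.

(** * Taylor's formula and mixed derivatives *)

Section OneVariable.
Context {R : realType}.
Implicit Types u v : R -> R.

Lemma is_derive_continuous u u' :
  (forall t : R, is_derive t 1 u (u' t)) -> continuous u.
Proof.
move=> du t; have /derivable1_diffP : derivable u t 1 by have := du t.
exact: differentiable_continuous.
Qed.

Lemma mean_value u u' a b : a < b -> (forall t : R, is_derive t 1 u (u' t)) ->
  exists2 c, a < c < b & u b - u a = u' c * (b - a).
Proof.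
move=> ab du; have [|c] := @MVT _ u u' a b ab (fun x _ => du x).
  exact/continuous_subspaceT/is_derive_continuous.
by rewrite in_itv /= => hc e; exists c.
Qed.

Lemma derive_ge0_le u u' a b : a <= b -> (forall t : R, is_derive t 1 u (u' t)) ->
  (forall t, a < t -> 0 <= u' t) -> u a <= u b.
Proof.
rewrite le_eqVlt => /orP[/eqP -> //|ab] du u'0.
have [c /andP[ac _] e] := mean_value _ _ _ _ ab du.
by rewrite -subr_ge0 e mulr_ge0 ?u'0 ?subr_ge0 ?ltW.
Qed.

Lemma norm_derive_le u u' v v' t : u 0 = 0 -> v 0 = 0 ->
  (forall s : R, is_derive s 1 u (u' s)) -> (forall s : R, is_derive s 1 v (v' s)) ->
  (forall s, 0 <= s -> `|u' s| <= v' s) -> 0 <= t -> `|u t| <= v t.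
Proof.
move=> u0 v0 du dv h t0.
have {}h s : 0 < s -> 0 <= v' s + u' s /\ 0 <= v' s - u' s.
  by move=> s0; have := h s (ltW s0); rewrite ler_norml => /andP[]; lra.
have := derive_ge0_le (v + u) _ 0 t t0
  (fun s => @is_deriveD _ _ _ v u s 1 _ _ (dv s) (du s)) (fun s s0 => proj1 (h s s0)).
have := derive_ge0_le (v - u) _ 0 t t0
  (fun s => @is_deriveB _ _ _ v u s 1 _ _ (dv s) (du s)) (fun s s0 => proj2 (h s s0)).
by rewrite !fctE u0 v0 ler_norml; lra.
Qed.

Lemma is_derive_expfact c k (t : R) :
  is_derive t 1 (fun s : R => c * s ^+ k.+1 / (k.+1)`!%:R) (c * t ^+ k / k`!%:R).
Proof.
have -> : (fun s : R => c * s ^+ k.+1 / (k.+1)`!%:R) =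
  (c / (k.+1)`!%:R) \*: ((id : R -> R) ^+ k.+1).
  by apply/funext => s; rewrite !fctE /= /GRing.scale /= mulrAC.
apply: is_derive_eq; rewrite /GRing.scale /= factS natrM invfM mulr1.
have K0 : k.+1%:R != 0 :> R by rewrite pnatr_eq0.
have F0 : k`!%:R != 0 :> R by rewrite pnatr_eq0 -lt0n fact_gt0.
by move=> /=; field; rewrite F0 addrC natr1 K0.
Qed.

Lemma is_derive_taylor (c : nat -> R) n (t : R) :
  is_derive t 1 (fun s : R => \sum_(k < n.+1) c k * s ^+ k / k`!%:R)
    (\sum_(k < n) c k.+1 * t ^+ k / k`!%:R).
Proof.
have -> : (fun s : R => \sum_(k < n.+1) c k * s ^+ k / k`!%:R) = cst (c 0) +
    \sum_(k < n) (fun s : R => c k.+1 * s ^+ k.+1 / (k.+1)`!%:R).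
  apply/funext => s; rewrite fctE fct_sumE big_ord_recl /= expr0 fact0 divr1 mulr1.
  by congr (_ + _); apply: eq_bigr.
apply: is_derive_eq; last exact: add0r.
apply: is_deriveD; apply: is_derive_sum => k; exact: is_derive_expfact.
Qed.

(** Only the increment of the n-th derivative from 0 is bounded, so no derivative of order n + 1 is
    involved. The induction applies the bound to the shifted sequence, that is, to the derivative of
    the remainder, and [norm_derive_le] integrates it. *)
Lemma taylor_remainder (u : nat -> R -> R) n M :
  (forall k (t : R), (k < n)%N -> is_derive t 1 (u k) (u k.+1 t)) ->
  (forall t, 0 <= t -> `|u n t - u n 0| <= M * t) ->
  forall t, 0 <= t ->
  `|u 0%N t - \sum_(k < n.+1) u k 0 * t ^+ k / k`!%:R|
    <= M * t ^+ n.+1 / n.+1`!%:R.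
Proof.
elim: n u => [|n IH] u du hu t t0.
  by rewrite big_ord_recl big_ord0 expr0 fact0 addr0 mulr1 divr1 expr1 divr1 hu.
have {}IH := IH (fun k => u k.+1) (fun k t hk => du k.+1 t hk) hu.
pose T := fun s : R => \sum_(k < n.+2) u k 0 * s ^+ k / k`!%:R.
pose T' := fun s : R => \sum_(k < n.+1) u k.+1 0 * s ^+ k / k`!%:R.
apply: (@norm_derive_le (u 0%N - T) (fun s => u 1%N s - T' s)
  (fun t => M * t ^+ n.+2 / (n.+2)`!%:R)
  (fun t => M * t ^+ n.+1 / (n.+1)`!%:R)) => //.
- rewrite !fctE /T big_ord_recl expr0 fact0 mulr1 divr1 big1 ?addr0 ?subrr // => k _.
  by rewrite /= expr0n mulr0 mul0r.
- by rewrite expr0n mulr0 mul0r.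
- move=> s; apply: is_deriveB; [exact: du | exact: (is_derive_taylor (fun k => u k 0))].
- move=> s; exact: is_derive_expfact.
Qed.

Lemma convex_tangent u u' u'' :
  (forall t : R, is_derive t 1 u (u' t)) -> (forall t : R, is_derive t 1 u' (u'' t)) ->
  (forall t, 0 <= u'' t) -> u 0 + u' 0 <= u 1.
Proof.
move=> du du' h; have [c /andP[c0 _]] := mean_value _ _ _ _ (ltr01 : 0 < 1 :> R) du.
rewrite subr0 mulr1 => e; have := derive_ge0_le _ _ _ _ (ltW c0) du' (fun t _ => h t).
lra.
Qed.

Lemma nondecreasing_derive_ge0 u (u' t : R) :
  (forall s t, s <= t -> u s <= u t) -> is_derive t 1 u u' -> 0 <= u'.
Proof.
move=> hu [du <-]; apply: limr_ge => //; near=> h.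
rewrite /= [h *: _]mulr1 [_ *: _]/(_ * _).
have [h0|h0] := leP 0 h.
  by rewrite mulr_ge0 ?invr_ge0 // subr_ge0 hu // lerDr.
by rewrite mulr_le0 ?invr_le0 ?(ltW h0) // subr_le0 hu // gerDr ltW.
Unshelve. all: end_near. Qed.

End OneVariable.

Lemma ler_dist_half {R : realType} (e u v z : R) :
  `|u - z| < e / 2 -> `|v - z| < e / 2 -> `|v - u| <= e.
Proof. by rewrite !ltr_norml ler_norml => /andP[? ?] /andP[? ?]; lra. Qed.

Section Derivatives.
Context {R : realType} {d : nat}.
Local Notation V := 'rV[R]_d.
Implicit Types (phi psi : V -> R) (x y h w : V) (hs ws : seq V).

Lemma is_derive_line phi y w (t : R) : derivable phi (y + t *: w) w ->
  is_derive t 1 (fun t => phi (y + t *: w)) ('D_w phi (y + t *: w)).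
Proof.
pose q (h : R) := h^-1 *: (phi (h *: w + (y + t *: w)) - phi (y + t *: w)).
have E : (fun h : R => h^-1 *: (((fun t => phi (y + t *: w)) \o shift t) (h *: 1)
    - phi (y + t *: w))) = q.
  apply/funext => h; rewrite /q /=; congr (_ *: (phi _ - _)).
  by rewrite scalerDl addrCA [h%:A]mulr1.
by move=> dphi; split; [rewrite /derivable E | rewrite /derive E].
Qed.

Lemma derive_translate phi x y w : 'D_w (fun z => phi (z - x)) y = 'D_w phi (y - x).
Proof.
rewrite /derive; set f := fun h : R => _; set g := fun h : R => _.
by have -> : f = g by apply/funext => h; rewrite /f /g /= addrA.
Qed.

Lemma differentiable_translate phi x y : differentiable phi (y - x) ->
  differentiable (fun z => phi (z - x)) y.
Proof.
by move=> dphi; apply: (@differentiable_comp _ _ _ _ (fun z => z - x) phi).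
Qed.

Lemma derive_sum_scale phi x (I : Type) (r : seq I) (c : I -> R) (e : I -> V) :
  differentiable phi x ->
  'D_(\sum_(i <- r) c i *: e i) phi x = \sum_(i <- r) c i * 'D_(e i) phi x.
Proof.
move=> dphi; rewrite deriveE // linear_sum; apply: eq_bigr => i _.
by rewrite linearZ -deriveE.
Qed.

Lemma derive_grad phi x w : differentiable phi x ->
  'D_w phi x = dotp (grad phi x) w.
Proof.
move=> dphi; rewrite {1}(row_sum_delta w) derive_sum_scale //.
by apply: eq_bigr => i _; rewrite mxE mulrC.
Qed.

Lemma mean_value_line phi y w : (forall z, differentiable phi z) ->
  exists2 c, 0 < c < 1 & phi (y + w) - phi y = 'D_w phi (y + c *: w).
Proof.
move=> dphi.
have [|c hc] := mean_value _ _ _ _ (ltr01 : 0 < 1 :> R)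
  (fun t => is_derive_line phi y w t _); first by move=> t; exact: diff_derivable.
by rewrite subr0 mulr1 scale1r scale0r addr0 => e; exists c.
Qed.

(** Mean value theorem twice: for the increment [psi] along [h], then for the derivative along [h]
    in the direction [k]. *)
Lemma second_difference phi x h k : (forall z, differentiable phi z) ->
  (forall z, differentiable ('D_h phi) z) ->
  exists s t, [/\ 0 < s < 1, 0 < t < 1 &
    phi (x + h + k) - phi (x + h) - (phi (x + k) - phi x) =
      'D_k ('D_h phi) (x + s *: h + t *: k)].
Proof.
move=> dphi dhphi.
pose psi z := phi (z + k) - phi z.
have dsh z : differentiable (fun z => phi (z + k)) z.
  by have := differentiable_translate phi (- k) z; rewrite opprK; apply.
have dpsi z : differentiable psi z by apply: differentiableB.
have [s hs] := mean_value_line psi x h dpsi.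
rewrite /psi deriveB; do ?exact: diff_derivable.
have := derive_translate phi (- k) (x + s *: h) h; rewrite opprK => ->.
have [t ht ->] := mean_value_line ('D_h phi) (x + s *: h) k dhphi.
by move=> e; exists s, t.
Qed.

Lemma continuous_corner phi x h k : {for x, continuous phi} ->
  forall e, 0 < e -> exists2 c, 0 < c &
    forall s t, 0 < s < c -> 0 < t < c -> `|phi x - phi (x + s *: h + t *: k)| < e.
Proof.
move=> /cvgrPdist_lt cphi e e0.
have /nbhs_ballP[r /= r0 hr] := cphi e e0.
exists (r / (`|h| + `|k| + 1)); first by rewrite divr_gt0 // addr_gt0 // ltr_wpDl.
move=> s t /andP[s0 sc] /andP[t0 tc]; apply: hr.
rewrite -ball_normE /= -addrA opprD addNKr normrN.
rewrite (le_lt_trans (ler_normD _ _)) // !normrZ !gtr0_norm //.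
set c := r / _ in sc tc.
have H : r = c * `|h| + c * `|k| + c.
  by rewrite /c; field; rewrite gt_eqF // ltr_wpDl // addr_ge0.
have : s * `|h| <= c * `|h| by rewrite ler_wpM2r // ltW.
have : t * `|k| <= c * `|k| by rewrite ler_wpM2r // ltW.
lra.
Qed.

Lemma derive_scale phi (c : R) x h : differentiable phi x ->
  'D_(c *: h) phi x = c * 'D_h phi x.
Proof. by move=> dphi; rewrite !deriveE // linearZ. Qed.

Lemma derive_derive_scale phi (c : R) x h k : (forall z, differentiable phi z) ->
  (forall z, differentiable ('D_h phi) z) ->
  'D_(c *: k) ('D_(c *: h) phi) x = c ^+ 2 * 'D_k ('D_h phi) x.
Proof.
move=> dphi dhphi.
have -> : 'D_(c *: h) phi = c *: 'D_h phi.
  by apply/funext => z; rewrite derive_scale.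
rewrite derive_scale; last exact: differentiableZ.
by rewrite deriveZ; [rewrite mulrA -expr2 | exact: diff_derivable].
Qed.

(** The second difference over the parallelogram spanned by [h] and [k] is symmetric in them, so
    [second_difference] expresses it with either mixed derivative. Shrinking both directions by c
    and dividing by c^2 brings the two intermediate points close to x, where continuity applies. *)
Lemma schwarz phi h k : (forall z, differentiable phi z) ->
  (forall z, differentiable ('D_h phi) z) -> (forall z, differentiable ('D_k phi) z) ->
  continuous ('D_k ('D_h phi)) -> continuous ('D_h ('D_k phi)) ->
  'D_k ('D_h phi) = 'D_h ('D_k phi).
Proof.
move=> dphi dh dk chk ckh; apply/funext => x; apply/eqP; rewrite -subr_eq0.
rewrite -normr_le0; apply/ler_addgt0Pr => e e0; rewrite add0r.
have e2 : 0 < e / 2 by rewrite divr_gt0.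
have [a a0 ha] := continuous_corner _ x h k (chk x) _ e2.
have [b b0 hb] := continuous_corner _ x k h (ckh x) _ e2.
have [c [c0 ca cb]] : exists c, [/\ 0 < c, c < a & c < b].
  have m0 : 0 < Num.min a b by rewrite lt_min a0.
  have : Num.min a b / 2 < Num.min a b by lra.
  by rewrite lt_min => /andP[? ?]; exists (Num.min a b / 2); split; rewrite ?divr_gt0.
have sc (u z : R) : c < z -> 0 < u -> u < 1 -> 0 < u * c < z.
  by move=> cz u0 u1; rewrite mulr_gt0 //= (lt_trans _ cz) // gtr_pMl.
have dsc v : (forall z, differentiable ('D_v phi) z) ->
    forall z, differentiable ('D_(c *: v) phi) z.
  move=> dv z; have -> : 'D_(c *: v) phi = c *: 'D_v phi.
    by apply/funext => z'; rewrite derive_scale.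
  exact: differentiableZ.
have [s [t [/andP[s0 s1] /andP[t0 t1]]]] := second_difference phi x (c *: h) (c *: k) dphi
  (dsc _ dh).
rewrite (derive_derive_scale _ _ _ _ _ dphi dh) => e1.
have [s' [t' [/andP[s'0 s'1] /andP[t'0 t'1]]]] := second_difference phi x (c *: k) (c *: h)
  dphi (dsc _ dk).
rewrite (derive_derive_scale _ _ _ _ _ dphi dk).
rewrite ![_ *: (c *: _)]scalerA in e1 *.
rewrite [x + c *: k + c *: h]addrAC.
have -> (u v z y : R) : u - v - (z - y) = u - z - (v - y) by ring.
have c2 (u v : R) : c ^+ 2 * u = c ^+ 2 * v -> u = v.
  by apply: mulfI; rewrite expf_eq0 gt_eqF.
rewrite e1 => /c2 e3.
have := ha _ _ (sc _ _ ca s0 s1) (sc _ _ ca t0 t1).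
have := hb _ _ (sc _ _ cb s'0 s'1) (sc _ _ cb t'0 t'1).
by rewrite e3; exact: ler_dist_half.
Qed.

End Derivatives.

(** * Symmetry of higher derivatives and the Taylor polynomial *)

Section Smooth.
Context {R : realType} {d : nat}.
Local Notation V := 'rV[R]_d.
Implicit Types (phi psi : V -> R) (x y h w : V) (hs ws : seq V) (p : nat).

(** What remains of [lip_deriv] once the constant is forgotten; continuity of the top derivatives is
    what [schwarz] asks for. *)
Definition smooth p phi :=
  (forall hs x, (size hs < p)%N -> differentiable (Dk phi hs) x) /\
  (forall hs, size hs = p -> continuous (Dk phi hs)).

(** The topology is that of the sup norm, hence a factor sqrt d. Only continuity is drawn from it,
    so the quantitative bounds stay dimension-free. *)
Lemma lip_continuous (c : R) phi :
  (forall x y, `|phi x - phi y| <= c * enorm (x - y)) -> continuous phi.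
Proof.
move=> hc x; apply/(@cvgrPdist_lt _ _ _ (nbhs x)) => e e0.
pose m := `|c| * (1 + Num.sqrt d%:R) + 1.
have m0 : 0 < m by rewrite ltr_wpDl // mulr_ge0 // addr_ge0 // sqrtr_ge0.
apply/nbhs_ballP; exists (e / m); first by rewrite /= divr_gt0.
move=> y; rewrite -ball_normE /= ltr_pdivlMr // => xy.
apply: le_lt_trans xy; rewrite (le_trans (hc x y)) //.
apply: le_trans (_ : `|c| * (Num.sqrt d%:R * `|x - y|) <= _).
  by rewrite (le_trans (ler_wpM2r (enorm_ge0 _) (ler_norm c))) // ler_wpM2l // enorm_le_normr.
rewrite mulrA [leRHS]mulrC ler_wpM2r // /m mulrDr mulr1.
by have := normr_ge0 c; lra.
Qed.

Lemma lip_deriv_smooth p (L : R) phi : lip_deriv p L phi -> smooth p phi.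
Proof.
move=> [h1 h2]; split => // hs ehs.
apply: (@lip_continuous (L * \prod_(h <- hs) enorm h)) => x y.
by rewrite mulrAC h2.
Qed.

Lemma Dk_cat phi hs ws : Dk phi (hs ++ ws) = Dk (Dk phi ws) hs.
Proof. by elim: hs => //= h hs ->. Qed.

Lemma smooth_continuous p phi hs : smooth p phi -> (size hs <= p)%N ->
  continuous (Dk phi hs).
Proof.
move=> [h1 h2]; rewrite leq_eqVlt => /orP[/eqP /h2 //|/h1 h] x.
exact: differentiable_continuous.
Qed.

Lemma Dk_swap p phi h k hs : smooth p phi -> (size hs + 2 <= p)%N ->
  Dk phi [:: h, k & hs] = Dk phi [:: k, h & hs].
Proof.
move=> sp hp; apply: schwarz => [z|z|z||].
- by apply: sp.1; lia.
- by apply: (sp.1 (k :: hs)) => /=; lia.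
- by apply: (sp.1 (h :: hs)) => /=; lia.
- by apply: (smooth_continuous p phi [:: h, k & hs]) => //=; lia.
- by apply: (smooth_continuous p phi [:: k, h & hs]) => //=; lia.
Qed.

Lemma Dk_move p phi h hs ws : smooth p phi -> (size hs + size ws < p)%N ->
  Dk phi (hs ++ h :: ws) = Dk phi (h :: hs ++ ws).
Proof.
move=> sp; elim: hs => //= k hs IH hp.
rewrite IH; last by lia.
by apply: (Dk_swap p phi k h) => //; rewrite size_cat; lia.
Qed.

Lemma Dk_sum_scale p phi x hs (I : Type) (r : seq I) (c : I -> R) (e : I -> V) :
  smooth p phi -> (size hs < p)%N ->
  Dk phi (\sum_(i <- r) c i *: e i :: hs) x = \sum_(i <- r) c i * Dk phi (e i :: hs) x.
Proof. by move=> sp hp; apply: derive_sum_scale; apply: sp.1. Qed.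

Lemma taylorE p phi x y :
  taylor p phi x y = \sum_(k < p.+1) Dk phi (nseq k (y - x)) x / k`!%:R.
Proof.
rewrite /taylor big_ord_recl /= fact0 divr1 big_add1 /= big_mkord.
by congr (_ + _); apply: eq_bigr => i _; rewrite mulrC.
Qed.

(** One copy of z - x is expanded in coordinates: the form of degree k in z - x becomes a sum of
    products of a coordinate with a form of degree k - 1 that has one more fixed direction. Hence
    the induction on k with [ws] arbitrary. For k = 0 the factor [k%:R] hides the value of
    [k.-1]. *)
Lemma Dk_power p phi x k ws : smooth p phi -> (k + size ws <= p)%N -> forall y w,
  let P j (vs : seq V) (z : V) := Dk phi (nseq j (z - x) ++ vs) x in
  is_derive y w (P k ws) (k%:R * P k.-1 (w :: ws) y) /\ differentiable (P k ws) y.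
Proof.
move=> sp; elim: k ws => [|k IH] ws hk y w P.
  by rewrite mul0r; split; [exact: is_derive_cst | exact: differentiable_cst].
pose e (i : 'I_d) : V := delta_mx 0 i.
have PE : P k.+1 ws = \sum_(i < d) ((fun z : V => (z - x) 0 i) * P k (e i :: ws)).
  apply/funext => z; rewrite fct_sumE /P /=.
  transitivity (Dk phi (\sum_(i < d) (z - x) 0 i *: e i :: nseq k (z - x) ++ ws) x).
    by rewrite -row_sum_delta.
  rewrite (Dk_sum_scale p) //; last by rewrite size_cat size_nseq; lia.
  apply: eq_bigr => i _; rewrite fctE; congr (_ * _).
  by rewrite (Dk_move p) // size_nseq; lia.
have dcoord i : differentiable (fun z : V => (z - x) 0 i) y.
  apply: (@differentiable_comp _ _ _ _ (fun z => z - x) (fun z : V => z 0 i)) => //.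
  exact: differentiable_coord.
have Dcoord i : is_derive y w (fun z : V => (z - x) 0 i) (w 0 i).
  split; first exact: diff_derivable.
  rewrite (derive_translate (fun z : V => z 0 i)) deriveE; last exact: differentiable_coord.
  pose pr : V -> R := fun z => z 0 i.
  have lp : linear pr by move=> c u v; rewrite /pr !mxE.
  pose L := GRing.isLinear.Build R V R *%R pr lp.
  pose prL : {linear V -> R} := HB.pack pr L.
  by rewrite (@diff_lin _ _ _ prL) //; exact: coord_continuous.
have IHe i := IH (e i :: ws) ltac:(by move: hk => /=; lia) y w.
split; last first.
  rewrite PE; apply: differentiable_sum => i; apply: differentiableM => //.
  by have [] := IHe i.
rewrite PE; apply: is_derive_eq.
  by apply: is_derive_sum => i; apply: is_deriveM; have [] := IHe i.
rewrite /GRing.scale /= big_split /= -/(P _ _) addrC.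
have {1}-> : \sum_(i < d) P k (e i :: ws) y * w 0 i = P k (w :: ws) y.
  rewrite /P (Dk_move p) //; last by rewrite size_nseq; lia.
  rewrite [in RHS](row_sum_delta w) (Dk_sum_scale p) //; last by rewrite size_cat size_nseq;
    lia.
  apply: eq_bigr => i _; rewrite mulrC; congr (_ * _).
  by rewrite (Dk_move p) // size_nseq; lia.
have -> : \sum_(i < d) (y - x) 0 i * 'D_w (P k (e i :: ws)) y = k%:R * P k (w :: ws) y.
  transitivity (k%:R * \sum_(i < d) (y - x) 0 i * P k.-1 [:: w, e i & ws] y).
    rewrite mulr_sumr; apply: eq_bigr => i _; have [dP _] := IHe i.
    by rewrite (@derive_val _ _ _ _ _ _ _ dP) mulrCA.
  case: (k) hk => [|k'] hk'; first by rewrite !mul0r.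
  congr (_ * _); rewrite /P /=.
  transitivity (Dk phi (\sum_(i < d) (y - x) 0 i *: e i :: nseq k' (y - x) ++ w :: ws) x);
    last first.
    by rewrite -row_sum_delta.
  rewrite (Dk_sum_scale p) //; last by rewrite size_cat size_nseq /=; lia.
  apply: eq_bigr => i _; congr (_ * _).
  rewrite -cat_rcons (Dk_move p) //; last by rewrite size_rcons size_nseq; lia.
  by rewrite /= cat_rcons.
by rewrite -natr1 mulrDl mul1r addrC.
Qed.

Lemma is_derive_taylor_poly p phi x n hs y w : smooth p phi ->
  (n.+1 + size hs <= p)%N ->
  is_derive y w (taylor n.+1 (Dk phi hs) x) (taylor n (Dk phi (w :: hs)) x y).
Proof.
move=> sp hp.
pose P j (vs : seq V) (z : V) := Dk phi (nseq j (z - x) ++ vs) x.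
have -> : taylor n.+1 (Dk phi hs) x =
    cst (Dk phi hs x) + \sum_(k < n.+1) ((k.+1)`!%:R^-1 \*: P k.+1 hs).
  apply/funext => z; rewrite taylorE big_ord_recl /= fact0 divr1 fctE fct_sumE.
  by congr (_ + _); apply: eq_bigr => k _; rewrite -Dk_cat mulrC.
have dP (k : 'I_n.+1) : is_derive y w (P k.+1 hs) (k.+1%:R * P k (w :: hs) y).
  by have [] := Dk_power p phi x k.+1 hs sp ltac:(have := ltn_ord k; lia) y w.
apply: is_derive_eq.
rewrite taylorE add0r; apply: eq_bigr => k _.
rewrite -Dk_cat -[_ *: _]/(_ * _) factS natrM invfM mulrAC mulKf ?pnatr_eq0 //.
Qed.

Lemma differentiable_taylor p phi x n hs y : smooth p phi ->
  (n + size hs <= p)%N -> differentiable (taylor n (Dk phi hs) x) y.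
Proof.
move=> sp hp.
pose P j (vs : seq V) (z : V) := Dk phi (nseq j (z - x) ++ vs) x.
have -> : taylor n (Dk phi hs) x = \sum_(k < n.+1) (k`!%:R^-1 \*: P k hs).
  apply/funext => z; rewrite taylorE fct_sumE.
  by apply: eq_bigr => k _; rewrite -Dk_cat mulrC.
apply: differentiable_sum => k; apply: differentiableZ.
by have [] := Dk_power p phi x k hs sp ltac:(have := ltn_ord k; lia) y 0.
Qed.

Lemma Dk_taylor p phi x hs : smooth p phi -> (size hs <= p)%N ->
  Dk (taylor p phi x) hs = taylor (p - size hs) (Dk phi hs) x.
Proof.
move=> sp; elim: hs => [|h hs IH] /= hp; first by rewrite subn0.
rewrite IH ?(ltnW hp) //; apply/funext => y.
rewrite -[(p - size hs)%N]prednK ?subn_gt0 // subnS.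
rewrite (@derive_val _ _ _ _ _ _ _ (is_derive_taylor_poly p phi x (p - size hs).-1 hs y h sp
  _)) //; lia.
Qed.

(** The derivatives of order p of the Taylor polynomial are constant, so in a subproblem only the
    regularization and g contribute to the Lipschitz constant. *)
Lemma lip_deriv_taylor p phi x : smooth p phi -> lip_deriv p 0 (taylor p phi x).
Proof.
move=> sp; split=> [hs y hp|hs y z hp].
  by rewrite (Dk_taylor p) ?(ltnW hp) //; apply: (differentiable_taylor p) => //; lia.
by rewrite (Dk_taylor p) ?hp // subnn !taylorE !big_ord1 subrr normr0 !mul0r.
Qed.

(** The scalar Taylor formula along the segment from x to y. The fixed directions [hs] make it an
    estimate for derivatives as well: one direction gives the error of the gradient, two that of the
    Hessian. *)
Lemma taylor_error p (L : R) phi x y hs n : lip_deriv p L phi -> (n + size hs)%N = p ->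
  `|Dk phi hs y - taylor n (Dk phi hs) x y| <=
    L * enorm (y - x) ^+ n.+1 * \prod_(h <- hs) enorm h / n.+1`!%:R.
Proof.
move=> lp hp; pose h := y - x; pose u k (t : R) := Dk phi (nseq k h ++ hs) (x + t *: h).
have := @taylor_remainder R u n (L * enorm (y - x) ^+ n.+1 * \prod_(h <- hs) enorm h) _ _ 1
  ler01.
rewrite expr1n mulr1 /u scale1r scale0r addr0 /h [x + (y - x)]addrC subrK taylorE.
have -> : \sum_(k < n.+1) Dk phi (nseq k (y - x) ++ hs) x * 1 ^+ k / k`!%:R =
  \sum_(k < n.+1) Dk (Dk phi hs) (nseq k (y - x)) x / k`!%:R.
  by apply: eq_bigr => k _; rewrite Dk_cat expr1n mulr1.
apply=> [k t hk|t t0].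
  apply: is_derive_line; apply: diff_derivable; apply: lp.1.
  by rewrite size_cat size_nseq; lia.
rewrite (le_trans (lp.2 _ _ _ _)) ?size_cat ?size_nseq //.
rewrite ?scale0r ?addr0 addrC addKr enormZ ger0_norm // big_cat /= big_nseq iter_mulr_1.
by rewrite exprS !mulrA; move: (\prod_(_ <- _) _) (enorm _) (_ ^+ n) => a b c; apply/ler_eq;
  ring.
Qed.

End Smooth.

(** * Stability of the smoothness class and first-order conditions *)

Section Closure.
Context {R : realType} {d : nat}.
Local Notation V := 'rV[R]_d.
Implicit Types (phi psi f g : V -> R) (x y h w : V) (hs ws : seq V) (p : nat).

Lemma DkD p f g hs : smooth p f -> smooth p g -> (size hs <= p)%N ->
  Dk (fun x => f x + g x) hs = fun x => Dk f hs x + Dk g hs x.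
Proof.
move=> sf sg; elim: hs => //= h hs IH hp; rewrite IH ?(ltnW hp) //.
apply/funext => x; rewrite -[fun x => _ + _]/(Dk f hs + Dk g hs).
by rewrite deriveD //; apply: diff_derivable; [apply: sf.1 | apply: sg.1].
Qed.

Lemma DkZ p (c : R) f hs : smooth p f -> (size hs <= p)%N ->
  Dk (fun x => c * f x) hs = fun x => c * Dk f hs x.
Proof.
move=> sf; elim: hs => //= h hs IH hp; rewrite IH ?(ltnW hp) //.
apply/funext => x; rewrite -[fun x => _ * _]/(c \*: Dk f hs).
by rewrite deriveZ //; apply: diff_derivable; apply: sf.1.
Qed.

Lemma Dk_translate f x0 hs : Dk (fun x => f (x - x0)) hs = fun x => Dk f hs (x - x0).
Proof.
elim: hs => //= h hs ->; apply/funext => x; exact: derive_translate.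
Qed.

Lemma lip_derivD p (L M : R) f g : lip_deriv p L f -> lip_deriv p M g ->
  lip_deriv p (L + M) (fun x => f x + g x).
Proof.
move=> lf lg; have sf := lip_deriv_smooth _ _ _ lf; have sg := lip_deriv_smooth _ _ _ lg.
split=> [hs x hp|hs x y hp].
  by rewrite (DkD p) ?(ltnW hp) //; apply: differentiableD; [apply: sf.1 | apply: sg.1].
rewrite (DkD p) ?hp // opprD addrACA !mulrDl (le_trans (ler_normD _ _)) //.
by rewrite lerD // ?lf.2 ?lg.2.
Qed.

Lemma lip_derivZ p (c L : R) f : 0 <= c -> lip_deriv p L f ->
  lip_deriv p (c * L) (fun x => c * f x).
Proof.
move=> c0 lf; have sf := lip_deriv_smooth _ _ _ lf.
split=> [hs x hp|hs x y hp].
  by rewrite (DkZ p) ?(ltnW hp) //; apply: differentiableZ; apply: sf.1.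
by rewrite (DkZ p) ?hp // -mulrBr normrM ger0_norm // -!mulrA ler_wpM2l // mulrA lf.2.
Qed.

Lemma lip_deriv_translate p (L : R) f x0 : lip_deriv p L f ->
  lip_deriv p L (fun x => f (x - x0)).
Proof.
move=> lf; split=> [hs x hp|hs x y hp]; rewrite Dk_translate.
  by apply: differentiable_translate; apply: lf.1.
by rewrite (le_trans (lf.2 _ _ _ hp)) // opprB addrA subrK.
Qed.

(** The derivative is computed as a limit from the right, so difference quotients need to be
    controlled only for t in (0, 1]; this serves both convexity and minimality. *)
Lemma derive_le_slope f x w m : derivable f x w ->
  (forall t, 0 < t -> t <= 1 -> f (x + t *: w) - f x <= t * m) -> 'D_w f x <= m.
Proof.
move=> df hm; pose q (h : R) := h^-1 *: (f (h *: w + x) - f x).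
have -> : 'D_w f x = lim (q h @[h --> 0^'+])%classic by apply: (cvg_at_rightE q 0).
apply: limr_le.
  rewrite -(cvg_at_rightE q 0) //; apply: cvg_trans df; apply: cvg_app.
  move=> A [e egt0 Ae]; exists e => // z ze zgt0; apply: Ae => //.
  exact/lt0r_neq0.
near=> h; have h0 : 0 < h by near: h; exists 1 => /=.
rewrite /q -[_ *: _]/(_ * _) ler_pdivrMl // [h *: w + x]addrC; apply: hm => //.
by near: h; apply: nbhs_right_le.
Unshelve. all: end_near. Qed.

Lemma convex_function_tangent f x y : convex_function setT f -> differentiable f x ->
  f x + 'D_(y - x) f x <= f y.
Proof.
move=> cf df; rewrite -lerBrDl; apply: derive_le_slope; first exact: diff_derivable.
move=> t t0 t1.
have h : f (t *: y + (1 - t) *: x) <= t * f y + (1 - t) * f x.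
  by apply: (cf (Itv01 (ltW t0) t1) y x); rewrite in_setT.
have -> : x + t *: (y - x) = t *: y + (1 - t) *: x.
  by rewrite scalerBr scalerBl scale1r addrCA.
by move: h; move: (f _) (f _) (f _) => a b c; lra.
Qed.

Lemma minimizer_derive f x w : minimizer f x -> differentiable f x -> 'D_w f x = 0.
Proof.
move=> mf df.
have dN v : 'D_v (- f) x = - 'D_v f x by rewrite deriveN //; exact: diff_derivable.
have le0 v : 0 <= 'D_v f x.
  rewrite -oppr_le0 -dN; apply: derive_le_slope => [|t _ _].
    by apply: diff_derivable; exact: differentiableN.
  by rewrite mulr0 subr_le0 lerN2; exact: mf.
apply/eqP; rewrite eq_le le0 andbT.
by have := le0 (- w); rewrite !deriveE // linearN oppr_ge0.
Qed.

Lemma minimizer_grad f x : minimizer f x -> differentiable f x -> grad f x = 0.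
Proof.
by move=> mf df; apply/rowP => i; rewrite !mxE minimizer_derive.
Qed.

Lemma gradD f g x : differentiable f x -> differentiable g x ->
  grad (fun x => f x + g x) x = grad f x + grad g x.
Proof.
move=> df dg; apply/rowP => i; rewrite !mxE -[fun x => _ + _]/(f + g).
by rewrite deriveD //; exact: diff_derivable.
Qed.

End Closure.

(** * Powers of the norm *)

(** The formulas for the derivatives of powers of the norm divide by the norm; this takes their
    place at the origin. *)
Lemma quadratic_differentiable0 {R : realType} {V : normedModType R} (u : V -> R) (c : R) :
  (forall x, `|x| <= 1 -> `|u x| <= c * `|x| ^+ 2) ->
  differentiable u 0 /\ 'd u 0 = 0 :> (V -> R).
Proof.
move=> hu.
have u0 : u 0 = 0.
  by apply/eqP; rewrite -normr_le0 (le_trans (hu 0 _)) ?normr0 // expr0n mulr0.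
have [H0 H1] : continuous (0 : V -> R) /\ u \o shift 0 = cst (u 0) + \0 +o_ (0 : V) id.
  split; first exact: cst_continuous.
  apply/eqaddoP => e e0.
  have m0 : 0 < `|c| + 1 by rewrite ltr_wpDl.
  apply/nbhs_ballP; exists (Num.min 1 (e / (`|c| + 1))).
    by rewrite /= lt_min ltr01 divr_gt0.
  move=> y; rewrite -ball_normE /= sub0r normrN lt_min ltr_pdivlMr // => /andP[y1 hy].
  rewrite !fctE /= addr0 u0 addr0 subr0 (le_trans (hu y (ltW y1))) // expr2 mulrA.
  rewrite ler_wpM2r // (le_trans _ (ltW hy)) // mulrC ler_wpM2l //.
  by rewrite (le_trans (ler_norm c)) // lerDl.
have D : 'd u 0 = 0 :> (V -> R) by apply/diff_unique.
by split => //; apply/diff_locallyP; rewrite D.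
Qed.

Lemma radial_derivative_identity {R : realType} (e b : R) (q j : nat) : e != 0 ->
  e ^+ q * (- (e ^+ 2) ^+ j ^- 2 * (j%:R * (e ^+ 2) ^+ j.-1 * (2 * b))) +
  (e ^+ 2) ^- j * (q%:R * e ^+ q.-1 * (b / e)) =
  (q%:R - 2 * j%:R) * b * (e ^+ q / (e ^+ 2) ^+ j.+1).
Proof.
move=> e0; have Q0 : e ^+ q.-1 != 0 by rewrite expf_neq0.
have J0 : (e ^+ 2) ^+ j.-1 != 0 by rewrite !expf_neq0.
case: q j Q0 J0 => [|q] [|j] /=; rewrite ?(exprS _ j.+1) ?(exprS _ j) ?(exprS _ q) ?expr0.
- by move=> _ _; field.
- by move: ((e ^+ 2) ^+ j) => J _ J0; field; rewrite J0.
- by move: (e ^+ q) => Q _ _; field.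
- by move: ((e ^+ 2) ^+ j) (e ^+ q) => J Q _ J0; field; rewrite J0.
Qed.

Section NormPower.
Context {R : realType} {d : nat}.
Local Notation V := 'rV[R]_d.
Implicit Types (phi u v : V -> R) (x y w : V) (l : seq V).

Lemma derive_eq_is_derive u x w (c : R) : differentiable u x -> 'D_w u x = c ->
  is_derive x w u c.
Proof. by move=> du e; split => //; exact: diff_derivable. Qed.

Lemma quadratic_derive0 u (c : R) n : (forall x, `|u x| <= c * enorm x ^+ n.+2) ->
  differentiable u 0 /\ forall w, 'D_w u 0 = 0.
Proof.
move=> hu; pose k : R := Num.sqrt d%:R.
have [x x1|du D] := @quadratic_differentiable0 R V u (`|c| * k ^+ n.+2).
  rewrite (le_trans (hu x)) //.
  apply: le_trans (_ : `|c| * (k * `|x|) ^+ n.+2 <= _).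
    rewrite (le_trans (ler_wpM2r (exprn_ge0 _ (enorm_ge0 _)) (ler_norm c))) // ler_wpM2l //.
    by rewrite lerXn2r ?nnegrE ?enorm_ge0 ?mulr_ge0 ?sqrtr_ge0 // enorm_le_normr.
  rewrite exprMn mulrA ler_wpM2l //.
    by apply: mulr_ge0 => //; apply: exprn_ge0; exact: sqrtr_ge0.
  by rewrite -addn2 exprD ler_piMl ?exprn_ge0 // exprn_ile1.
by split => // w; rewrite deriveE // D.
Qed.

Lemma differentiable_dotp a x : differentiable (fun z => dotp z a) x.
Proof.
have -> : (fun z => dotp z a) = \sum_(i < d) (a 0 i \*: (fun z : V => z 0 i)).
  by apply/funext => z; rewrite fct_sumE; apply: eq_bigr => i _; rewrite mulrC.
apply: differentiable_sum => i; apply: differentiableZ; exact: differentiable_coord.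
Qed.

Lemma derive_dotp a x w : is_derive x w (fun z => dotp z a) (dotp w a).
Proof.
have da z := differentiable_dotp a z.
apply: derive_eq_is_derive => //; rewrite deriveE //.
pose pr : V -> R := fun z => dotp z a.
have lp : linear pr by move=> c u v; rewrite /pr dotpDl dotpZl.
pose L := GRing.isLinear.Build R V R *%R pr lp.
pose prL : {linear V -> R} := HB.pack pr L.
rewrite (@diff_lin _ _ _ prL) // => z; exact: differentiable_continuous.
Qed.

Lemma is_derive_dotpp x w :
  is_derive x w (fun z => dotp z z) (2 * dotp x w) /\ differentiable (fun z => dotp z z) x.
Proof.
have -> : (fun z => dotp z z) = \sum_(i < d) ((fun z : V => z 0 i) * (fun z : V => z 0 i)).
  by apply/funext => z; rewrite fct_sumE.
have dc (i : 'I_d) : differentiable (fun z : V => z 0 i) x by exact: differentiable_coord.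
have Dc (i : 'I_d) : is_derive x w (fun z : V => z 0 i) (w 0 i).
  by have := derive_dotp (delta_mx 0 i) x w; rewrite dotp_delta;
    under eq_fun do rewrite dotp_delta.
split; last by apply: differentiable_sum => i; apply: differentiableM.
apply: is_derive_eq; rewrite /dotp mulr_sumr; apply: eq_bigr => i _.
by rewrite /GRing.scale /= mulr_natl mulr2n.
Qed.

(** The power |x|^(q - 2j), whose exponent may be negative. Differentiation keeps q and raises j;
    the factor <x, w> that appears goes into a separate product. *)
Definition radial (q j : nat) x : R := enorm x ^+ q / dotp x x ^+ j.

Lemma is_derive_radial q j x w : x != 0 ->
  is_derive x w (radial q j) ((q%:R - 2 * j%:R) * dotp x w * radial q j.+1 x) /\
  differentiable (radial q j) x.
Proof.
move=> x0; have e0 := enorm_gt0 _ x0.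
have n0 : 0 < dotp x x by rewrite -enormE exprn_gt0.
have [Dn dn] := is_derive_dotpp x w.
have ds : differentiable (Num.sqrt : R -> R) (dotp x x).
  by apply/derivable1_diffP; have [] := is_derive1_sqrt n0.
have de : differentiable enorm x.
  exact: (differentiable_comp dn ds).
have De : is_derive x w enorm (dotp x w / enorm x).
  apply: derive_eq_is_derive => //.
  have : 'D_w ((enorm : V -> R) * enorm) x = 2 * dotp x w.
    have -> : (enorm : V -> R) * enorm = (fun z => dotp z z).
      by apply/funext => z; rewrite fctE -enormE expr2.
    exact: derive_val.
  rewrite deriveM; [|exact: diff_derivable..].
  rewrite /GRing.scale /= => h.
  have {}h : enorm x * 'D_w enorm x = dotp x w.
    by move: h; move: (enorm x * _) (dotp x w) => a b; lra.
  by rewrite -h mulrC mulKf // gt_eqF.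
have Dj : is_derive x w ((fun z => dotp z z) ^+ j) (j%:R * dotp x x ^+ j.-1 * (2 * dotp x w)).
  by apply: is_derive_eq.
have dj : differentiable ((fun z => dotp z z) ^+ j : V -> R) x.
  by case: (j) => [|j']; [rewrite expr0; exact: differentiable_cst | exact: differentiableX].
have nj : ((fun z => dotp z z) ^+ j : V -> R) x != 0 by rewrite fctE expf_neq0 // gt_eqF.
have Dq : is_derive x w (enorm ^+ q) (q%:R * enorm x ^+ q.-1 * (dotp x w / enorm x)).
  by apply: is_derive_eq.
have dq : differentiable (enorm ^+ q : V -> R) x.
  by case: (q) => [|q']; [rewrite expr0; exact: differentiable_cst | exact: differentiableX].
have E : radial q j = (enorm ^+ q) * (fun z => (((fun z => dotp z z) ^+ j : V -> R) z)^-1).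
  by apply/funext => z; rewrite /radial !fctE.
have dr : differentiable (radial q j) x.
  by rewrite E; apply: differentiableM => //; exact: differentiableV.
split => //; apply: derive_eq_is_derive => //.
rewrite E deriveM; [|exact: diff_derivable | by apply: diff_derivable; exact: differentiableV].
rewrite deriveV //.
rewrite !derive_val !fctE /radial /GRing.scale /= -!enormE.
exact/radial_derivative_identity/lt0r_neq0.
Qed.

(* [N] bounds the size of the terms and [B] the sum of their norms. Directional
   derivatives stay in this class, with bounds that do not depend on the dimension. *)
Inductive homog (q : nat) : nat -> nat -> R -> (V -> R) -> Prop :=
| homog0 N deg : homog q N deg 0 (fun=> 0)
| homog_term N deg (c : R) j l : (size l + j <= N)%N -> (q + size l = deg + 2 * j)%N ->
    homog q N deg (`|c| * \prod_(a <- l) enorm a)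
      (fun x => c * radial q j x * \prod_(a <- l) dotp x a)
| homogD N deg B1 B2 u v : homog q N deg B1 u -> homog q N deg B2 v ->
    homog q N deg (B1 + B2) (fun x => u x + v x)
| homogW N deg B1 B2 u : B1 <= B2 -> homog q N deg B1 u -> homog q N deg B2 u.

Lemma prod_enorm_ge0 l : 0 <= \prod_(a <- l) enorm a.
Proof. by apply: prodr_ge0 => a _; exact: enorm_ge0. Qed.

Lemma prod_dotp_le l x :
  `|\prod_(a <- l) dotp x a| <= enorm x ^+ size l * \prod_(a <- l) enorm a.
Proof.
elim: l => [|a l IH]; first by rewrite !big_nil expr0 mul1r normr1.
rewrite !big_cons normrM exprS mulrACA ler_pM //; exact: normr_dotp_le.
Qed.

Lemma homog_bound q N deg B u x : (0 < q)%N -> homog q N deg B u ->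
  `|u x| <= B * enorm x ^+ deg.
Proof.
move=> q0; elim=> {N deg B u} [N deg|N deg c j l _ e|N deg B1 B2 u v _ IHu _ IHv|N deg B1 B2
  u h _ IH].
- by rewrite normr0 mul0r.
- have [->|x0] := eqVneq x 0.
    rewrite /radial enorm0 expr0n gtn_eqF // mul0r mulr0 mul0r normr0.
    by rewrite !mulr_ge0 ?exprn_ge0 ?prod_enorm_ge0 ?enorm_ge0.
  have e0 := enorm_gt0 _ x0.
  have -> : enorm x ^+ deg = radial q j x * enorm x ^+ size l.
    rewrite /radial -enormE -exprM mulrAC -exprD e exprD mulfK //.
    by rewrite expf_neq0 // gt_eqF.
  have r0 : 0 <= radial q j x by rewrite /radial -enormE divr_ge0 // !exprn_ge0 // enorm_ge0.
  have := prod_dotp_le l x; move: (radial q j x) r0 => rho r0 hP.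
  rewrite !normrM (ger0_norm r0) -!mulrA ler_wpM2l // [leRHS]mulrCA.
  by rewrite ler_wpM2l // mulrC.
- by rewrite mulrDl (le_trans (ler_normD _ _)) // lerD.
- by rewrite (le_trans IH) // ler_wpM2r // exprn_ge0 // enorm_ge0.
Qed.

Lemma homog_at0 q N deg B u : (0 < q)%N -> homog q N deg B u -> u 0 = 0.
Proof.
move=> q0; elim=> {N deg B u} // [N deg c j l _ _|N deg B1 B2 u v _ -> _ ->].
  by rewrite /radial enorm0 expr0n gtn_eqF // mul0r mulr0 mul0r.
by rewrite addr0.
Qed.

Fixpoint prod_dotp_derive w l x : R :=
  if l is a :: l' then
    dotp x a * prod_dotp_derive w l' x + (\prod_(a <- l') dotp x a) * dotp w a
  else 0.

Lemma is_derive_prod_dotp l x w :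
  is_derive x w (fun z => \prod_(a <- l) dotp z a) (prod_dotp_derive w l x) /\
  differentiable (fun z => \prod_(a <- l) dotp z a) x.
Proof.
elim: l => [|a l [IH1 IH2]].
  have -> : (fun z : V => \prod_(a <- [::]) dotp z a) = cst (1 : R).
    by apply/funext => z; rewrite big_nil.
  by split; [exact: is_derive_cst | exact: differentiable_cst].
have -> : (fun z : V => \prod_(a <- a :: l) dotp z a) =
  (fun z => dotp z a) * (fun z => \prod_(a <- l) dotp z a).
  by apply/funext => z; rewrite big_cons.
have da := derive_dotp a x w.
split; last by apply: differentiableM => //; exact: differentiable_dotp.
exact: is_deriveM.
Qed.

(** [pre] holds the factors that the product rule has already passed over: differentiating the
    factor of [a] leaves the list [pre ++ l]. *)
Lemma homog_prod_dotp_derive q N deg (c : R) j w l pre :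
  (size pre + size l + j <= N)%N -> (q + size pre + size l = deg.+1 + 2 * j)%N ->
  homog q N deg ((size l)%:R *
      (`|c| * enorm w * \prod_(a <- pre) enorm a * \prod_(a <- l) enorm a))
    (fun x => c * radial q j x * (\prod_(a <- pre) dotp x a) * prod_dotp_derive w l x).
Proof.
elim: l pre => [|a l IH] pre /= h1 h2.
  rewrite mul0r.
  have -> : (fun x => c * radial q j x * (\prod_(a <- pre) dotp x a) * 0) = fun=> 0.
    by apply/funext => x; rewrite mulr0.
  exact: homog0.
have H1 := IH (a :: pre) ltac:(move=> /=; lia) ltac:(move=> /=; lia).
have H2 := homog_term q N deg (c * dotp w a) j (pre ++ l)
  ltac:(rewrite size_cat; lia) ltac:(rewrite size_cat; lia).
have -> : (fun x => c * radial q j x * (\prod_(a <- pre) dotp x a) *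
    (dotp x a * prod_dotp_derive w l x + (\prod_(a0 <- l) dotp x a0) * dotp w a)) =
  (fun x => (c * radial q j x * (\prod_(a <- a :: pre) dotp x a) * prod_dotp_derive w l x) +
    (c * dotp w a * radial q j x * \prod_(a <- pre ++ l) dotp x a)).
  apply/funext => x; rewrite big_cons big_cat /=.
  by move: (radial q j x) (prod_dotp_derive w l x) (dotp x a) (dotp w a) (\prod_(a <- pre) _)
    (\prod_(a <- l) _) => *; ring.
apply: homogW (homogD q _ _ _ _ _ _ H1 H2).
rewrite big_cons big_cat big_cons /= normrM.
have h := normr_dotp_le w a.
have p0 : 0 <= `|c| * (\prod_(a <- pre) enorm a * \prod_(a <- l) enorm a).
  by rewrite !mulr_ge0 // prod_enorm_ge0.
have := ler_wpM2l p0 h; rewrite -natr1.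
by move: (\prod_(a <- pre) _) (\prod_(a <- l) _) (enorm w) (enorm a) `|c| `|dotp w a|
  (size l)%:R => P L W A C D S; lra.
Qed.

(** For a single term the radial factor contributes |q - 2j| and each of the [size l] linear factors
    contributes 1. Since [size l + j] is at most N, the total is at most q + 2N. *)
Lemma homog_derive q N deg B u w : (0 < q)%N -> homog q N deg.+1 B u ->
  exists2 u', homog q N.+2 deg ((q + 2 * N)%:R * enorm w * B) u' &
    forall x, x != 0 -> is_derive x w u (u' x) /\ differentiable u x.
Proof.
move=> q0; move E: deg.+1 => D h.
elim: h E => {N D B u} [N D _|N D c j l hN e E|N D B1 B2 u v _ IHu _ IHv E
  |N D B1 B2 u h _ IH E].
- exists (fun=> 0); first by rewrite mulr0; exact: homog0.
  by move=> x _; split; [exact: is_derive_cst | exact: differentiable_cst].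
- exists (fun x => c * (q%:R - 2 * j%:R) * radial q j.+1 x * (\prod_(a <- w :: l) dotp x a)
     + (c * radial q j x * (\prod_(a <- [::]) dotp x a) * prod_dotp_derive w l x)).
    have H1 := homog_term q N.+2 deg (c * (q%:R - 2 * j%:R)) j.+1 (w :: l)
       ltac:(move=> /=; lia) ltac:(move=> /=; lia).
    have H2 := homog_prod_dotp_derive q N.+2 deg c j w l [::]
       ltac:(move=> /=; lia) ltac:(move=> /=; lia).
    apply: homogW (homogD q _ _ _ _ _ _ H1 H2).
    rewrite big_cons big_nil normrM.
    have h1 : `|q%:R - 2 * j%:R| <= (q + 2 * j)%:R :> R.
      by rewrite natrD natrM (le_trans (ler_normB _ _)) // normrM !normr_nat.
    have h2 : (q + 2 * j)%:R + (size l)%:R <= (q + 2 * N)%:R :> R.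
      by rewrite -natrD ler_nat; lia.
    have p0 : 0 <= `|c| * enorm w * \prod_(a <- l) enorm a.
      by rewrite !mulr_ge0 ?prod_enorm_ge0 ?enorm_ge0.
    have := ler_wpM2l p0 (le_trans (lerD h1 (lexx _)) h2).
    by move: (\prod_(a <- l) _) (enorm w) `|c| `|_| (size l)%:R => P W C A S; lra.
  move=> x x0; have [D1 d1] := is_derive_radial q j x w x0.
  have [D2 d2] := is_derive_prod_dotp l x w.
  have -> : (fun x => c * radial q j x * \prod_(a <- l) dotp x a) =
     c \*: (radial q j * (fun x => \prod_(a <- l) dotp x a)).
    by apply/funext => z /=; rewrite -mulrA.
  split; last by apply: differentiableZ; exact: differentiableM.
  apply: is_derive_eq; rewrite big_nil big_cons /GRing.scale /=.
  rewrite (dotpC x w); move: (radial _ _ _) (radial _ _ _) (prod_dotp_derive w l x)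
    (dotp w x) (\prod_(a <- l) _) => r1 r2 p dd P.
  by rewrite ?(dotpC w x); ring.
- have [u' hu' Du] := IHu E; have [v' hv' Dv] := IHv E.
  exists (fun x => u' x + v' x); first by rewrite mulrDr; exact: homogD.
  move=> x x0; have [? ?] := Du x x0; have [? ?] := Dv x x0.
  by split; [exact: (@is_deriveD _ _ _ u v) | exact: (@differentiableD _ _ _ u v)].
- have [u' hu' Du] := IH E; exists u' => //; apply: homogW hu'.
  by rewrite ler_wpM2l // mulr_ge0 // enorm_ge0.
Qed.

End NormPower.

Section NormPowerDerivatives.
Context {R : realType} {d : nat}.
Local Notation V := 'rV[R]_d.
Implicit Types (phi u v : V -> R) (x y w : V) (l hs : seq V).

(** Degree at least 2 makes u quadratically small at 0, so its derivative there is 0, which is also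
    the value of [u'] at 0: the formula found away from the origin holds everywhere. *)
Lemma homog_derivable q N deg B u w : (0 < q)%N -> homog q N deg.+2 B u ->
  homog q N.+2 deg.+1 ((q + 2 * N)%:R * enorm w * B) ('D_w u) /\
  forall x, differentiable u x.
Proof.
move=> q0 hu; have [u' hu' D] := homog_derive q N deg.+1 B u w q0 hu.
have [d0 D0] := quadratic_derive0 u B deg (fun x => homog_bound _ _ _ _ _ x q0 hu).
split.
  have -> // : 'D_w u = u'.
  apply/funext => x; have [->|x0] := eqVneq x 0.
    by rewrite D0 (homog_at0 _ _ _ _ _ q0 hu').
  by have [h _] := D x x0; exact: derive_val.
by move=> x; have [->//|x0] := eqVneq x 0; have [] := D x x0.
Qed.

(** The product of the factors q + 2N of [homog_derive], with N = 2i after i derivatives. *)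
Definition homog_cst q k : R := \prod_(i < k) (q + 4 * i)%:R.

Lemma homog_cst_ge0 q k : 0 <= homog_cst q k.
Proof. by apply: prodr_ge0. Qed.

Lemma homog_Dk p hs : (size hs <= p)%N ->
  homog p.+1 (2 * size hs) (p.+1 - size hs) (homog_cst p.+1 (size hs) * \prod_(h <- hs) enorm h)
    (Dk (fun x => enorm x ^+ p.+1) hs).
Proof.
elim: hs => [_|h hs IH] /=.
  have -> : (fun x : V => enorm x ^+ p.+1) =
      fun x => 1 * radial p.+1 0 x * \prod_(a <- [::]) dotp x a.
    by apply/funext => x; rewrite big_nil /radial expr0 divr1 mul1r mulr1.
  rewrite /homog_cst big_ord0 -[X in homog _ _ _ (X * _)](normr1 R).
  by apply: homog_term => /=; lia.
move=> hp; have := IH (ltnW hp).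
have -> : (p.+1 - size hs = (p - size hs).-1.+2)%N by lia.
move=> H; have [] := homog_derivable _ _ _ _ _ h (ltn0Sn p) H.
have -> : ((2 * size hs).+2 = 2 * (size hs).+1)%N by lia.
have -> : ((p - size hs).-1.+1 = p.+1 - (size hs).+1)%N by lia.
move=> H' _; apply: homogW H'.
rewrite big_cons /homog_cst big_ord_recr /= mulnA /=.
by apply/ler_eq; move: (_%:R) (\prod_(_ <- _) _) (\prod_(_ < _) _) => a b c; ring.
Qed.

(** Degree 1 is what is left after p derivatives of |x|^(p+1), and such a function may fail to be
    differentiable at 0. If the segment from z to y meets 0, then |y| + |z| = |y - z| and the
    homogeneous bound suffices; otherwise the mean value theorem applies along the segment. *)
Lemma homog_lipschitz q N (B : R) u y z : (0 < q)%N -> 0 <= B -> homog q N 1 B u ->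
  `|u y - u z| <= (q + 2 * N)%:R * B * enorm (y - z).
Proof.
move=> q0 B0 hu; set K := (q + 2 * N)%:R.
have [[t /andP[t0 t1] e]|hn] := pselect (exists2 t : R, 0 <= t <= 1 & z + t *: (y - z) = 0).
  rewrite (le_trans (ler_normB _ _)) //.
  have bu x := homog_bound _ _ _ _ _ x q0 hu.
  rewrite (le_trans (lerD (bu y) (bu z))) // !expr1 -mulrDr.
  have zE : z = - (t *: (y - z)) by apply/eqP; rewrite -subr_eq0 opprK e.
  have yE : y = (1 - t) *: (y - z).
    by rewrite scalerBl scale1r -zE subrK.
  rewrite {1}yE {2}zE enormN !enormZ (ger0_norm t0) ger0_norm ?subr_ge0 //.
  rewrite -mulrDl subrK mul1r -mulrA ler_peMl ?mulr_ge0 ?enorm_ge0 //.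
  by rewrite /K ler1n; lia.
have [u' hu' D] := homog_derive q N 0 B u (y - z) q0 hu.
pose g (t : R) := u (z + t *: (y - z)).
have Dg (t : R) : 0 <= t <= 1 -> is_derive t 1 g (u' (z + t *: (y - z))).
  move=> ht; have x0 : z + t *: (y - z) != 0 by apply/eqP => e; apply: hn; exists t.
  have [D1 d1] := D _ x0.
  have := is_derive_line u z (y - z) t (@diff_derivable _ _ _ u _ _ d1).
  by rewrite (@derive_val _ _ _ _ _ _ _ D1).
have [t||c] := @MVT R g (fun t => u' (z + t *: (y - z))) 0 1 ltr01.
- by rewrite in_itv /= => /andP[? ?]; apply: Dg; rewrite !ltW.
- apply: continuous_in_subspaceT => t; rewrite inE /= in_itv /= => /Dg Dt.
  by apply: differentiable_continuous; apply/derivable1_diffP; have := Dt.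
rewrite in_itv /= => /andP[c0 c1].
rewrite /g scale1r scale0r addr0 subr0 mulr1 [z + _]addrC subrK => ->.
have := homog_bound _ _ _ _ _ (z + c *: (y - z)) q0 hu'.
by rewrite expr0 mulr1 mulrAC.
Qed.

Lemma lip_deriv_enorm_power p : (0 < p)%N ->
  lip_deriv p (homog_cst p.+1 p.+1) (fun x : V => enorm x ^+ p.+1).
Proof.
move=> p0; split=> [hs x hp|hs y z hp].
  have := homog_Dk p hs (ltnW hp).
  have -> : (p.+1 - size hs = (p - size hs).-1.+2)%N by lia.
  by move=> /homog_derivable H; have [] := H 0 (ltn0Sn p).
have := homog_Dk p hs; rewrite hp subSnn => /(_ (leqnn p)) H.
have := homog_lipschitz _ _ _ _ y z (ltn0Sn p) _ H.
rewrite mulr_ge0 ?homog_cst_ge0 ?prod_enorm_ge0 // => /(_ isT) h.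
rewrite (le_trans h) // /homog_cst [in leRHS]big_ord_recr /= mulnA /=.
by apply/ler_eq; move: (_%:R) (\prod_(_ <- _) _) (\prod_(_ < _) _) (enorm _) => a b c e; ring.
Qed.

Lemma derive_enorm_power n x w :
  differentiable (fun x => enorm x ^+ n.+2) x /\
  'D_w (fun x => enorm x ^+ n.+2) x = n.+2%:R * enorm x ^+ n * dotp x w.
Proof.
have [->|x0] := eqVneq x 0.
  have [|d0 D0] := quadratic_derive0 (fun x => enorm x ^+ n.+2) 1 n.
    by move=> y; rewrite mul1r ger0_norm // exprn_ge0 // enorm_ge0.
  by rewrite D0 dot0p mulr0.
have -> : (fun x : V => enorm x ^+ n.+2) = radial n.+2 0.
  by apply/funext => y; rewrite /radial expr0 divr1.
have [D dr] := is_derive_radial n.+2 0 x w x0; split => //.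
rewrite (@derive_val _ _ _ _ _ _ _ D) /radial mulr0 subr0 expr1 -enormE -addn2 exprD.
rewrite mulfK; first by rewrite mulrAC.
by rewrite expf_neq0 // gt_eqF // enorm_gt0.
Qed.

(** The rank-one part of the Hessian, a nonnegative multiple of <x, w>^2, is dropped. *)
Lemma derive2_enorm_power n x w :
  differentiable ('D_w (fun x => enorm x ^+ n.+3)) x /\
  n.+3%:R * enorm x ^+ n.+1 * enorm w ^+ 2 <= 'D_w ('D_w (fun x => enorm x ^+ n.+3)) x.
Proof.
have -> : 'D_w (fun x => enorm x ^+ n.+3) =
    fun x => n.+3%:R * enorm x ^+ n.+1 * dotp x w.
  by apply/funext => z; have [] := derive_enorm_power n.+1 z w.
have [->|x0] := eqVneq x 0.
  have [|d0 D0] := quadratic_derive0 (fun x => n.+3%:R * enorm x ^+ n.+1 * dotp x w) (n.+3%:R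
    * enorm w) n.
    move=> y; rewrite !normrM normr_nat (ger0_norm (exprn_ge0 _ (enorm_ge0 _))).
    rewrite [enorm y ^+ n.+2]exprSr.
    have e0 : 0 <= enorm y ^+ n.+1 by rewrite exprn_ge0 // enorm_ge0.
    move: (enorm y ^+ n.+1) e0 => E E0.
    rewrite -!mulrA ler_wpM2l // [leRHS]mulrCA ler_wpM2l // mulrC.
    exact: normr_dotp_le.
  by rewrite D0 enorm0 expr0n mulr0 mul0r.
have -> : (fun x => n.+3%:R * enorm x ^+ n.+1 * dotp x w) =
    n.+3%:R \*: (radial n.+1 0 * (fun x => dotp x w)).
  have E y : radial n.+1 0 y = enorm y ^+ n.+1 by rewrite /radial expr0 divr1.
  by apply/funext => y; rewrite -mulrA -E.
have [D dr] := is_derive_radial n.+1 0 x w x0.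
have Dd := derive_dotp w x w; have dd := differentiable_dotp w x.
split; first by apply: differentiableZ; exact: differentiableM.
rewrite deriveZ; last by apply: derivableM; exact: diff_derivable.
rewrite deriveM; [|exact: diff_derivable..].
rewrite !derive_val /GRing.scale /= mulr0 subr0 -enormE -mulrA ler_wpM2l //.
rewrite /radial expr0 divr1 lerDl expr1 -enormE.
have -> (a b c : R) : a * (b * a * c) = b * (a * a) * c by ring.
have ? : 0 <= enorm x ^+ n.+1 / enorm x ^+ 2 by rewrite divr_ge0 // exprn_ge0 // enorm_ge0.
by apply: mulr_ge0 => //; apply: mulr_ge0 => //; rewrite -expr2 sqr_ge0.
Qed.

End NormPowerDerivatives.

(** * Uniform convexity of powers of the norm *)

Lemma leq_pow3 n : (3 * n.+2 + 1 <= 3 ^ n.+2)%N.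
Proof. by elim: n => // k; rewrite [(3 ^ k.+3)%N]expnS; lia. Qed.

Section UniformConvexity.
Context {R : realType} {d : nat}.
Implicit Types x y : 'rV[R]_d.

(** The tangent inequality of t^((n+2)/2) between t = a^2 and t = b^2. *)
Lemma power_bregman (a b : R) n : 0 <= a -> 0 <= b ->
  n.+2%:R * a ^+ n * b ^+ 2 <= 2 * b ^+ n.+2 + n%:R * a ^+ n.+2.
Proof.
move=> a0 b0; elim: n => [|n IH]; first by rewrite expr0 mul0r addr0 mulr1.
have := ler_wpM2l a0 IH.
have : 0 <= (b - a) * (2 * b ^+ n.+2 - a ^+ n.+1 * b - a ^+ n.+2).
  have [ab|ba] := leP a b.
    rewrite mulr_ge0 ?subr_ge0 //.
    have h1 : a ^+ n.+1 <= b ^+ n.+1 by rewrite lerXn2r.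
    have h2 : a ^+ n.+2 <= b ^+ n.+2 by rewrite lerXn2r.
    have := ler_wpM2r b0 h1; rewrite -exprSr; lra.
  rewrite mulr_le0 ?subr_le0 ?(ltW ba) //.
  have h1 : b ^+ n.+1 <= a ^+ n.+1 by rewrite lerXn2r // ltW.
  have h2 : b ^+ n.+2 <= a ^+ n.+2 by rewrite lerXn2r // ltW.
  have := ler_wpM2r b0 h1; rewrite -exprSr; lra.
rewrite -[n.+3]addn3 -[n.+2]addn2 -[n.+1]addn1 !natrD !exprD !expr1.
have -> : b ^+ 3 = b ^+ 2 * b by rewrite exprSr.
have -> : a ^+ 3 = a ^+ 2 * a by rewrite exprSr.
rewrite !expr2; move: (a ^+ n) (b ^+ n) (n%:R) => A B N; lra.
Qed.

(** Here a, b, D, s stand for |x|, |y|, |y - x| and <x, y - x>. [power_bregman] leaves a surplus of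
    (n+2)/2 times a^n D^2, and D <= 4a makes a^n D^2 at least D^(n+2) / 4^n. *)
Lemma power_unif_convex_small (a b D s : R) n : 0 <= a -> 0 <= b -> 0 <= D ->
  D <= 4 * a -> b ^+ 2 = a ^+ 2 + 2 * s + D ^+ 2 ->
  a ^+ n.+2 + n.+2%:R * a ^+ n * s + D ^+ n.+2 / 4 ^+ n.+2 <= b ^+ n.+2.
Proof.
move=> a0 b0 D0 Da e.
have -> : s = (b ^+ 2 - a ^+ 2 - D ^+ 2) / 2 by rewrite e; field.
have h1 := power_bregman a b n a0 b0.
have h2 : D ^+ n / 4 ^+ n <= a ^+ n.
  rewrite ler_pdivrMr ?exprn_gt0 // mulrC -exprMn.
  by rewrite lerXn2r // nnegrE // mulr_ge0.
have h3 := ler_wpM2r (sqr_ge0 D) h2.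
have h4 : 0 <= n%:R * a ^+ n * D ^+ 2 by rewrite !mulr_ge0 // ?sqr_ge0 // exprn_ge0.
have h5 : 0 <= a ^+ n * D ^+ 2 by rewrite mulr_ge0 // ?sqr_ge0 // exprn_ge0.
have E : D ^+ n.+2 / 4 ^+ n.+2 = (D ^+ n / 4 ^+ n * D ^+ 2) / 16.
  by rewrite -addn2 !exprD; field; rewrite expf_neq0.
rewrite E; move: h1 h3 h4 h5; rewrite -addn2 natrD !exprD.
move: (D ^+ n / 4 ^+ n) (a ^+ n) (b ^+ n) (D ^+ 2) (n%:R) => X A B D2 N; lra.
Qed.

(** Now b is at least 3a and at least 3D/4. The cross term and the term in D together are at most
    (3(n+2) + 1) / 3^(n+2) times b^(n+2), and this factor is at most 1 by [leq_pow3]. *)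
Lemma power_unif_convex_large (a b D s : R) n : 0 <= a -> 0 <= b ->
  4 * a <= D -> D - a <= b -> s <= a * b - a ^+ 2 ->
  a ^+ n.+2 + n.+2%:R * a ^+ n * s + D ^+ n.+2 / 4 ^+ n.+2 <= b ^+ n.+2.
Proof.
move=> a0 b0 aD Db hs; have D0 : 0 <= D by lra.
have ba : 3 * a <= b by lra.
have bD : 3 * (D / 4) <= b by lra.
have h1 : 3 ^+ n.+1 * a ^+ n.+1 <= b ^+ n.+1.
  by rewrite -exprMn lerXn2r // nnegrE // mulr_ge0.
have h2 : 3 ^+ n.+2 * (D / 4) ^+ n.+2 <= b ^+ n.+2.
  by rewrite -exprMn lerXn2r // nnegrE // !mulr_ge0.
have h3 : (3 * n.+2 + 1)%:R <= 3 ^+ n.+2 :> R.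
  by rewrite -natrX ler_nat leq_pow3.
have h4 : n.+2%:R * a ^+ n * s <= n.+2%:R * (a ^+ n.+1 * b - a ^+ n.+2).
  apply: le_trans (_ : n.+2%:R * a ^+ n * (a * b - a ^+ 2) <= _).
    by rewrite ler_wpM2l // mulr_ge0 // exprn_ge0.
  have -> : a ^+ n.+2 = a ^+ n * a ^+ 2 by rewrite -exprD addn2.
  by rewrite [a ^+ n.+1]exprSr; move: (a ^+ n) (n.+2%:R) => A N; lra.
have h5 : 0 <= n.+1%:R * a ^+ n.+2 by rewrite mulr_ge0 // exprn_ge0.
have E0 : 0 < 3 ^+ n.+2 :> R by rewrite exprn_gt0.
rewrite -[D ^+ _ / _]expr_div_n -(ler_pM2l E0).
have h6 := ler_wpM2l (ltW E0) h4; have h7 := ler_wpM2l (ltW E0) h5.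
have h8 : n.+2%:R * (3 ^+ n.+1 * a ^+ n.+1 * b) <= n.+2%:R * b ^+ n.+2.
  by rewrite ler_wpM2l // [leRHS]exprSr ler_wpM2r.
have h9 := ler_wpM2r (exprn_ge0 n.+2 b0) h3.
have N2 : n.+2%:R = n.+1%:R + 1 :> R by rewrite natr1.
move: h2 h6 h7 h8 h9; rewrite [3 ^+ n.+2]exprS natrD natrM N2.
move: (n.+1%:R) ((D / 4) ^+ n.+2) (a ^+ n.+2) (a ^+ n) (a ^+ n.+1) (b ^+ n.+2) (3 ^+ n.+1) =>
  N X A2 A0 A1 B E.
lra.
Qed.

Lemma enorm_power_unif_convex n x y :
  enorm x ^+ n.+2 + n.+2%:R * enorm x ^+ n * dotp x (y - x) +
    enorm (y - x) ^+ n.+2 / 4 ^+ n.+2 <= enorm y ^+ n.+2.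
Proof.
have [h|h] := leP (enorm (y - x)) (4 * enorm x).
  apply: power_unif_convex_small => //; rewrite ?enorm_ge0 // !enormE.
  rewrite -{1 2}(subrK x y) (dotpDl (y - x)) !(dotpDr (y - x) x) (dotpC (y - x) x).
  by move: (dotp x x) (dotp x (y - x)) (dotp _ _) => *; ring.
apply: power_unif_convex_large; rewrite ?enorm_ge0 ?(ltW h) //.
  by rewrite lerBlDr (le_trans (enorm_triangle _ _)) // enormN.
by rewrite dotpBr enormE lerB // dotp_le.
Qed.

End UniformConvexity.

(** * The regularized subproblem *)

Lemma factr_neq0 {R : realType} n : n`!%:R != 0 :> R.
Proof. by rewrite pnatr_eq0 -lt0n fact_gt0. Qed.

Section Subproblem.
Context {R : realType} {d : nat}.
Local Notation V := 'rV[R]_d.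
Implicit Types (f g phi : V -> R) (x y w xt : V).

Lemma lip_deriv_differentiable p (L : R) phi x : (0 < p)%N -> lip_deriv p L phi ->
  differentiable phi x.
Proof. by move=> p0 lp; apply: (lp.1 [::]). Qed.

(** Adding the tangent inequalities at two points of the line shows that the derivative along w is
    nondecreasing there. *)
Lemma convex_derive2_ge0 p (L : R) f x w : (2 <= p)%N -> lip_deriv p L f ->
  convex_function setT f -> 0 <= Dk f [:: w; w] x.
Proof.
move=> p2 lf cf.
have df z : differentiable f z by apply: lip_deriv_differentiable lf; lia.
have dwf z : differentiable ('D_w f) z by exact: (lf.1 [:: w]).
pose u (t : R) := 'D_w f (x + t *: w).
have Du : is_derive (0 : R) 1 u (Dk f [:: w; w] x).
  have := is_derive_line ('D_w f) x w 0 (@diff_derivable _ _ _ _ _ _ (dwf _)).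
  by rewrite /= scale0r addr0.
apply: nondecreasing_derive_ge0 Du => s t; rewrite le_eqVlt => /orP[/eqP -> //|st].
have h1 := convex_function_tangent f (x + s *: w) (x + t *: w) cf (df _).
have h2 := convex_function_tangent f (x + t *: w) (x + s *: w) cf (df _).
have E a b : x + a *: w - (x + b *: w) = (a - b) *: w.
  by rewrite opprD addrACA subrr add0r -scalerBl.
move: h1 h2; rewrite !E !derive_scale //.
rewrite /u; move: ('D_w f _) ('D_w f _) (f _) (f _) => a b c e h1 h2.
have : 0 <= (t - s) * (a - b) by lra.
by rewrite pmulr_rge0 ?subr_ge0 // subr_gt0.
Qed.

Definition reg_taylor p (H : R) f xt y : R :=
  taylor p f xt y + H / p`!%:R * enorm (y - xt) ^+ p.+1.

(* The Hessian of the regularization dominates the error of the second-order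
   expansion of [f]. *)
Lemma regularized_taylor_tangent p (L : R) f xt y z : (0 < p)%N -> 0 <= L ->
  lip_deriv p L f -> convex_function setT f ->
  reg_taylor p L f xt y + 'D_(z - y) (reg_taylor p L f xt) y <= reg_taylor p L f xt z.
Proof.
move=> p0 L0 lf cf; pose c := L / p`!%:R.
have c0 : 0 <= c by rewrite divr_ge0.
have sf := lip_deriv_smooth _ _ _ lf.
pose N x : R := enorm (x - xt) ^+ p.+1.
have dT x : differentiable (taylor p f xt) x.
  by apply: (differentiable_taylor p f xt p [::]); rewrite ?addn0.
have [q Eq] : exists q, p = q.+1 by exists p.-1; rewrite prednK.
have dN x : differentiable N x.
  apply: (differentiable_translate (fun x => enorm x ^+ p.+1)).
  by rewrite Eq; have [] := derive_enorm_power q (x - xt) 0.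
have -> : reg_taylor p L f xt = taylor p f xt + c \*: N by [].
set w := z - y.
rewrite deriveD; [|exact: diff_derivable|by apply: diff_derivable; exact: differentiableZ].
rewrite deriveZ; last exact: diff_derivable.
have Dline phi : (forall x, differentiable phi x) -> forall t : R,
    is_derive t 1 (fun t => phi (y + t *: w)) ('D_w phi (y + t *: w)).
  by move=> dphi t; apply: is_derive_line; exact: diff_derivable.
have zE : z = y + w by rewrite /w addrC subrK.
(* For p = 1 the hypotheses give no second derivative of f; there the model is affine and the
   convexity of the squared norm is enough. *)
have [p1|p2] : p = 1%N \/ (2 <= p)%N by lia.
  have T0 x : 'D_w (taylor p f xt) x = 'D_w f xt.
    rewrite p1 (@derive_val _ _ _ _ _ _ _ (is_derive_taylor_poly p f xt 0 [::] x w sf _)) ?p1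
      //.
    by rewrite taylorE big_ord1 /= divr1.
  have := convex_tangent (fun t => taylor p f xt (y + t *: w)) (fun=> 'D_w f xt) (fun=> 0) _
    _ _.
  move=> /(_ _ _ (fun=> lexx _)); rewrite scale1r scale0r addr0 -zE => hT.
  have {}hT : taylor p f xt y + 'D_w f xt <= taylor p f xt z.
    apply: hT => t.
    by rewrite -(T0 (y + t *: w)); exact: Dline.
  have hN : N y + 'D_w N y <= N z.
    have := enorm_power_unif_convex q (y - xt) (z - xt).
    rewrite (derive_translate (fun x => enorm x ^+ p.+1)) Eq.
    have [_ ->] := derive_enorm_power q (y - xt) w.
    rewrite opprB addrA subrK -/w -Eq /N.
    by apply: le_trans; rewrite lerDl divr_ge0 // exprn_ge0 // enorm_ge0.
  rewrite T0 addrACA lerD // -[(c \*: N) y]/(c * N y) -[c *: _]/(c * _) -[(c \*: N) z]/(c * N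
    z).
  by rewrite -mulrDr ler_wpM2l.
pose T1 := taylor p.-1 (Dk f [:: w]) xt; pose T2 := taylor p.-2 (Dk f [:: w; w]) xt.
have DT x : 'D_w (taylor p f xt) x = T1 x.
  have := is_derive_taylor_poly p f xt p.-1 [::] x w sf; rewrite prednK //.
  by move=> /(_ _) H; rewrite (@derive_val _ _ _ _ _ _ _ (H _)) //=; lia.
have dT1 x : differentiable T1 x by apply: (differentiable_taylor p f xt p.-1 [:: w]) => //=;
  lia.
have DT1 x : 'D_w T1 x = T2 x.
  have := is_derive_taylor_poly p f xt p.-2 [:: w] x w sf.
  rewrite /T1 /T2; have -> : (p.-2.+1 = p.-1)%N by lia.
  by move=> H; rewrite (@derive_val _ _ _ _ _ _ _ (H _)) //=; lia.
have dN1 x : differentiable ('D_w N) x /\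
    p.+1%:R * enorm (x - xt) ^+ p.-1 * enorm w ^+ 2 <= 'D_w ('D_w N) x.
  have [k Ek] : exists k, p = k.+2 by exists p.-2; lia.
  have -> : 'D_w N = fun x => 'D_w (fun x => enorm x ^+ p.+1) (x - xt).
    by apply/funext => x'; rewrite -derive_translate.
  rewrite (derive_translate ('D_w (fun x => enorm x ^+ p.+1))).
  have := derive2_enorm_power k (x - xt) w; rewrite Ek /= => -[h1 h2]; split => //.
  exact: (differentiable_translate ('D_w (fun x => enorm x ^+ k.+3))) h1.
have := convex_tangent (fun t => taylor p f xt (y + t *: w) + c * N (y + t *: w))
  (fun t => T1 (y + t *: w) + c * 'D_w N (y + t *: w))
  (fun t => T2 (y + t *: w) + c * 'D_w ('D_w N) (y + t *: w)).
rewrite scale0r scale1r addr0 -zE DT; apply=> t.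
- apply: is_deriveD; first by rewrite -DT; exact: Dline.
  exact: (@is_deriveZ R R R (fun t => N (y + t *: w)) c t 1 _ (Dline _ dN t)).
- apply: is_deriveD; first by rewrite -DT1; exact: Dline.
  apply: (@is_deriveZ R R R (fun t => 'D_w N (y + t *: w)) c t 1 _ (Dline _ _ t)) => x.
  by have [] := dN1 x.
set x := y + t *: w.
have [_ h1] := dN1 x.
have h2 := convex_derive2_ge0 p L f x w p2 lf cf.
(* [T2] approximates D^2 f[w, w] up to c p |x - xt|^(p-1) |w|^2, while the regularization
   contributes at least c (p + 1) times the same product of norms. *)
have h3 := taylor_error p L f xt x [:: w; w] p.-2 lf ltac:(move=> /=; lia).
have h4 := ler_wpM2l c0 h1.
move: h3; rewrite -/(T2 x) big_cons big_seq1 prednK; last by lia.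
have -> : L * enorm (x - xt) ^+ p.-1 * (enorm w * enorm w) / p.-1`!%:R =
  c * (p%:R * (enorm (x - xt) ^+ p.-1 * enorm w ^+ 2)).
  rewrite /c Eq /= factS natrM expr2; have := @factr_neq0 R q.
  move: (q`!%:R) (enorm w) (enorm (x - xt) ^+ q) => F a b F0; field.
  by rewrite F0 addrC natr1 pnatr_eq0.
have h5 : 0 <= c * (enorm (x - xt) ^+ p.-1 * enorm w ^+ 2).
  by rewrite !mulr_ge0 ?exprn_ge0 // enorm_ge0.
rewrite ler_norml => /andP[_ h3].
move: h2 h3 h4 h5; rewrite -natr1.
move: (Dk f _ x) (T2 x) (p%:R) (enorm w ^+ 2) (enorm (x - xt) ^+ p.-1) ('D_w ('D_w N) x) => a
  b P W E D2.
lra.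
Qed.

Lemma differentiable_reg_taylor p (L H : R) phi xt y : (0 < p)%N -> lip_deriv p L phi ->
  differentiable (taylor p phi xt) y /\ differentiable (reg_taylor p H phi xt) y.
Proof.
move=> p0 lp.
have dT : differentiable (taylor p phi xt) y.
  by apply: (differentiable_taylor p phi xt p [::]); rewrite ?addn0 //;
    exact: lip_deriv_smooth lp.
split => //.
apply: (@differentiableD _ _ _ (taylor p phi xt) (_ \*: (fun y => enorm (y - xt) ^+ p.+1)))
  => //.
apply: differentiableZ; apply: (differentiable_translate (fun x => enorm x ^+ p.+1)).
by rewrite -[p]prednK //; have [] := derive_enorm_power p.-1 (y - xt) 0.
Qed.

Lemma derive_reg_taylor p (L H : R) phi xt y w : (0 < p)%N -> lip_deriv p L phi ->
  'D_w (reg_taylor p H phi xt) y = taylor p.-1 (Dk phi [:: w]) xt y +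
     H * p.+1%:R / p`!%:R * enorm (y - xt) ^+ p.-1 * dotp (y - xt) w.
Proof.
move=> p0 lp; have sp := lip_deriv_smooth _ _ _ lp.
have [dT _] := differentiable_reg_taylor p L H phi xt y p0 lp.
pose N x : R := enorm (x - xt) ^+ p.+1.
have dN : differentiable N y.
  apply: (differentiable_translate (fun x => enorm x ^+ p.+1)).
  by rewrite -[p]prednK //; have [] := derive_enorm_power p.-1 (y - xt) 0.
have -> : reg_taylor p H phi xt = taylor p phi xt + (H / p`!%:R) \*: N by [].
rewrite deriveD; [|exact: diff_derivable|by apply: diff_derivable; exact: differentiableZ].
rewrite deriveZ; last exact: diff_derivable.
congr (_ + _).
  have := is_derive_taylor_poly p phi xt p.-1 [::] y w sp; rewrite prednK // addn0.
  by move=> /(_ (leqnn _)) D; exact: derive_val.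
rewrite (derive_translate (fun x => enorm x ^+ p.+1)).
have := derive_enorm_power p.-1 (y - xt) w; rewrite prednK // => -[_ ->].
by rewrite -[_ *: _]/(_ * _) !mulrA [H * _ / _]mulrAC.
Qed.

Lemma step_obj_grad p (L H : R) phi gam xt y : (0 < p)%N -> lip_deriv p L phi ->
  differentiable gam y ->
  enorm (grad phi y + grad gam y + (H * p.+1%:R / p`!%:R * enorm (y - xt) ^+ p.-1) *: (y - xt)
    - grad (step_obj p H phi gam xt) y) <= L / p`!%:R * enorm (y - xt) ^+ p.
Proof.
move=> p0 lp dg.
have [_ dT] := differentiable_reg_taylor p L H phi xt y p0 lp.
rewrite -[step_obj p H phi gam xt]/(fun y => reg_taylor p H phi xt y + gam y).
rewrite (gradD (reg_taylor p H phi xt) gam y dT dg).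
set k := _ * _ ^+ p.-1; set G := grad (reg_taylor _ _ _ _) y.
have -> : grad phi y + grad gam y + k *: (y - xt) - (G + grad gam y) =
    grad phi y + k *: (y - xt) - G.
  by rewrite opprD addrA addrAC [_ + k *: _]addrAC addrK addrAC.
have dphi : differentiable phi y by exact: lip_deriv_differentiable lp.
set v := grad phi y + k *: (y - xt) - G.
(* v is tested against an arbitrary direction u, where the Taylor error of D_u phi is available;
   taking u = v then gives its norm. *)
have bound u : `|dotp v u| <= L / p`!%:R * enorm (y - xt) ^+ p * enorm u.
  have -> : dotp v u = Dk phi [:: u] y - taylor p.-1 (Dk phi [:: u]) xt y.
    rewrite /v dotpBl dotpDl dotpZl -(derive_grad phi) // -(derive_grad (reg_taylor _ _ _ _))
      //.
    by rewrite (derive_reg_taylor p L) // opprD addrACA subrr addr0.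
  have := taylor_error p L phi xt y [:: u] p.-1 lp; rewrite addn1 prednK // big_seq1.
  by move=> /(_ erefl) h; apply: le_trans h _; apply/ler_eq; ring.
have [->|v0] := eqVneq v 0.
  rewrite enorm0; have [->|h0] := eqVneq (y - xt) 0.
    by rewrite enorm0 expr0n gtn_eqF // mulr0.
  by rewrite -(pmulr_lge0 _ (enorm_gt0 _ h0)) (le_trans _ (bound _)).
rewrite -(ler_pM2r (enorm_gt0 _ v0)) (le_trans _ (bound _)) //.
by rewrite -expr2 enormE ler_norm.
Qed.

End Subproblem.

Lemma inner_constants_exist {R : realType} p : (0 < p)%N -> exists kappa : R,
  forall d (f g : 'rV[R]_d -> R) (Lf Lg sigma r : R) (xs : 'rV[R]_d), composite_problem p r f
    g Lf Lg sigma xs ->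
  exists Hin sigmain : R, inner_constants p kappa f g Lf Lg Hin sigmain.
Proof.
move=> p0; pose F : R := p`!%:R; pose C : R := homog_cst p.+1 p.+1.
have F0 : 0 < F by rewrite ltr0n fact_gt0.
have C0 : 0 <= C by exact: homog_cst_ge0.
pose s0 : R := p.+1%:R / F / 4 ^+ p.+1.
have s0_gt0 : 0 < s0 by rewrite !divr_gt0 // exprn_gt0.
exists (Num.max s0^-1 (2 * C / F + 1)) => d f g Lf Lg sigma r xs.
move=> [[cf lf] [cg lg] /andP[Lf0 LfLg] _ _].
(* The regularization contributes 2 Lf / p! times [homog_cst] to the Lipschitz constant, and g
   contributes Lg. Half of the regularization is uniformly convex with factor Lf / (p! 4^(p+1)); the
   numerator p + 1 of [s0] compensates the division by s in [unif_convex]. *)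
exists (2 * Lf / F * C + Lg), (Lf * s0); split.
- exact: mulr_gt0.
- by rewrite mulrCA -[leLHS]mulr1 ler_wpM2l ?(ltW Lf0) // -ler_pdivrMr // div1r le_max lexx.
- rewrite maxr_pMl ?(ltW (lt_trans Lf0 LfLg)) // le_max; apply/orP; right.
  have : 2 * Lf / F * C <= 2 * C / F * Lg.
    have -> : 2 * Lf / F * C = 2 * C / F * Lf by ring.
    by rewrite ler_wpM2l ?(ltW LfLg) // divr_ge0 ?mulr_ge0 // ltW.
  by rewrite mulrDl mul1r; lra.
move=> xt; split.
  have := lip_derivD p _ _ _ _ (lip_derivD p _ _ _ _ (lip_deriv_taylor p f xt
    (lip_deriv_smooth _ _ _ lf))
    (lip_derivZ p (2 * Lf / F) _ _ _ (lip_deriv_translate p _ _ xt (lip_deriv_enorm_power p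
      p0)))) lg.
  by rewrite add0r; apply; rewrite divr_ge0 ?mulr_ge0 // ltW.
move=> x y.
have dg z : differentiable g z by exact: lip_deriv_differentiable lg.
have [_ dm] := differentiable_reg_taylor p Lf (2 * Lf) f xt x p0 lf.
have [_ dP] := differentiable_reg_taylor p Lf Lf f xt x p0 lf.
rewrite -derive_grad; last exact: differentiableD.
have E1 : step_obj p (2 * Lf) f g xt = reg_taylor p (2 * Lf) f xt + g by [].
rewrite E1 deriveD; [|exact: diff_derivable..].
rewrite !fctE powR_mulrn ?enorm_ge0 //.
have h1 := convex_function_tangent g x y cg (dg _).
have h2 := regularized_taylor_tangent p Lf f xt x y p0 (ltW Lf0) lf cf.
have := enorm_power_unif_convex p.-1 (x - xt) (y - xt);
  rewrite prednK // opprB addrA subrK => h3.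
have c0 : 0 <= Lf / F by rewrite divr_ge0 // ltW.
have := ler_wpM2l c0 h3; move: h2.
rewrite !(derive_reg_taylor p Lf) // /reg_taylor -/F.
have -> : Lf * s0 / p.+1%:R * enorm (y - x) ^+ p.+1 = Lf / F * (enorm (y - x) ^+ p.+1 / 4 ^+
  p.+1).
  have b0 : 0 < 4 ^+ p.+1 :> R by rewrite exprn_gt0.
  have P0 : 0 < p.+1%:R :> R by [].
  rewrite /s0; move: (enorm (y - x) ^+ p.+1) (4 ^+ p.+1) b0 (p.+1%:R : R) P0 => a b b0 P P0.
  by field; rewrite !gt_eqF.
move: h1; move: ('D_(y - x) g x) (g x) (g y) (taylor _ _ _ _) (taylor p f xt x) (taylor p f
  xt y) (dotp _ _) => a b c e f1 f2 h.
move: (enorm (y - x) ^+ p.+1 / 4 ^+ p.+1) (enorm (x - xt) ^+ p.+1) (enorm (y - xt) ^+ p.+1)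
  (enorm (x - xt) ^+ p.-1) => U A B E.
move: (p.+1%:R) F0 => P F0; rewrite -!mulrA; move: (F^-1) => G.
by clear => h1 h2 h3; lra.
Qed.

(** * The rate of CATD *)

Section Growth.
Context {R : realType}.

(** The bound 1 + c ln t <= t^c is used at c = 1 - b and at c = -b with weights b and 1 - b. The
    logarithms cancel, and multiplication by t^b gives the claim. *)
Lemma powR_bernoulli (t b : R) : 0 <= t -> 0 < b <= 1 -> t `^ b <= 1 + b * (t - 1).
Proof.
rewrite le_eqVlt => /orP[/eqP <-|t0] /andP[b0 b1].
  by rewrite powR0 ?gt_eqF //; lra.
have e c : 1 + c * ln t <= t `^ c by rewrite /powR gt_eqF // expR_ge1Dx.
have h1 := ler_wpM2l (ltW b0) (e (1 - b)).
have b1' : 0 <= 1 - b by lra.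
have h2 := ler_wpM2l b1' (e (- b)).
have h : 1 <= b * t `^ (1 - b) + (1 - b) * t `^ (- b).
  by move: h1 h2; move: (ln t) (t `^ (1 - b)) (t `^ (- b)) => L X Y; lra.
have t0' : t != 0 by rewrite gt_eqF.
have := ler_wpM2l (powR_ge0 t b) h;
  rewrite mulr1 mulrDr !(mulrCA (t `^ b)) -!powRD ?t0' ?implybT //.
rewrite [b + (1 - b)]addrC subrK subrr powRr1 ?(ltW t0) // powRr0; lra.
Qed.

Lemma powR_tangent (s s' b : R) : 0 <= s -> 0 < s' -> 0 < b <= 1 ->
  b * s' `^ (b - 1) * (s' - s) <= s' `^ b - s `^ b.
Proof.
move=> s0 s'0 hb.
have h : (s / s') `^ b <= 1 + b * (s / s' - 1) by apply: powR_bernoulli;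
  rewrite // divr_ge0 // ltW.
have e : s `^ b = s' `^ b * (s / s') `^ b.
  by rewrite -powRM ?(ltW s'0) ?divr_ge0 ?(ltW s'0) // mulrC divfK // gt_eqF.
have := ler_wpM2l (powR_ge0 s' b) h.
have E : s' `^ (b - 1) = s' `^ b / s'.
  by rewrite powRB ?powRr1 ?(ltW s'0) // (gt_eqF s'0) implybT.
rewrite -e E => h'.
suff -> : b * (s' `^ b / s') * (s' - s) = - (s' `^ b * (b * (s / s' - 1))) by lra.
by field; rewrite gt_eqF.
Qed.

(** The tangent at t = 1 of the convex function t^(-c). *)
Lemma powR_neg_tangent (t c : R) : 0 < t -> 0 <= c -> 1 + c - c * t <= t `^ (- c).
Proof.
move=> t0 c0; rewrite /powR gt_eqF //; apply: le_trans (expR_ge1Dx _).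
have := ler_wpM2l c0 (@le_ln1Dx R (t - 1) _); rewrite [1 + (t - 1)]addrC subrK.
move=> /(_ ltac:(lra)); lra.
Qed.

Lemma powR_expR (x c : R) : 0 < x -> x `^ c = expR (c * ln x).
Proof. by move=> x0; rewrite /powR gt_eqF. Qed.

(* With [e = s^2 eta^2 / lam], the hypothesis on [lam] gives
   [Num.sqrt lam * s `^ (b - 1) >= B `^ P^-1 * e `^ (- c)]. *)
Lemma step_growth p (lam s eta B T : R) : (0 < p)%N -> 0 < lam -> 0 < s -> 0 <= eta ->
  0 < B -> 0 < T -> B <= lam * eta ^+ p.-1 ->
  forall P c : R, P = p.+1%:R -> c = p.-1%:R / (2 * P) ->
  B `^ P^-1 * T `^ (- c) * (1 + c - c * (s ^+ 2 * eta ^+ 2 / lam / T)) <=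
  Num.sqrt lam * s `^ (2 / P - 1).
Proof.
move=> p0 l0 s0 e0 B0 T0 hB P c PE cE.
have P0 : 0 < P by rewrite PE.
have c0 : 0 <= c by rewrite cE divr_ge0 // mulr_ge0 // ltW.
(* For p = 1 the exponent c is 0 and eta may vanish; for p >= 2 the bound [hB] forces eta > 0, so
   that logarithms can be taken. *)
have [p1|p2] : p = 1%N \/ (2 <= p)%N by lia.
  have -> : c = 0 by rewrite cE p1 mul0r.
  have -> : P = 2 by rewrite PE p1.
  rewrite oppr0 divff // subrr !powRr0 mul0r !mulr1 addr0 subr0 mulr1.
  rewrite powR12_sqrt ?(ltW B0) // ler_sqrt ?(ltW l0) //.
  by move: hB; rewrite p1 /= mulr1.
have eta0 : 0 < eta.
  rewrite lt_neqAle e0 andbT; apply/eqP => h; move: hB; rewrite -h expr0n.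
  have -> : (p.-1 == 0%N) = false by apply/eqP; lia.
  by rewrite mulr0 leNgt B0.
set e := s ^+ 2 * eta ^+ 2 / lam.
have e_gt0 : 0 < e by rewrite divr_gt0 // mulr_gt0 // exprn_gt0.
have eT0 : 0 < e / T by rewrite divr_gt0.
apply: le_trans (_ : B `^ P^-1 * e `^ (- c) <= _).
  rewrite -mulrA ler_wpM2l ?powR_ge0 //.
  apply: le_trans (_ : T `^ (- c) * (e / T) `^ (- c) <= _).
    by rewrite ler_wpM2l ?powR_ge0 // powR_neg_tangent.
  by rewrite -powRM ?(ltW T0) ?(ltW eT0) // mulrC divfK // gt_eqF.
(* In logarithms the claim is linear: it is the logarithm of [hB] multiplied by 1/P. *)
rewrite -powR12_sqrt ?(ltW l0) // !powR_expR // -!expRD ler_expR.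
have hl : ln B <= ln lam + p.-1%:R * ln eta.
  apply: le_trans (_ : ln (lam * eta ^+ p.-1) <= _).
    by rewrite ler_ln // posrE mulr_gt0 // exprn_gt0.
  by rewrite lnM ?posrE ?exprn_gt0 // lnXn // mulr_natl.
have -> : ln e = 2 * ln s + 2 * ln eta - ln lam.
  rewrite /e lnM ?posrE ?invr_gt0 ?mulr_gt0 ?exprn_gt0 // lnV ?posrE //.
  by rewrite lnM ?posrE ?exprn_gt0 // !lnXn // !mulr2n; ring.
have Pi0 : 0 <= P^-1 by rewrite invr_ge0 ltW.
have := ler_wpM2l Pi0 hl.
have Pm : p.-1%:R = P - 2.
  by rewrite PE; case: (p) p0 => // k _ /=; rewrite -!natr1; ring.
rewrite cE Pm.
move: (ln B) (ln lam) (ln s) (ln eta) => lB ll ls le h.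
rewrite -subr_ge0.
have -> : 2^-1 * ll + (2 / P - 1) * ls - (P^-1 * lB + - ((P - 2) / (2 * P)) * (2 * ls + 2 *
  le - ll)) =
  P^-1 * (ll + (P - 2) * le) - P^-1 * lB by field; rewrite gt_eqF.
by rewrite subr_ge0.
Qed.

(** A' - A equals both sqrt(lam) sqrt(A') and (sqrt(A') - sqrt(A)) (sqrt(A') + sqrt(A)), where the
    last factor is at most 2 sqrt(A'). *)
Lemma sqrt_increment (lam A A' : R) : 0 < lam -> 0 <= A -> 0 < A' -> A <= A' ->
  (A' - A) ^+ 2 = lam * A' -> Num.sqrt lam / 2 <= Num.sqrt A' - Num.sqrt A.
Proof.
move=> l0 A0 A'0 AA' e.
have s'0 : 0 < Num.sqrt A' by rewrite sqrtr_gt0.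
have ss' : Num.sqrt A <= Num.sqrt A' by rewrite ler_sqrt // ltW.
have e1 : A' - A = Num.sqrt lam * Num.sqrt A'.
  by rewrite -sqrtrM ?ltW // -e sqrtr_sqr ger0_norm // subr_ge0.
have e2 : A' - A = (Num.sqrt A' - Num.sqrt A) * (Num.sqrt A' + Num.sqrt A).
  by rewrite -subr_sqr !sqr_sqrtr // ltW.
rewrite ler_pdivrMr // -(ler_pM2r s'0) -e1 e2 -mulrA.
by rewrite ler_wpM2l ?subr_ge0 //; lra.
Qed.

(* With [s k = Num.sqrt (A k)] and [b = 2 / (p + 1)], the increments of [s k `^ b] are
   bounded below affinely in the terms of the sum, which then telescopes. *)
Lemma growth_rate p N (lam A eta : nat -> R) (B E : R) :
  (0 < p)%N -> (0 < N)%N -> 0 < B -> 0 < E -> A 0%N = 0 ->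
  (forall k, (k < N)%N -> [/\ 0 < lam k.+1, 0 < A k.+1, A k <= A k.+1,
     (A k.+1 - A k) ^+ 2 = lam k.+1 * A k.+1 & 0 <= eta k.+1 /\
     B <= lam k.+1 * eta k.+1 ^+ p.-1]) ->
  \sum_(k < N) (A k.+1 * eta k.+1 ^+ 2 / lam k.+1) <= E ->
  B * (E / N%:R) `^ (- (p.-1%:R / 2)) * N%:R ^+ p.+1 <= p.+1%:R ^+ p.+1 * A N.
Proof.
move=> p0 N0 B0 E0 A0 h hE.
(* T is the largest mean value that the sum allows for its terms. The tangent of e^(-c) is taken at
   T, so that the affine lower bounds have mean at least 1. *)
pose P : R := p.+1%:R; pose c := p.-1%:R / (2 * P); pose T := E / N%:R.
have P0 : 0 < P by [].
have N0' : 0 < N%:R :> R by rewrite ltr0n.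
have T0 : 0 < T by rewrite divr_gt0.
have c0 : 0 <= c by rewrite divr_ge0 // mulr_ge0 // ltW.
have An n : (n <= N)%N -> 0 <= A n.
  by case: n => [|n /h []]; rewrite ?A0 // => _ /ltW.
pose b := 2 / P.
have hb : 0 < b <= 1.
  rewrite divr_gt0 //= ler_pdivrMr // mul1r /P; have : (2 <= p.+1)%N by lia.
  by rewrite -(ler_nat R).
pose K := B `^ P^-1 * T `^ (- c).
pose e k := A k.+1 * eta k.+1 ^+ 2 / lam k.+1.
have step k : (k < N)%N ->
    P^-1 * K * (1 + c - c * (e k / T)) <= Num.sqrt (A k.+1) `^ b - Num.sqrt (A k) `^ b.
  move=> kN; have [l0 A'0 AA' hA [eta0 hB]] := h k kN.
  have s'0 : 0 < Num.sqrt (A k.+1) by rewrite sqrtr_gt0.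
  apply: le_trans (powR_tangent _ _ _ (sqrtr_ge0 _) s'0 hb).
  have h1 := sqrt_increment _ _ _ l0 (An k (ltnW kN)) A'0 AA' hA.
  have h2 := step_growth p _ _ _ _ _ p0 l0 s'0 eta0 B0 T0 hB P c erefl erefl.
  move: h2; rewrite sqr_sqrtr ?(ltW A'0) // -/(e k) -/b -/K => h2.
  have h3 := ler_wpM2l (mulr_ge0 (ltW (proj1 (andP hb))) (powR_ge0 (Num.sqrt (A k.+1)) (b -
    1))) h1.
  apply: le_trans h3.
  have Pi0 : 0 <= P^-1 by rewrite invr_ge0 ltW.
  have := ler_wpM2l Pi0 h2.
  move: (Num.sqrt (lam _)) (_ `^ (b - 1)) (e k / T) => x y z h4.
  rewrite -mulrA; apply: le_trans h4 _; apply/ler_eq.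
  by rewrite /b; field; rewrite gt_eqF.
have sum n : (n <= N)%N ->
    P^-1 * K * \sum_(k < n) (1 + c - c * (e k / T)) <= Num.sqrt (A n) `^ b.
  elim: n => [_|n IH nN]; first by rewrite big_ord0 mulr0 powR_ge0.
  rewrite big_ord_recr /= mulrDr.
  by have := lerD (IH (ltnW nN)) (step n nN); rewrite [leRHS]addrC subrK.
have K0 : 0 <= P^-1 * K.
  by apply: mulr_ge0; [rewrite invr_ge0 ltW | apply: mulr_ge0; exact: powR_ge0].
have hsum : N%:R <= \sum_(k < N) (1 + c - c * (e k / T)).
  have -> : \sum_(k < N) (1 + c - c * (e k / T)) = N%:R * (1 + c) - c * ((\sum_(k < N) e k) /
    T).
    by rewrite sumrB sumr_const card_ord -mulr_sumr -mulr_suml mulr_natl.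
  have : (\sum_(k < N) e k) / T <= N%:R.
    by rewrite ler_pdivrMr // /T mulrC divfK // gt_eqF.
  by move=> /(ler_wpM2l c0); move: (_ / T) => X; lra.
have main : P^-1 * K * N%:R <= Num.sqrt (A N) `^ b.
  by apply: le_trans (sum N (leqnn N)); rewrite ler_wpM2l.
have KN0 : 0 <= P^-1 * K * N%:R by rewrite mulr_ge0.
have : (P^-1 * K * N%:R) ^+ p.+1 <= (Num.sqrt (A N) `^ b) ^+ p.+1.
  by rewrite lerXn2r // nnegrE // powR_ge0.
have -> : (Num.sqrt (A N) `^ b) ^+ p.+1 = A N.
  rewrite -powR_mulrn ?powR_ge0 // -powRrM /b divfK ?gt_eqF //.
  by rewrite powR_mulrn ?sqrtr_ge0 // sqr_sqrtr // An.
have -> : (P^-1 * K * N%:R) ^+ p.+1 =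
    (P ^+ p.+1)^-1 * (B * T `^ (- (p.-1%:R / 2)) * N%:R ^+ p.+1).
  rewrite !exprMn exprVn -!mulrA; congr (_ * (_ * _)).
    by rewrite -powR_mulrn ?powR_ge0 // -powRrM mulVf ?gt_eqF // powRr1 // ltW.
  congr (_ * _); rewrite -powR_mulrn ?powR_ge0 // -powRrM; congr (_ `^ _).
  by rewrite /c -/P; field; rewrite gt_eqF.
by rewrite ler_pdivrMl ?exprn_gt0.
Qed.

End Growth.

(** * The Monteiro-Svaiter energy and the rate of one run *)

Section Energy.
Context {R : realType} {d : nat}.
Local Notation V := 'rV[R]_d.
Implicit Types (x y z v w h xs xt : V).

Lemma enormD_sqr v w : enorm (v + w) ^+ 2 = dotp v v + 2 * dotp v w + enorm w ^+ 2.
Proof.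
by rewrite !enormE dotpDl !dotpDr (dotpC w v); move: (dotp v v) (dotp v w) (dotp w w) => *;
  ring.
Qed.

(* A Monteiro-Svaiter step: the hypothesis on [lam *: v + (y' - xt)] says that y' is an
   approximate proximal point with relative error 1/2. *)
Lemma energy_step (lam a A fy fy' fs : R) x y y' xs xt v :
  0 < lam -> 0 <= A -> 0 < A + a -> 0 <= a -> a ^+ 2 = lam * (A + a) ->
  xt = (A / (A + a)) *: y + (a / (A + a)) *: x ->
  enorm (lam *: v + (y' - xt)) <= 2^-1 * enorm (y' - xt) ->
  fy' + dotp v (y - y') <= fy -> fy' + dotp v (xs - y') <= fs ->
  2^-1 * enorm (x - a *: v - xs) ^+ 2 + (A + a) * (fy' - fs)
    + 3 / 8 * ((A + a) * enorm (y' - xt) ^+ 2 / lam)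
  <= 2^-1 * enorm (x - xs) ^+ 2 + A * (fy - fs).
Proof.
move=> l0 A0 A'0 a0 ea ext hp h1 h2.
have {}hp : enorm (lam *: v + (y' - xt)) ^+ 2 <= 4^-1 * enorm (y' - xt) ^+ 2.
  have -> : 4^-1 * enorm (y' - xt) ^+ 2 = (2^-1 * enorm (y' - xt)) ^+ 2 by field.
  by rewrite lerXn2r ?nnegrE ?mulr_ge0 ?enorm_ge0.
have evt : (A + a) * dotp v xt = A * dotp v y + a * dotp v x.
  by rewrite ext dotpDr !dotpZr; field; rewrite gt_eqF.
have e1 : enorm (x - a *: v - xs) ^+ 2 =
    enorm (x - xs) ^+ 2 - 2 * a * (dotp v x - dotp v xs) + a ^+ 2 * dotp v v.
  have -> : x - a *: v - xs = - (a *: v) + (x - xs) by rewrite addrAC addrC.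
  rewrite (enormD_sqr (- (a *: v))) !dotpNl !dotpNr !dotpZl !dotpZr dotpBr.
  by move: (enorm _) (dotp v x) (dotp v xs) (dotp v v) => *; ring.
have e2 : enorm (lam *: v + (y' - xt)) ^+ 2 =
    lam ^+ 2 * dotp v v + 2 * lam * (dotp v y' - dotp v xt) + enorm (y' - xt) ^+ 2.
  rewrite (enormD_sqr (lam *: v)) !dotpZl !dotpZr dotpBr.
  by move: (enorm _) (dotp v y') (dotp v xt) (dotp v v) => *; ring.
move: hp h1 h2; rewrite e1 e2 !dotpBr.
move: (enorm (x - xs) ^+ 2) (enorm (y' - xt) ^+ 2) evt => XX HH evt.
move: (dotp v v) (dotp v y') (dotp v y) (dotp v x) (dotp v xs) (dotp v xt) evt => vv vy' vy
  vx vs vt evt hp h1 h2.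
clear e1 e2 ext.
have k1 := ler_wpM2l A0 h1; have k2 := ler_wpM2l a0 h2.
(* With this weight the <v, v> term of the proximal inequality becomes a^2 <v, v> / 2, the one
   created by the update of x; the constant 3/8 is 1/2 - 1/8. *)
have c0 : 0 <= (A + a) / (2 * lam) by rewrite divr_ge0 ?ltW // mulr_gt0.
have k3 := ler_wpM2l c0 hp.
have k4 : (A + a) / (2 * lam) * (lam ^+ 2 * vv + 2 * lam * (vy' - vt) + HH) =
   2^-1 * (a ^+ 2 * vv) + (A + a) * (vy' - vt) + 2^-1 * ((A + a) * HH / lam).
  by rewrite ea; field; rewrite gt_eqF.
have k5 : (A + a) / (2 * lam) * (4^-1 * HH) = 8^-1 * ((A + a) * HH / lam).
  by field; rewrite gt_eqF.
move: k3; rewrite k4 k5.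
move: ((A + a) * HH / lam) (a ^+ 2 * vv) => Q U k3.
by move: evt k1 k2 k3; clear; lra.
Qed.

End Energy.

Section Rate.
Context {R : realType}.

Lemma step_size (lam A a : R) : 0 < lam -> 0 <= A ->
  a = (lam + Num.sqrt (lam ^+ 2 + 4 * lam * A)) / 2 ->
  [/\ 0 < a, a ^+ 2 = lam * (A + a) & lam <= A + a].
Proof.
move=> l0 A0 ->; set S := Num.sqrt _.
have D0 : 0 <= 4 * lam * A by rewrite !mulr_ge0 // ltW.
have S2 : S ^+ 2 = lam ^+ 2 + 4 * lam * A by rewrite sqr_sqrtr // addr_ge0 // sqr_ge0.
have Sl : lam <= S.
  by rewrite -(ler_pXn2r (n := 2)) ?nnegrE ?sqrtr_ge0 ?(ltW l0) // S2 lerDl.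
split; lra.
Qed.

(** Here B = (p-1)! / (2H) is the lower bound on lam eta^(p-1), and E = 4 Rd^2. The factor
    (E/N)^(-(p-1)/2) raises the exponent of N from p + 1 to (3p+1)/2. The computation yields
    (p+1)^(p+1), which is bounded by the larger power (p+1)^((3p+1)/2) in [c_const]. *)
Lemma value_rate p N (A D H Rd : R) : (0 < p)%N -> (0 < N)%N -> 0 < H -> 0 < Rd -> 0 <= D ->
  (p.-1)`!%:R / (2 * H) * (4 * Rd ^+ 2 / N%:R) `^ (- (p.-1%:R / 2)) * N%:R ^+ p.+1
    <= p.+1%:R ^+ p.+1 * A ->
  A * D <= 2^-1 * Rd ^+ 2 ->
  D <= c_const p * H * Rd ^+ p.+1 / N%:R `^ ((3 * p + 1)%:R / 2).
Proof.
move=> p0; have pE : (p.+1 = 2 + p.-1)%N by rewrite add2n prednK.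
have pq : (p.+1 * 2 <= 3 * p + 1)%N by lia.
move=> N0 H0 R0 D0 h1 h2.
pose F : R := (p.-1)`!%:R; pose n : R := N%:R; pose q : R := (3 * p + 1)%:R / 2.
have n0 : 0 < n by rewrite ltr0n.
have F0 : 0 < F by rewrite ltr0n fact_gt0.
have nq0 : 0 < n `^ q by rewrite powR_gt0.
have e1 : (4 * Rd ^+ 2 / n) `^ (- (p.-1%:R / 2)) * n ^+ p.+1 = n `^ q / (2 * Rd) ^+ p.-1.
  have -> : 4 * Rd ^+ 2 / n = (2 * Rd) `^ 2%:R * n `^ (- 1).
    rewrite powR_mulrn ?mulr_ge0 ?(ltW R0) // powR_inv1 ?ltW //.
    by congr (_ / _); ring.
  rewrite powRM ?powR_ge0 // -!powRrM -(powR_mulrn p.+1 (ltW n0)) -mulrA -powRD; last first.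
    by rewrite (gt_eqF n0) implybT.
  have -> : 2 * - (p.-1%:R / 2) = - p.-1%:R :> R by field.
  rewrite powR_invn ?mulr_ge0 ?(ltW R0) // mulrC; congr (_ `^ _ / _).
  by rewrite /q; case: (p) p0 => // k _ /=; rewrite natrD natrM -!natr1; field.
have P0 : 0 < p.+1%:R ^+ p.+1 :> R by rewrite exprn_gt0.
have D20 : 0 < (2 * Rd) ^+ p.-1 by rewrite exprn_gt0 // mulr_gt0.
have h3 : D * (F * n `^ q) <= p.+1%:R ^+ p.+1 * H * Rd ^+ 2 * (2 * Rd) ^+ p.-1.
  have := ler_wpM2l D0 h1; rewrite -/n -mulrA e1.
  have := ler_wpM2l (ltW P0) h2; rewrite -/F.
  move: (_ ^+ p.+1) (n `^ q) => P Q k1 k2.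
  have : D * (F / (2 * H) * (Q / (2 * Rd) ^+ p.-1)) <= P * (2^-1 * Rd ^+ 2).
    by apply: le_trans k2 _; rewrite mulrCA mulrC [D * A]mulrC mulrC.
  have -> : D * (F / (2 * H) * (Q / (2 * Rd) ^+ p.-1)) = D * (F * Q) / (2 * H * (2 * Rd) ^+
    p.-1).
    by move: ((2 * Rd) ^+ p.-1) D20 => W W0; field; rewrite !gt_eqF.
  rewrite ler_pdivrMr; last by rewrite !mulr_gt0.
  by move: ((2 * Rd) ^+ p.-1) => W; lra.
have h4 : p.+1%:R ^+ p.+1 <= p.+1%:R `^ q :> R.
  rewrite -powR_mulrn // ler_powR ?ler1n // /q ler_pdivlMr //.
  by rewrite -natrM ler_nat.
rewrite ler_pdivlMr // -(ler_pM2l F0) mulrCA (le_trans h3) //.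
have -> : F * (c_const p * H * Rd ^+ p.+1) = p.+1%:R `^ q * H * Rd ^+ 2 * (2 * Rd) ^+ p.-1.
  rewrite /c_const -/F -/q exprMn.
  have -> : Rd ^+ p.+1 = Rd ^+ 2 * Rd ^+ p.-1 by rewrite -exprD -pE.
  by field; rewrite gt_eqF.
by rewrite !ler_wpM2r ?(ltW D20) ?sqr_ge0 ?(ltW H0).
Qed.

End Rate.

Section CATDRate.
Context {R : realType} {d : nat}.
Local Notation V := 'rV[R]_d.
Implicit Types (x y z v w h xs xt : V).

(** All that the rate has to know of a step: y is an approximate proximal point with relative error
    1/2. It is the common interface of the inexact outer steps and the exact inner ones. *)
Definition proximal (p : nat) (H : R) (solve : nat -> V -> V -> Prop) (G : V -> V) :=
  forall k xt y lam, 0 < lam -> solve k xt y ->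
    2^-1 <= lam * (H * enorm (y - xt) ^+ p.-1 / (p.-1)`!%:R) <= p%:R / p.+1%:R ->
    enorm (lam *: G y + (y - xt)) <= 2^-1 * enorm (y - xt).

(** The gradient bound is meant for the accuracy test of the inner loop. [Rd] is an upper bound for
    the initial distance, since this is what a restart inherits from the previous one. *)
Lemma catd_rate p (H : R) solve (G : V -> V) (F : V -> R) z0 N yN xs (Rd : R) :
  (0 < p)%N -> (0 < N)%N ->
  (forall x y, F y + dotp (G y) (x - y) <= F x) -> proximal p H solve G ->
  minimizer F xs -> 0 < Rd -> enorm (z0 - xs) <= Rd ->
  catd p H solve G z0 N yN ->
  [/\ 0 < H,
      F yN - F xs <= c_const p * H * Rd ^+ p.+1 / N%:R `^ ((3 * p + 1)%:R / 2) &
      enorm (G yN) <= 3 * H / (p.-1)`!%:R * (2 * Rd) ^+ p].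
Proof.
move=> p0 N0 cF prox mF Rd0 hz [lam [a [A [x [y [xt [A0 x0 y0 -> steps]]]]]]].
pose Fp : R := (p.-1)`!%:R; have Fp0 : 0 < Fp by rewrite ltr0n fact_gt0.
pose eta k := enorm (y k.+1 - xt k).
(* The lower bound 1/2 in the condition of the first step would fail for H <= 0. *)
have H0 : 0 < H.
  have [[l0 _] _ _ /andP[h _] _] := steps 0%N N0.
  rewrite ltNge; apply/negP => Hle; have : lam 1%N * (H * eta 0%N ^+ p.-1 / Fp) <= 0.
    rewrite mulr_ge0_le0 ?(ltW l0) // mulr_le0_ge0 ?invr_ge0 ?(ltW Fp0) //.
    by rewrite mulr_le0_ge0 // exprn_ge0 // enorm_ge0.
  by rewrite /eta /Fp => h'; have := le_trans h h'; lra.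
have Age0 k : (k <= N)%N -> 0 <= A k.
  elim: k => [|k IH] kN; first by rewrite A0.
  have [[l0 ea] [-> _] _ _ _] := steps k kN.
  have [a0 _ _] := step_size _ _ _ l0 (IH (ltnW kN)) ea.
  by rewrite addr_ge0 ?IH ?ltW // ltnW.
have st k : (k < N)%N -> [/\ 0 < lam k.+1, 0 < a k.+1,
    a k.+1 ^+ 2 = lam k.+1 * (A k + a k.+1), lam k.+1 <= A k + a k.+1 & A k.+1 = A k + a k.+1].
  move=> kN; have [[l0 ea] [eA _] _ _ _] := steps k kN.
  by have [] := step_size _ _ _ l0 (Age0 k (ltnW kN)) ea.
have Agt0 k : (k < N)%N -> 0 < A k.+1.
  by move=> kN; have [_ a0 _ _ ->] := st k kN; rewrite ltr_wpDl // Age0 // ltnW.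
have px k : (k < N)%N -> enorm (lam k.+1 *: G (y k.+1) + (y k.+1 - xt k)) <= 2^-1 * eta k.
  by move=> kN; have [[l0 _] _ hs hl _] := steps k kN; exact: prox hs hl.
pose e k := A k.+1 * eta k ^+ 2 / lam k.+1.
have e_ge0 k : (k < N)%N -> 0 <= e k.
  move=> kN; have [l0 _ _ _ _] := st k kN.
  by rewrite divr_ge0 ?(ltW l0) // mulr_ge0 ?sqr_ge0 // ltW // Agt0.
have energy n : (n <= N)%N ->
    2^-1 * enorm (x n - xs) ^+ 2 + A n * (F (y n) - F xs) + 3 / 8 * \sum_(k < n) e k
      <= 2^-1 * Rd ^+ 2.
  elim: n => [_|n IH nN].
    rewrite A0 mul0r addr0 big_ord0 mulr0 addr0 x0 ler_wpM2l //.
    by rewrite lerXn2r ?nnegrE ?enorm_ge0 // ltW.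
  have [l0 a0 ea _ eA] := st n nN.
  have := energy_step (lam n.+1) (a n.+1) (A n) (F (y n)) (F (y n.+1)) (F xs) (x n) (y n)
    (y n.+1) xs (xt n) (G (y n.+1)) l0 (Age0 n (ltnW nN)) _ (ltW a0) ea _ (px n nN) (cF _ _)
      (cF _ _).
  rewrite -eA => /(_ (Agt0 n nN)).
  have [_ [_ ext] _ _ ex] := steps n nN; move=> /(_ ext); rewrite -ex => h.
  rewrite big_ord_recr /=; have := IH (ltnW nN); rewrite /e /eta.
  by move: h; move: (_ + _ * (F (y n.+1) - _)) (_ + _ * (F (y n) - _)) (\sum_(k < n) _) (_ /
    lam n.+1) => *; lra.
have D0 n : 0 <= F (y n) - F xs by rewrite subr_ge0.
have sum_e n : (n <= N)%N -> 0 <= \sum_(k < n) e k.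
  by move=> nN; apply: sumr_ge0 => k _; rewrite e_ge0 // (leq_trans _ nN).
have enN := energy N (leqnn N).
have sq_ge0 : 0 <= enorm (x N - xs) ^+ 2 by exact: sqr_ge0.
have AD0 : 0 <= A N * (F (y N) - F xs) by rewrite mulr_ge0 // Age0.
have e43 : \sum_(k < N) e k <= 4 / 3 * Rd ^+ 2.
  by move: enN sq_ge0 AD0; move: (\sum_(k < N) _) (_ * (F _ - _)) (_ ^+ 2) (_ ^+ 2) => *; lra.
have lamB k : (k < N)%N -> Fp / (2 * H) <= lam k.+1 * eta k ^+ p.-1.
  move=> kN; have [_ _ _ /andP[h _] _] := steps k kN.
  rewrite ler_pdivrMr ?mulr_gt0 //.
  have := ler_wpM2r (ltW Fp0) h.
  have -> : lam k.+1 * (H * enorm (y k.+1 - xt k) ^+ p.-1 / (p.-1)`!%:R) * Fp =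
      lam k.+1 * eta k ^+ p.-1 * H.
    by rewrite -/Fp -/(eta k); move: (eta k ^+ _) => W; field; rewrite gt_eqF.
  by move: (eta k ^+ _) => W; lra.
split => //.
(* [growth_rate] numbers the step lengths from 1, hence the [k.-1]. The 4/3 of [e43] is rounded up
   to 4 so that the square root of E is 2 Rd. *)
- apply: (value_rate p N (A N)) => //.
    have := growth_rate p N lam A (fun k => eta k.-1) (Fp / (2 * H)) (4 * Rd ^+ 2) p0 N0.
    apply=> //; rewrite ?divr_gt0 ?mulr_gt0 ?exprn_gt0 //.
      move=> k kN; have [l0 a0 ea _ eA] := st k kN; split => //.
      + exact: Agt0.
      + by rewrite eA lerDl ltW.
      + by rewrite eA addrAC subrr add0r ea.
      + by split; [exact: enorm_ge0 | exact: lamB].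
    apply: le_trans e43 _; have := sqr_ge0 Rd; move: (Rd ^+ 2) => *; lra.
  have := sum_e N (leqnn N); move: enN sq_ge0;
    move: (\sum_(k < N) _) (_ * (F _ - _)) (_ ^+ 2) => *; lra.
have [n En] : exists n, N = n.+1 by exists N.-1; rewrite prednK.
have nN : (n < N)%N by rewrite En.
have [l0 a0 _ lA eA] := st n nN.
(* The last term of the sum controls the last step length, because lam is at most A there. *)
have eta2R : eta n <= 2 * Rd.
  rewrite -(ler_pXn2r (n := 2)) ?nnegrE ?mulr_ge0 ?enorm_ge0 ?(ltW Rd0) //.
  apply: le_trans (_ : e n <= _).
    by rewrite /e ler_pdivlMr // mulrC ler_wpM2r ?sqr_ge0 // eA.
  apply: le_trans (_ : 4 / 3 * Rd ^+ 2 <= _).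
    apply: le_trans e43; rewrite En big_ord_recr /= lerDr sum_e // ltnW //.
  by rewrite exprMn; have := sqr_ge0 Rd; move: (Rd ^+ 2) => *; lra.
rewrite En; set v := G _.
have h1 : lam n.+1 * enorm v <= 3 / 2 * eta n.
  have := px n nN; rewrite -/v => h.
  have := enorm_triangleB (lam n.+1 *: v) (- (y n.+1 - xt n)).
  by rewrite opprK enormN enormZ gtr0_norm // -/(eta n); move: h;
    move: (enorm _) (lam _ * _) => *; lra.
have h2 := ler_wpM2r (enorm_ge0 v) (lamB n nN).
have eta0 : 0 <= eta n by exact: enorm_ge0.
have h3 := ler_wpM2l (exprn_ge0 p.-1 eta0) h1.
(* The lower bound on lam eta^(p-1) turns the bound on lam |v| into one on |v| of order eta^p. *)
have h4 : Fp / (2 * H) * enorm v <= 3 / 2 * eta n ^+ p.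
  rewrite -[in leRHS](prednK p0) exprSr.
  apply: le_trans h2 _; rewrite mulrAC mulrC (le_trans h3) //.
  by move: (eta n ^+ _) => W; lra.
have h5 : eta n ^+ p <= (2 * Rd) ^+ p.
  by rewrite lerXn2r // nnegrE // mulr_ge0 // ltW.
have FH : 0 < Fp / (2 * H) by rewrite divr_gt0 // mulr_gt0.
rewrite -(ler_pM2l FH) (le_trans h4) // -/Fp.
have -> : Fp / (2 * H) * (3 * H / Fp * (2 * Rd) ^+ p) = 3 / 2 * (2 * Rd) ^+ p.
  by move: ((2 * Rd) ^+ p) => W; field; rewrite !gt_eqF.
by rewrite ler_wpM2l // divr_ge0.
Qed.

End CATDRate.

(** * Restarts *)

(** As rho >= 1/2, the coefficient of eta is at most 1/2 - 1/(4P), where 1/(4P) is the slack due to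
    H = 2L. Since lam G <= X + eta, the term lam v is at most (X + eta) / (4P(P+1)), and the slack
    absorbs it. *)
Lemma accurate_prox_arith {R : realType} (P rho X v eta G lam : R) : 1 <= P ->
  0 <= eta -> 0 <= X -> 0 < lam -> 2^-1 <= rho -> v <= (4 * P * (P + 1))^-1 * G ->
  lam * G - eta <= X ->
  X <= (2^-1 * (rho / P) + 1 - rho * (P + 1) / P) * eta + lam * v ->
  X <= 2^-1 * eta.
Proof.
move=> P1 eta0 X0 l0 hrho hv hG hX.
have P0 : 0 < P by lra.
pose D := 4 * P * (P + 1).
have D0 : 0 < D by rewrite /D !mulr_gt0 //; lra.
have k1 : lam * v <= D^-1 * (X + eta).
  apply: le_trans (_ : lam * (D^-1 * G) <= _); first by rewrite ler_wpM2l // ltW.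
  by rewrite mulrCA ler_wpM2l ?invr_ge0 ?(ltW D0) //; lra.
have k2 : (2^-1 * (rho / P) + 1 - rho * (P + 1) / P) * eta <= (2^-1 - (4 * P)^-1) * eta.
  rewrite ler_wpM2r //.
  have -> : 2^-1 * (rho / P) + 1 - rho * (P + 1) / P = 1 - rho * (1 + (2 * P)^-1).
    by field; rewrite gt_eqF.
  have c0 : 0 <= 1 + (2 * P)^-1 by rewrite addr_ge0 // invr_ge0; lra.
  have := ler_wpM2r c0 hrho.
  have -> : (4 * P)^-1 = 2^-1 * (2 * P)^-1 by field; rewrite gt_eqF.
  by move: (2 * P)^-1 => c; lra.
have k3 : X <= (2^-1 - (4 * P)^-1) * eta + D^-1 * (X + eta).
  by apply: le_trans hX _; rewrite lerD.
have := ler_wpM2l (ltW D0) k3.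
have -> : D * ((2^-1 - (4 * P)^-1) * eta + D^-1 * (X + eta)) =
  (2 * P * (P + 1) - (P + 1)) * eta + (X + eta).
  by rewrite /D; field; rewrite !gt_eqF //; lra.
rewrite /D => k4.
have q1 : 0 < 4 * P * (P + 1) - 1.
  have : 0 <= (P - 1) * P by rewrite mulr_ge0 ?subr_ge0 // ltW.
  lra.
rewrite -(ler_pM2l q1).
have : 0 <= (P - 1) * eta by rewrite mulr_ge0 // subr_ge0.
have : 0 <= (P - 1) * (P * eta) by rewrite !mulr_ge0 ?subr_ge0 // ltW.
lra.
Qed.

Section Prox.
Context {R : realType} {d : nat}.
Local Notation V := 'rV[R]_d.
Implicit Types (x y z v w h xs xt : V) (f g m : V -> R).

(** lam G + h splits into lam times the Taylor error, (1 - lam k) h, and lam v. The upper bound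
    p/(p+1) in the step condition is exactly what makes 1 - lam k nonnegative. *)
Lemma prox_residual p (lam L H rho : R) (G h v : V) : (0 < p)%N -> 0 < lam -> 0 < H ->
  rho = lam * (H * enorm h ^+ p.-1 / (p.-1)`!%:R) -> rho <= p%:R / p.+1%:R ->
  enorm (G + (H * p.+1%:R / p`!%:R * enorm h ^+ p.-1) *: h - v)
    <= L / p`!%:R * enorm h ^+ p ->
  enorm (lam *: G + h) <=
    (L / H * (rho / p%:R) + 1 - rho * p.+1%:R / p%:R) * enorm h + lam * enorm v.
Proof.
move=> p0 l0 H0 erho hrho; set k := _ * _ ^+ p.-1 => hE.
have P0 : 0 < p%:R :> R by rewrite ltr0n.
have P1 : 0 < p.+1%:R :> R by [].
have F0 : 0 < (p.-1)`!%:R :> R by rewrite ltr0n fact_gt0.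
have Fp : p`!%:R = p%:R * (p.-1)`!%:R :> R.
  by rewrite -{1}(prednK p0) factS prednK // natrM.
have lk : lam * k = rho * p.+1%:R / p%:R.
  rewrite erho /k Fp; move: (enorm h ^+ p.-1) (p.+1%:R : R) => W Q.
  by field; rewrite !gt_eqF.
have lk1 : 0 <= 1 - lam * k.
  by rewrite lk subr_ge0 ler_pdivrMr // mul1r -ler_pdivlMr.
have -> : lam *: G + h = lam *: (G + k *: h - v) + (1 - lam * k) *: h + lam *: v.
  by apply/rowP => i; rewrite !mxE; ring.
apply: le_trans (enorm_triangle _ _) _; rewrite [enorm (lam *: v)]enormZ (gtr0_norm l0) lerD2r.
apply: le_trans (enorm_triangle _ _) _; rewrite !enormZ (gtr0_norm l0) (ger0_norm lk1) lk.
have -> (A B e : R) : (A + 1 - B) * e = A * e + (1 - B) * e by ring.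
rewrite lerD2r; apply: le_trans (ler_wpM2l (ltW l0) hE) _.
apply/ler_eq.
rewrite erho Fp -[in LHS](prednK p0) exprSr prednK //.
by move: (enorm h ^+ p.-1) => W; field; rewrite !gt_eqF.
Qed.

Lemma accurate_prox p (Lf : R) f g : (0 < p)%N -> 0 < Lf -> lip_deriv p Lf f ->
  (forall x, differentiable g x) -> forall (solve : nat -> V -> V -> Prop),
  (forall k xt y, solve k xt y -> accurate p f g (2 * Lf) xt y) ->
  proximal p (2 * Lf) solve (gradF f g).
Proof.
move=> p0 L0 lf dg solve hs k xt y lam l0 /hs; rewrite /accurate => hacc /andP[h1 h2].
have H0 : 0 < 2 * Lf by rewrite mulr_gt0.
have hE := step_obj_grad p Lf (2 * Lf) f g xt y p0 lf (dg y).
have := prox_residual p lam Lf (2 * Lf) _ (gradF f g y) (y - xt) _ p0 l0 H0 erefl h2 hE.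
have hG := enorm_triangleB (lam *: gradF f g y) (- (y - xt)).
rewrite opprK enormN enormZ (gtr0_norm l0) in hG.
move: h1 hacc hG; set rho := lam * _; set X := enorm (lam *: _ + _).
set v := enorm (grad _ y); set eta := enorm (y - xt); set G := enorm (gradF f g y).
have eta0 : 0 <= eta by exact: enorm_ge0.
have X0 : 0 <= X by exact: enorm_ge0.
have -> : Lf / (2 * Lf) = 2^-1 by field; rewrite gt_eqF.
rewrite natrM natrM; move: h2 l0 => _ l0.
have Pge : 1 <= p%:R :> R by rewrite ler1n.
rewrite -[p.+1%:R]natr1; move: (p%:R : R) Pge rho X v eta G eta0 X0 {hs hE lf dg} => P P1.
move=> rho X v eta G eta0 X0 h1 hacc hG hX.
exact: (accurate_prox_arith P rho X v eta G lam).
Qed.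

(** Here v = 0 and the ratio L / H is 1, so the coefficient in [prox_residual] is 1 - rho, at most
    1/2. *)
Lemma exact_prox p (L : R) m : (0 < p)%N -> lip_deriv p L m ->
  proximal p L (fun _ xt => minimizer (step_obj p L m (cst 0) xt)) (grad m).
Proof.
move=> p0 lm k xt y lam l0 mn /andP[h1 h2].
have L0 : 0 < L.
  rewrite ltNge; apply/negP => L0; have : 0 < lam * (L * enorm (y - xt) ^+ p.-1 / (p.-1)`!%:R).
    by apply: lt_le_trans h1; rewrite invr_gt0.
  rewrite pmulr_rgt0 // ltNge => /negP; apply.
  by rewrite mulr_le0_ge0 ?invr_ge0 // mulr_le0_ge0 // exprn_ge0 // enorm_ge0.
have d0 : differentiable (cst 0 : V -> R) y by exact: differentiable_cst.
have hE := step_obj_grad p L L m (cst 0) xt y p0 lm d0.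
have g0 : grad (cst 0 : V -> R) y = 0 by apply/rowP => i; rewrite !mxE derive_cst.
have [_ dT] := differentiable_reg_taylor p L L m xt y p0 lm.
have dS : differentiable (step_obj p L m (cst 0) xt) y.
  exact: (@differentiableD _ _ _ (reg_taylor p L m xt) (cst 0)).
have gm := minimizer_grad _ _ mn dS.
have := prox_residual p lam L L _ (grad m y) (y - xt) 0 p0 l0 L0 erefl h2 _.
rewrite enorm0 mulr0 addr0 divff ?gt_eqF // mul1r; move: hE;
  rewrite gm g0 addr0 => hE /(_ hE) h.
apply: le_trans h _; rewrite ler_wpM2r ?enorm_ge0 //.
have P0 : 0 < p%:R :> R by rewrite ltr0n.
move: h1; set rho := lam * _ => h1.
have -> : rho / p%:R + 1 - rho * p.+1%:R / p%:R = 1 - rho.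
  by rewrite -[p.+1%:R]natr1; field; rewrite gt_eqF.
by lra.
Qed.

End Prox.

Section Restarts.
Context {R : realType} {d : nat}.
Local Notation V := 'rV[R]_d.
Implicit Types (x y z v w h xs xt : V) (f g m : V -> R).

Lemma nsteps_gt0 p (H s sigma R0 : R) k : (0 < nsteps p H s sigma R0 k)%N.
Proof. by rewrite /nsteps leq_max orbT. Qed.

Definition nsteps_arg p (H s sigma R0 : R) k : R :=
  (s * c_const p * H * 2 `^ s / sigma * (R0 / 2 ^+ k) `^ (p.+1%:R - s)) `^ (2 / (3 * p + 1)%:R).

Lemma nsteps_bounds p (H s sigma R0 : R) k :
  nsteps_arg p H s sigma R0 k <= (nsteps p H s sigma R0 k)%:R <= nsteps_arg p H s sigma R0 k
    + 2.
Proof.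
rewrite /nsteps -/(nsteps_arg p H s sigma R0 k); set X := nsteps_arg _ _ _ _ _ _.
have X0 : 0 <= X by exact: powR_ge0.
have c0 : 0 <= Num.ceil X by rewrite ceil_ge0 (lt_le_trans _ X0) // ltrN10.
have E : (`|Num.ceil X|%N)%:R = (Num.ceil X)%:~R :> R by rewrite pmulrn gez0_abs.
have := ceilB1_lt X; have := ceil_ge X; rewrite intrB -E; set M := `|_|%N => h1 h2.
have M1 : M%:R <= 1 + M%:R :> R by rewrite lerDr.
rewrite /maxn; case: (ltnP M 1) => hM; last by apply/andP; split; lra.
have M0 : M%:R = 0 :> R by move: hM; rewrite ltnS leqn0 => /eqP ->.
by apply/andP; split; lra.
Qed.

Lemma c_const_gt0 p : 0 < c_const p :> R.
Proof.
by rewrite /c_const divr_gt0 ?ltr0n ?fact_gt0 // mulr_gt0 ?exprn_gt0 ?powR_gt0.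
Qed.

(** The step count of a restart is this inequality solved for N: the value gap drops to the level at
    which uniform convexity forces half the distance. *)
Lemma restart_value p (H s sigma Rd : R) (N : R) : 0 < H -> 0 < s -> 0 < sigma -> 0 < Rd ->
  0 < N ->
  (s * c_const p * H * 2 `^ s / sigma * Rd `^ (p.+1%:R - s)) `^ (2 / (3 * p + 1)%:R) <= N ->
  c_const p * H * Rd ^+ p.+1 / N `^ ((3 * p + 1)%:R / 2) <= sigma / s * (Rd / 2) `^ s.
Proof.
move=> H0 s0 g0 R0 N0; set X := s * _ * _ * _ / _ * _ => hN.
have c0 := c_const_gt0 p.
have X0 : 0 < X by rewrite !mulr_gt0 ?invr_gt0 ?powR_gt0.
have q0 : 0 < (3 * p + 1)%:R :> R by rewrite ltr0n addn1.
have XN : X <= N `^ ((3 * p + 1)%:R / 2).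
  have -> : X = (X `^ (2 / (3 * p + 1)%:R)) `^ ((3 * p + 1)%:R / 2).
    rewrite -powRrM; have -> : 2 / (3 * p + 1)%:R * ((3 * p + 1)%:R / 2) = 1 :> R.
      by move: (_%:R : R) q0 => Q Q0; field; rewrite gt_eqF.
    by rewrite powRr1 // ltW.
  by rewrite ge0_ler_powR ?nnegrE ?powR_ge0 ?(ltW N0) // divr_ge0 // ltW.
have RE : Rd ^+ p.+1 = Rd `^ (p.+1%:R - s) * Rd `^ s.
  by rewrite -powRD ?(gt_eqF R0) ?implybT // subrK powR_mulrn // ltW.
have R2E : Rd `^ s = 2 `^ s * (Rd / 2) `^ s.
  by rewrite -powRM ?divr_ge0 ?(ltW R0) // mulrC divfK.
rewrite ler_pdivrMr ?powR_gt0 //.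
have k0 : 0 <= sigma / s * (Rd / 2) `^ s by rewrite mulr_ge0 ?powR_ge0 // divr_ge0 // ltW.
apply: le_trans (ler_wpM2l k0 XN); rewrite RE R2E /X.
move: (2 `^ s) (Rd `^ (_ - s)) ((Rd / 2) `^ s) (c_const p) => a b e c.
by apply/ler_eq; field; rewrite !gt_eqF.
Qed.

(** The value bound serves the outer loop, the gradient bound the inner one. *)
Lemma restarts_rate p (H s sigma : R) (F : V -> R) (G : V -> V) xs
    (solve : nat -> nat -> V -> V -> Prop) (z : nat -> V) K :
  (0 < p)%N -> 0 < s -> 0 < sigma ->
  (forall x y, F x + dotp (G x) (y - x) + sigma / s * enorm (y - x) `^ s <= F y) ->
  minimizer F xs -> G xs = 0 -> (forall k, proximal p H (solve k) G) ->
  let R0 := enorm (z 0%N - xs) in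
  0 < R0 -> catd_restarts p H s sigma xs solve G z K ->
  (forall k, (k <= K)%N -> enorm (z k - xs) <= R0 / 2 ^+ k) /\
  (forall k, (k < K)%N -> [/\ 0 < H, F (z k.+1) - F xs <= sigma / s * (R0 / 2 ^+ k.+1) `^ s &
    enorm (G (z k.+1)) <= 3 * H / (p.-1)`!%:R * (2 * (R0 / 2 ^+ k)) ^+ p]).
Proof.
move=> p0 s0 g0 uc mF Gxs prox R0 R0_gt0 rs.
have cF x y : F y + dotp (G y) (x - y) <= F x.
  by apply: le_trans (uc y x); rewrite lerDl mulr_ge0 ?powR_ge0 // divr_ge0 // ltW.
have sharp y : sigma / s * enorm (y - xs) `^ s <= F y - F xs.
  by have := uc xs y; rewrite Gxs dot0p addr0 lerBrDl.
have Rk0 k : 0 < R0 / 2 ^+ k by rewrite divr_gt0 // exprn_gt0.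
have step k : (k < K)%N -> enorm (z k - xs) <= R0 / 2 ^+ k ->
  [/\ 0 < H, F (z k.+1) - F xs <= sigma / s * (R0 / 2 ^+ k.+1) `^ s &
    enorm (G (z k.+1)) <= 3 * H / (p.-1)`!%:R * (2 * (R0 / 2 ^+ k)) ^+ p].
  move=> kK hk; have N0 := nsteps_gt0 p H s sigma R0 k.
  have [H0 hv hg] := catd_rate p H (solve k) G F (z k) _ (z k.+1) xs _ p0 N0 cF (prox k) mF
    (Rk0 k) hk (rs k kK).
  split => //; apply: le_trans hv _.
  have -> : R0 / 2 ^+ k.+1 = R0 / 2 ^+ k / 2 by rewrite exprSr invfM mulrA.
  apply: restart_value => //; first by rewrite ltr0n.
  by have /andP[h _] := nsteps_bounds p H s sigma R0 k.
have dist k : (k <= K)%N -> enorm (z k - xs) <= R0 / 2 ^+ k.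
  elim: k => [_|k IH kK]; first by rewrite expr0 divr1.
  have [_ hv _] := step k kK (IH (ltnW kK)).
  rewrite leNgt; apply/negP => hlt.
  have sg0 : 0 < sigma / s by rewrite divr_gt0.
  have := le_trans (sharp (z k.+1)) hv; rewrite ler_pM2l // leNgt => /negP; apply.
  by apply: gt0_ltr_powR => //; rewrite nnegrE ?enorm_ge0 // ltW.
by split => // k kK; apply: step => //; apply: dist; exact: ltnW.
Qed.

End Restarts.

(** * Oracle calls *)

Section Counting.
Context {R : realType}.

Lemma exp2_le_ln (n : nat) (X : R) : 2 ^+ n <= X -> n%:R <= 2 * ln X.
Proof.
move=> h; have X0 : 0 < X by apply: lt_le_trans h; rewrite exprn_gt0.
(* From ln(1 + t) <= t at t = -1/2. *)
have ln2 : 2^-1 <= ln 2 :> R.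
  have := @le_ln1Dx R (- 2^-1) ltac:(lra).
  have -> : 1 + - 2^-1 = 2^-1 :> R by field.
  by rewrite lnV ?posrE //; lra.
have : ln (2 ^+ n) <= ln X by rewrite ler_ln // posrE exprn_gt0.
rewrite lnXn // -[ln 2 *+ n]mulr_natl => h'.
have := ler_wpM2l (ler0n R n) ln2; lra.
Qed.

Lemma sum_sum_le (N : nat) (c : nat -> nat) (t : nat -> nat -> nat) (M T : R) :
  0 <= T -> (forall k, (k < N)%N -> (c k)%:R <= M) ->
  (forall k i, (k < N)%N -> (i < c k)%N -> (t k i)%:R <= T) ->
  (\sum_(k < N) \sum_(i < c k) t k i)%N%:R <= N%:R * (M * T).
Proof.
move=> T0 hc ht; rewrite natr_sum.
apply: le_trans (_ : \sum_(k < N) M * T <= _); last by rewrite sumr_const card_ord mulr_natl.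
apply: ler_sum => k _; rewrite natr_sum.
apply: le_trans (_ : \sum_(i < c k) T <= _).
  by apply: ler_sum => i _; apply: ht.
by rewrite sumr_const card_ord -[leLHS]mulr_natl ler_wpM2r // hc.
Qed.

Lemma small_arg_max (x : R) : 0 < x -> x * small_arg x = Num.max x 1.
Proof.
move=> x0; rewrite /small_arg maxr_pMr ?(ltW x0) // mulr1 divff ?gt_eqF //.
Qed.

End Counting.

(** * The number of inner restarts *)

Section Inner.
Context {R : realType} {d : nat}.
Local Notation V := 'rV[R]_d.
Implicit Types (x y z v w h xs xt : V) (f g m : V -> R).

(** [GF] and [gm] are the gradient norms of F and of the subproblem at a point that failed the test.
    The failure bounds GF by a multiple of gm, and the Taylor estimate then bounds Lf eta^p by a
    multiple of gm. Since eta is at least Rin / 2 and gm decays like (Rin / 2^j)^p, the powers of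
    Rin cancel. *)
Lemma inner_loop_bound_arith p (Lf Hin gm GF eta Rin : R) j : (0 < p)%N ->
  0 < Lf -> 0 < Hin -> 0 < Rin -> 0 <= gm ->
  gm <= 3 * Hin / (p.-1)`!%:R * (2 * (Rin / 2 ^+ j)) ^+ p ->
  (4 * p * p.+1)%:R^-1 * GF <= gm -> Rin / 2 <= eta ->
  2 * Lf * p.+1%:R / p`!%:R * eta ^+ p <= GF + gm + Lf / p`!%:R * eta ^+ p ->
  2 ^+ j <= 3 * (4 * p * p.+1 + 1)%:R * p%:R * 4 ^+ p * (Hin / Lf).
Proof.
move=> p0 Lf0 Hin0 R0 gm0 hgm hGF heta h.
pose D : R := (4 * p * p.+1)%:R; pose F : R := (p.-1)`!%:R; pose q : R := p%:R.
have D0 : 0 < D by rewrite ltr0n !muln_gt0 p0.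
have F0 : 0 < F by rewrite ltr0n fact_gt0.
have q0 : 0 < q by rewrite ltr0n.
have Fp : p`!%:R = q * F by rewrite /q /F -natrM -{2}(prednK p0) -factS prednK.
have e0 : 0 < eta ^+ p by rewrite exprn_gt0 // (lt_le_trans _ heta) // divr_gt0.
have k1 : GF <= D * gm by rewrite -ler_pdivrMl.
have k2 : Lf / (q * F) * eta ^+ p <= (D + 1) * gm.
  have : Lf / (q * F) * eta ^+ p <= 2 * Lf * p.+1%:R / p`!%:R * eta ^+ p - Lf / p`!%:R * eta
    ^+ p.
    have -> : 2 * Lf * p.+1%:R / p`!%:R * eta ^+ p - Lf / p`!%:R * eta ^+ p =
       (Lf / (q * F) * eta ^+ p) * (2 * q + 1).
      rewrite Fp -[p.+1%:R]natr1 -/q; move: (eta ^+ p) => W; field.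
      by rewrite !gt_eqF.
    rewrite ler_peMr // ?lerDr; last by rewrite mulr_ge0 // ltW.
    by rewrite mulr_ge0 ?divr_ge0 ?mulr_ge0 // ltW.
  by move: h k1; set S1 := 2 * Lf * _ / _ * _; set S2 := Lf / p`!%:R * _;
    set S3 := Lf / (q * F) * _; lra.
have k3 : (Rin / 2) ^+ p <= eta ^+ p.
  by rewrite lerXn2r // nnegrE ?(le_trans _ heta) // divr_ge0 // ltW.
have LF0 : 0 < Lf / (q * F) by rewrite divr_gt0 // mulr_gt0.
have D1 : 0 <= D + 1 by rewrite addr_ge0 // ltW.
have k4 := le_trans (ler_wpM2l (ltW LF0) k3) (le_trans k2 (ler_wpM2l D1 hgm)).
have W0 : 0 < (Rin / 2) ^+ p by rewrite exprn_gt0 // divr_gt0.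
have E : (2 * (Rin / 2 ^+ j)) ^+ p = (Rin / 2) ^+ p * 4 ^+ p / (2 ^+ j) ^+ p.
  by rewrite -exprMn -expr_div_n; congr (_ ^+ _); field; rewrite expf_neq0.
have J1 : 1 <= 2 ^+ j :> R by rewrite exprn_ege1 // ler1n.
have k5 : 2 ^+ j <= (2 ^+ j) ^+ p :> R by rewrite -[leLHS]expr1 ler_weXn2l.
apply: le_trans k5 _; move: k4; rewrite E -/F natrD -/D -/q.
have J0 : 0 < (2 ^+ j) ^+ p :> R by rewrite !exprn_gt0.
move: ((Rin / 2) ^+ p) W0 ((2 ^+ j) ^+ p) J0 (4 ^+ p) => W W0 J J0 Q k4.
have c0 : 0 < q * F * J / (Lf * W) by rewrite divr_gt0 ?mulr_gt0.
have := ler_wpM2l (ltW c0) k4.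
have -> : q * F * J / (Lf * W) * (Lf / (q * F) * W) = J by field; rewrite !gt_eqF.
have -> // : q * F * J / (Lf * W) * ((D + 1) * (3 * Hin / F * (W * Q / J))) =
  3 * (D + 1) * q * Q * (Hin / Lf) by field; rewrite !gt_eqF.
Qed.

(** The 3 leaves room for J = j + 2 in [inner_loop_bound]; the maximum with 1 keeps the logarithm
    nonnegative. *)
Definition inner_cst p (kappa : R) : R :=
  3 + 2 * ln (3 * (4 * p * p.+1 + 1)%:R * p%:R * 4 ^+ p * Num.max kappa 1).

Lemma inner_cst_ge3 p (kappa : R) : (0 < p)%N -> 3 <= inner_cst p kappa.
Proof.
move=> p0; rewrite /inner_cst lerDl mulr_ge0 // ln_ge0 //.
have h1 : 1 <= (4 * p * p.+1 + 1)%:R :> R by rewrite ler1n addn1.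
have h2 : 1 <= p%:R :> R by rewrite ler1n.
have h3 : 1 <= 4 ^+ p :> R by rewrite exprn_ege1 // ler1n.
have h4 : 1 <= Num.max kappa 1 by rewrite le_max lexx orbT.
by do 4 (rewrite mulr_ege1 //); rewrite ler1n.
Qed.

Lemma inner_loop_bound p r kappa f g (Lf Lg sigma Hin sigmain : R) xs xt
    (z : nat -> V) J : (0 < p)%N ->
  composite_problem p r f g Lf Lg sigma xs ->
  inner_constants p kappa f g Lf Lg Hin sigmain ->
  inner_loop p f g (2 * Lf) Hin sigmain xt z J ->
  J%:R <= inner_cst p kappa * (1 + ln (Lg / Lf)).
Proof.
move=> p0 [[cf lf] [cg lg] /andP[Lf0 LfLg] _ _] [s0 hk1 hk2 hm] [ys [mys z0 rs nacc]].
set m := step_obj p (2 * Lf) f g xt in mys rs.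
have Lg0 : 0 < Lg by exact: lt_trans LfLg.
have dg x : differentiable g x by exact: lip_deriv_differentiable lg.
have ln0 : 0 <= ln (Lg / Lf) by rewrite ln_ge0 // ler_pdivlMr // mul1r ltW.
have c3 := inner_cst_ge3 p kappa p0.
have l1 : 1 <= 1 + ln (Lg / Lf) by rewrite lerDl.
(* The estimate needs a point that came out of a restart, so that its gradient is bounded, and yet
   failed the test: this is [z j.+1] with J = j + 2. *)
have [J1|[j Ej]] : (J <= 1)%N \/ exists j, J = j.+2.
  by case: (J) => [|[|j]]; [left|left|right; exists j].
  apply: le_trans (_ : 1 <= _); first by rewrite (ler_nat R _ 1).
  by rewrite mulr_ege1 //; lra.
have [lm um] := hm xt.
have dm x : differentiable m x by exact: lip_deriv_differentiable lm.
have gys : grad m ys = 0 by exact: minimizer_grad.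
have gm_xt x : enorm (gradF f g x +
    (2 * Lf * p.+1%:R / p`!%:R * enorm (x - xt) ^+ p.-1) *: (x - xt) - grad m x)
    <= Lf / p`!%:R * enorm (x - xt) ^+ p.
  exact: step_obj_grad.
(* A start at the minimizer would have passed the first test. *)
have R0 : 0 < enorm (z 0%N - ys).
  apply: enorm_gt0; apply/eqP => e; apply: (nacc 0%N); first by rewrite Ej.
  have -> : z 0%N = ys by apply/eqP; rewrite -subr_eq0 e.
  by rewrite /accurate gys enorm0 mulr_ge0 ?enorm_ge0 // invr_ge0.
have [dist step] := restarts_rate p Hin p.+1%:R sigmain m (grad m) ys _ z J p0
  (ltr0Sn R p) s0 um mys gys (fun _ => exact_prox p Hin m p0 lm) R0 rs.
have jJ : (j < J)%N by rewrite Ej ltnS leqnSn.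
have j1J : (j.+1 < J)%N by rewrite Ej.
have [Hin0 _ hg] := step j jJ.
have hd := dist j.+1 (ltnW j1J).
set Rin := enorm (z 0%N - ys) in R0 dist step hg hd.
(* The inner loop starts at the centre xt, at distance Rin from ys, while [z j.+1] is within Rin / 2
   of ys. *)
have heta : Rin / 2 <= enorm (z j.+1 - xt).
  have := enorm_triangleB (z 0%N - ys) (z j.+1 - ys).
  rewrite opprB addrA subrK [enorm (z 0%N - z _)]enormB -/Rin z0.
  have : Rin / 2 ^+ j.+1 <= Rin / 2.
    by rewrite ler_pM2l // lef_pV2 ?posrE ?exprn_gt0 // exprS ler_peMr // exprn_ege1 // ler1n.
  by move: hd; clear; move: (enorm (z j.+1 - ys)) (enorm (z j.+1 - xt)) (Rin / 2 ^+ j.+1)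
    (Rin) => *; lra.
have hna := nacc j.+1 j1J.
have {}hna : (4 * p * p.+1)%:R^-1 * enorm (gradF f g (z j.+1)) <= enorm (grad m (z j.+1)).
  by rewrite leNgt; apply/negP => /ltW.
have hG : 2 * Lf * p.+1%:R / p`!%:R * enorm (z j.+1 - xt) ^+ p <=
    enorm (gradF f g (z j.+1)) + enorm (grad m (z j.+1)) +
    Lf / p`!%:R * enorm (z j.+1 - xt) ^+ p.
  have := gm_xt (z j.+1); set k := _ * _ ^+ p.-1; set h := z j.+1 - xt.
  move=> hE; have k0 : 0 <= k.
    by rewrite mulr_ge0 ?exprn_ge0 ?enorm_ge0 // divr_ge0 // !mulr_ge0 // ltW.
  have -> : 2 * Lf * p.+1%:R / p`!%:R * enorm h ^+ p = enorm (k *: h).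
    by rewrite enormZ ger0_norm // /k -[RHS]mulrA -exprSr prednK.
  have -> : k *: h = (gradF f g (z j.+1) + k *: h - grad m (z j.+1)) +
      (grad m (z j.+1) - gradF f g (z j.+1)).
    by apply/rowP => i; rewrite !mxE; ring.
  apply: le_trans (enorm_triangle _ _) _.
  have := enorm_triangle (grad m (z j.+1)) (- gradF f g (z j.+1)); rewrite enormN.
  by move: hE; move: (enorm _) (enorm _) (enorm _) (enorm _) (_ * _) => *; lra.
have := inner_loop_bound_arith p Lf Hin _ _ _ Rin j p0 Lf0 Hin0 R0 (enorm_ge0 _) hg hna heta hG.
set K := 3 * _ * _ * _ => hj.
have K0 : 0 < K by rewrite !mulr_gt0 // ?exprn_gt0 ?ltr0n // addn1.
have M0 : 0 < Num.max kappa 1 by rewrite lt_max ltr01 orbT.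
have hH : Hin / Lf <= Num.max kappa 1 * (Lg / Lf).
  rewrite mulrA ler_wpM2r ?invr_ge0 ?(ltW Lf0) // (le_trans hk2) // ler_wpM2r ?(ltW Lg0) //.
  by rewrite le_max lexx.
have := exp2_le_ln j _ (le_trans hj (ler_wpM2l (ltW K0) hH)).
have LL0 : 0 < Lg / Lf by rewrite divr_gt0.
have KM0 : 0 < K * Num.max kappa 1 by rewrite mulr_gt0.
rewrite (mulrA K) (lnM KM0 LL0) => hjl.
rewrite Ej -addn2 natrD.
have -> : inner_cst p kappa = 3 + 2 * ln (K * Num.max kappa 1) by [].
have L0 : 0 <= ln (K * Num.max kappa 1) by move: c3; rewrite /inner_cst -/K; lra.
have := mulr_ge0 L0 ln0.
by move: (ln (K * _)) (ln (Lg / Lf)) hjl L0 ln0 => a b *; lra.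
Qed.

End Inner.

Section Calls.
Context {R : realType}.

Definition outer_cst p (r : R) : R :=
  (r * c_const p * 2 * 2 `^ r) `^ (2 / (3 * p + 1)%:R).

(** One factor [kappa] comes from Hin <= kappa Lg, the other from sigmain >= Lf / kappa. *)
Definition inner_steps_cst p (kappa : R) : R :=
  (p.+1%:R * c_const p * 2 `^ p.+1%:R * kappa ^+ 2) `^ (2 / (3 * p + 1)%:R).

Lemma alpha_ge0 p : 0 <= 2 / (3 * p + 1)%:R :> R.
Proof. by rewrite divr_ge0. Qed.

(** As r <= p + 1, the radius R_k can be replaced by R_0 for every k; the maximum with 1 accounts
    for rounding and for the minimum of one step. *)
Lemma outer_steps p (r Lf sigma R0 : R) k : 0 < r -> r <= p.+1%:R -> 0 < Lf -> 0 < sigma ->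
  0 < R0 -> forall X, X = (Lf * R0 `^ (p.+1%:R - r) / sigma) `^ (2 / (3 * p + 1)%:R) ->
  (nsteps p (2 * Lf) r sigma R0 k)%:R <= (outer_cst p r + 2) * Num.max X 1.
Proof.
move=> r0 rp L0 s0 R00 X XE; have /andP[_ h] := nsteps_bounds p (2 * Lf) r sigma R0 k.
apply: le_trans h _; rewrite [leRHS]mulrDl.
have c0 := c_const_gt0 (R := R) p.
have o0 : 0 <= outer_cst p r by exact: powR_ge0.
rewrite lerD //; last by rewrite ler_peMr // le_max lexx orbT.
apply: le_trans (_ : outer_cst p r * X <= _); last by rewrite ler_wpM2l // le_max lexx.
have A0 : 0 <= r * c_const p * 2 * 2 `^ r by rewrite !mulr_ge0 ?powR_ge0 // ltW.
have B0 : 0 <= Lf * R0 `^ (p.+1%:R - r) / sigma.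
  by rewrite divr_ge0 ?mulr_ge0 ?powR_ge0 // ltW.
rewrite /outer_cst XE -powRM // /nsteps_arg.
have Rk0 : 0 <= R0 / 2 ^+ k by rewrite divr_ge0 ?exprn_ge0 // ltW.
apply: ge0_ler_powR; rewrite ?nnegrE ?alpha_ge0 //.
- by rewrite !mulr_ge0 ?invr_ge0 ?powR_ge0 // ltW.
- exact: mulr_ge0.
have h : (R0 / 2 ^+ k) `^ (p.+1%:R - r) <= R0 `^ (p.+1%:R - r).
  apply: ge0_ler_powR; rewrite ?nnegrE ?subr_ge0 ?(ltW R00) //.
  by rewrite ler_pdivrMr ?exprn_gt0 // ler_peMr ?(ltW R00) // exprn_ege1 // ler1n.
have -> : r * c_const p * 2 * 2 `^ r * (Lf * R0 `^ (p.+1%:R - r) / sigma) =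
  r * c_const p * (2 * Lf) * 2 `^ r / sigma * R0 `^ (p.+1%:R - r).
  by move: (2 `^ r) (R0 `^ _) (c_const p) => a b c; ring.
by rewrite ler_wpM2l // !mulr_ge0 ?invr_ge0 ?powR_ge0 // ltW.
Qed.

Lemma inner_steps p (kappa Lf Lg Hin sigmain : R) : 0 < Lf -> Lf < Lg -> 0 < sigmain ->
  Lf <= kappa * sigmain -> Hin <= kappa * Lg ->
  (nsteps p Hin p.+1%:R sigmain 1 0)%:R <=
    (inner_steps_cst p kappa + 3) * (Lg / Lf) `^ (2 / (3 * p + 1)%:R).
Proof.
move=> L0 LL s0 h1 h2.
have /andP[_ h] := nsteps_bounds p Hin p.+1%:R sigmain 1 0.
apply: le_trans h _.
have Lg0 : 0 < Lg by exact: lt_trans LL.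
have k0 : 0 < kappa by rewrite -(pmulr_lgt0 _ s0) (lt_le_trans L0).
have c0 := c_const_gt0 (R := R) p.
have q1 : 1 <= Lg / Lf by rewrite ler_pdivlMr // mul1r ltW.
have i0 : 0 <= inner_steps_cst p kappa by exact: powR_ge0.
have Q1 : 1 <= (Lg / Lf) `^ (2 / (3 * p + 1)%:R).
  have E1 : 1 `^ (2 / (3 * p + 1)%:R) = 1 :> R by rewrite powR1.
  rewrite -[leLHS]E1.
  by apply: ge0_ler_powR; rewrite ?nnegrE ?alpha_ge0 // (le_trans ler01).
have key : nsteps_arg p Hin p.+1%:R sigmain 1 0 <=
    inner_steps_cst p kappa * (Lg / Lf) `^ (2 / (3 * p + 1)%:R) + 1; last first.
  by move: key Q1 i0; move: (nsteps_arg _ _ _ _ _ _) (inner_steps_cst _ _) (_ `^ _) => *; lra.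
rewrite /nsteps_arg subrr powRr0 mulr1.
have a0 : 0 < p.+1%:R * c_const p * 2 `^ p.+1%:R :> R.
  by apply: mulr_gt0; [exact: mulr_gt0 | exact: powR_gt0].
have e0 : 0 <= inner_steps_cst p kappa * (Lg / Lf) `^ (2 / (3 * p + 1)%:R).
  by rewrite mulr_ge0 ?powR_ge0.
(* For [Hin] negative the base is negative and [powR] returns 1; the summand 1 in [key] is there for
   this case. *)
have [H0|H0] := leP 0 Hin; last first.
  rewrite lt0_powR1 ?lerDr // pmulr_llt0 ?invr_gt0 // mulrAC.
  by rewrite pmulr_rlt0.
apply: le_trans (_ : inner_steps_cst p kappa * (Lg / Lf) `^ (2 / (3 * p + 1)%:R) <= _);
  last by rewrite lerDl.
have K0 : 0 <= p.+1%:R * c_const p * 2 `^ p.+1%:R * kappa ^+ 2.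
  by rewrite mulr_ge0 ?exprn_ge0 // ltW.
rewrite /inner_steps_cst -powRM // ?divr_ge0 ?(ltW L0) ?(ltW Lg0) //.
have D0 : 0 <= Lg / Lf by rewrite divr_ge0 ?(ltW L0) ?(ltW Lg0).
apply: ge0_ler_powR; rewrite ?nnegrE ?alpha_ge0 //.
- by rewrite mulr_ge0 ?invr_ge0 ?(ltW s0) // mulrAC mulr_ge0 // ltW.
- exact: mulr_ge0.
have h3 : Hin / sigmain <= kappa ^+ 2 * (Lg / Lf).
  rewrite ler_pdivrMr // mulrA mulrAC ler_pdivlMr //.
  apply: le_trans (_ : (kappa * Lg) * (kappa * sigmain) <= _).
    by rewrite ler_pM // ltW.
  by apply/ler_eq; ring.
have := ler_wpM2l (ltW a0) h3.
have -> : p.+1%:R * c_const p * Hin * 2 `^ p.+1%:R / sigmain =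
  p.+1%:R * c_const p * 2 `^ p.+1%:R * (Hin / sigmain).
  by move: (c_const p : R) (2 `^ p.+1%:R : R) (p.+1%:R : R) => a b c; ring.
move=> h5; apply: le_trans h5 _.
by rewrite [leLHS](mulrA (p.+1%:R * c_const p * 2 `^ p.+1%:R)).
Qed.

(** Since r >= 1, replacing (2^n)^r by 2^n and dropping 1/r only weakens the bound, and after taking
    logarithms this costs a constant factor. *)
Lemma restarts_count (r sigma R0 eps : R) n : 1 <= r -> 0 < sigma -> 0 < R0 -> 0 < eps ->
  eps < sigma / r * (R0 / 2 ^+ n) `^ r -> 2 ^+ n <= sigma * R0 `^ r / eps.
Proof.
move=> r1 s0 R00 e0 h; have r0 : 0 < r by lra.
have J1 : 1 <= 2 ^+ n :> R by rewrite exprn_ege1 // ler1n.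
have J0 : 0 < 2 ^+ n :> R by rewrite exprn_gt0.
have E : (R0 / 2 ^+ n) `^ r * (2 ^+ n) `^ r = R0 `^ r.
  by rewrite -powRM ?divr_ge0 ?(ltW R00) ?(ltW J0) // divfK // gt_eqF.
have Jr := le1r_powR J1 r1.
rewrite ler_pdivlMr // -E.
have h' : eps <= sigma * (R0 / 2 ^+ n) `^ r.
  by apply: le_trans (ltW h) _; rewrite ler_wpM2r ?powR_ge0 // ler_pdivrMr // ler_peMr // ltW.
rewrite mulrA mulrC; apply: ler_pM => //; exact: ltW.
Qed.

End Calls.

(** * The outer loop and the final count *)

Section Outer.
Context {R : realType} {d : nat}.
Local Notation V := 'rV[R]_d.
Implicit Types (x y z v w h xs xt : V) (f g m : V -> R).

Lemma outer_rate p r f g (Lf Lg sigma Hin sigmain : R) xs x0 (z : nat -> V) J n :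
  (0 < p)%N -> 2 <= r -> composite_problem p r f g Lf Lg sigma xs ->
  0 < enorm (x0 - xs) ->
  combination p r f g sigma xs (2 * Lf) Hin sigmain x0 z J n ->
  forall k, (k < n)%N -> f (z k.+1) + g (z k.+1) - (f xs + g xs) <=
    sigma / r * (enorm (x0 - xs) / 2 ^+ k.+1) `^ r.
Proof.
move=> p0 r2 [[cf lf] [cg lg] /andP[Lf0 LfLg] [s0 uc] mF] R0 [z0 rs].
have df x : differentiable f x by exact: lip_deriv_differentiable lf.
have dg x : differentiable g x by exact: lip_deriv_differentiable lg.
have gE x : grad (fun x => f x + g x) x = gradF f g x by exact: gradD.
have uc' x y : f x + g x + dotp (gradF f g x) (y - x) + sigma / r * enorm (y - x) `^ r <= f y
  + g y.
  by have := uc x y; rewrite gE.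
have gxs : gradF f g xs = 0.
  by rewrite -gE; apply: minimizer_grad => //; exact: differentiableD.
have r0 : 0 < r by lra.
have prox k : proximal p (2 * Lf) (fun i => inner_solve p f g (2 * Lf) Hin sigmain (J k i))
  (gradF f g).
  by apply: accurate_prox => // i xt y [z' [_ _]].
have := restarts_rate p (2 * Lf) r sigma (fun x => f x + g x) (gradF f g) xs _ z n p0 r0 s0
  uc' mF gxs prox.
by rewrite z0 => /(_ R0 rs) [_ st] k kn; have [] := st k kn.
Qed.

Lemma combination_inner p r f g (Lf sigma Hin sigmain : R) xs x0 (z : nat -> V) J n k i :
  combination p r f g sigma xs (2 * Lf) Hin sigmain x0 z J n -> (k < n)%N ->
  (i < nsteps p (2 * Lf) r sigma (enorm (x0 - xs)) k)%N ->
  exists xt (z' : nat -> V), inner_loop p f g (2 * Lf) Hin sigmain xt z' (J k i).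
Proof.
move=> [z0 rs] kn hi; have := rs k kn; rewrite z0.
move=> [lam [a [A [x [y [xt [_ _ _ _ st]]]]]]].
have [_ _ [z' [il _ _]] _ _] := st i hi.
by exists (xt i), z'.
Qed.

End Outer.

Theorem theorem3 (R : realType) (p : nat) (r : R)
    (hp : (1 <= p)%N) (hr : 2 <= r) (hpr : r <= p.+1%:R) :
  (exists kappa0 : R,
     forall (d : nat) (f g : 'rV[R]_d -> R) (Lf Lg sigma : R) (xs : 'rV[R]_d),
       composite_problem p r f g Lf Lg sigma xs ->
       exists Hin sigmain : R,
         inner_constants p kappa0 f g Lf Lg Hin sigmain) /\
  (forall kappa : R, exists (C : R) (m : nat),
     forall (d : nat) (f g : 'rV[R]_d -> R) (Lf Lg sigma : R)
       (xs x0 : 'rV[R]_d) (Hin sigmain eps : R),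
       composite_problem p r f g Lf Lg sigma xs ->
       inner_constants p kappa f g Lf Lg Hin sigmain ->
       0 < eps ->
       let F := fun x => f x + g x in
       let Hf := 2 * Lf in
       let R0 := enorm (x0 - xs) in
       let alpha := 2 / (3 * p + 1)%:R in
       let Xf := Lf * R0 `^ (p.+1%:R - r) / sigma in
       let Xg := Lg * R0 `^ (p.+1%:R - r) / sigma in
       let logs := 1 + ln (1 + sigma * R0 `^ r / eps) + ln (Lg / Lf) in
       let small := small_arg (Xf `^ alpha) in
       (forall (xt : 'rV[R]_d) (z : nat -> 'rV[R]_d) (J : nat),
          inner_loop p f g Hf Hin sigmain xt z J -> J%:R <= C * (1 + ln (Lg / Lf)) ^+ m) /\
       (exists K : nat,
          forall (n : nat) (z : nat -> 'rV[R]_d) (J : nat -> nat -> nat),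
            combination p r f g sigma xs Hf Hin sigmain x0 z J n ->
            (K <= n)%N \/ F (z n) - F xs <= eps ->
            exists N : nat,
              [/\ (N <= n)%N,
                  F (z N) - F xs <= eps,
                  (calls_f p r sigma Hf R0 J N)%:R
                    <= C * logs ^+ m * Xf `^ alpha * small
                & (calls_g p r sigma Hf Hin sigmain R0 J N)%:R
                    <= C * logs ^+ m * Xg `^ alpha * small])).
Proof.
split.
  have [k0 hk] := @inner_constants_exist R p hp.
  by exists k0 => d f g Lf Lg sigma xs cp; exact: hk cp.
move=> kappa; pose c := inner_cst p kappa; pose o := outer_cst p r + 2.
pose q := inner_steps_cst p kappa + 3.
have c3 : 3 <= c by exact: inner_cst_ge3.
have o2 : 2 <= o by rewrite lerDr powR_ge0.
have q3 : 3 <= q by rewrite lerDr powR_ge0.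
have c0 : 0 <= c by exact: le_trans c3.
have c_cq : c <= c * q by rewrite ler_peMr // (le_trans _ q3) // ler1n.
(* The factors bound the outer restarts (2 [logs]), the steps of a restart ([o]) and the calls in a
   step (1 + 2cq), up to their variable parts. The power 2 is one logarithm for the outer restarts
   and one for the inner ones. *)
exists (2 * o * (1 + 2 * c * q)), 2%N => d f g Lf Lg sigma xs x0 Hin sigmain eps cp ic e0.
move=> F Hf R0 alpha Xf Xg logs small.
have [_ _ /andP[Lf0 LfLg] [s0 _] mF] := cp.
have [si0 hk1 hk2 _] := ic.
have Lg0 : 0 < Lg by exact: lt_trans LfLg.
pose l := 1 + ln (Lg / Lf).
have ln0 : 0 <= ln (Lg / Lf) by rewrite ln_ge0 // ler_pdivlMr // mul1r ltW.
have l1 : 1 <= l by rewrite lerDl.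
have inner xt z J : inner_loop p f g Hf Hin sigmain xt z J -> J%:R <= c * l.
  by move=> il; exact: inner_loop_bound cp ic il.
have cq0 : 9 <= c * q.
  have : 3 * 3 <= c * q by rewrite ler_pM.
  lra.
split.
  move=> xt z J /inner hJ; apply: le_trans hJ _; rewrite -/l expr2.
  have cC : c <= 2 * o * (1 + 2 * c * q).
    have : c * 3 <= c * q by rewrite ler_wpM2l //; lra.
    have : 2 * (1 + 2 * c * q) <= o * (1 + 2 * c * q) by rewrite ler_wpM2r //; lra.
    lra.
  apply: ler_pM => //; first lra.
  by rewrite ler_peMr //; lra.
pose Q := sigma * R0 `^ r / eps.
have Q0 : 0 <= Q by rewrite divr_ge0 ?mulr_ge0 ?powR_ge0 // ltW.
(* After K restarts the gap is at most eps, since otherwise [rate] would give 2^K <= Q. *)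
have [K [K1 QK]] : exists K : nat, (0 < K)%N /\ Q < 2 ^+ K.
  exists (Num.truncn Q).+1; split => //.
  apply: lt_le_trans (truncnS_gt Q) _.
  by rewrite -natrX ler_nat ltnW // ltn_expl.
exists K => n z J comb hn.
have z0 : z 0%N = x0 by case: comb.
have R00 : 0 <= R0 by exact: enorm_ge0.
(* The rates assume R0 > 0; for R0 = 0 the start is the minimizer and no restart has to be
   counted. *)
have acc0 : R0 = 0 -> F (z 0%N) - F xs <= eps.
  move=> h; have -> : z 0%N = xs; last by rewrite subrr ltW.
  by rewrite z0; apply/eqP; rewrite -subr_eq0; apply/eqP/enorm_eq0; exact: h.
have rate k : 0 < R0 -> (k < n)%N -> eps < F (z k.+1) - F xs -> 2 ^+ k.+1 <= Q.
  move=> R0gt kn h; apply: (restarts_count r) => //; first by lra.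
  by apply: lt_le_trans h _; exact: outer_rate cp R0gt comb k kn.
have ex : exists i, (i <= n)%N && (F (z i) - F xs <= eps).
  have [Kn|h] := hn; last by exists n; rewrite leqnn.
  have [R0e|R0gt] : R0 = 0 \/ 0 < R0.
    by move: R00; rewrite le_eqVlt => /orP[/eqP <-|]; [left|right].
    by exists 0%N; rewrite acc0.
  exists K; rewrite Kn /= leNgt; apply/negP => h.
  have := rate K.-1 R0gt; rewrite prednK // => /(_ Kn h).
  by rewrite leNgt QK.
(* By minimality [z N.-1] is not yet accurate, so that for N >= 2 [rate] bounds 2^(N-1) by Q and N
   is logarithmic, whatever n is. *)
case: (ex_minnP ex) => N /andP[Nn hN] minN; exists N.
have C0 : 0 <= 2 * o * (1 + 2 * c * q) by rewrite !mulr_ge0 //; lra.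
have sm0 : 0 <= small by rewrite /small /small_arg le_max ler01.
have [N0|N1] : N = 0%N \/ (0 < N)%N by case: (N); [left|right].
  split => //; rewrite N0 /calls_f /calls_g big_ord0 mulr_ge0 // mulr_ge0 ?powR_ge0 //.
    by rewrite mulr_ge0 ?sqr_ge0.
  by rewrite mulr_ge0 ?sqr_ge0.
have R0gt : 0 < R0.
  rewrite lt_neqAle R00 andbT eq_sym; apply/eqP => /acc0 h.
  by have := minN 0%N; rewrite h andbT => /(_ isT); rewrite leqNgt N1.
have lQ0 : 0 <= ln (1 + Q) by rewrite ln_ge0 // lerDl.
have logsE : logs = 1 + ln (1 + Q) + ln (Lg / Lf) by [].
have N_logs : N%:R <= 2 * logs.
  case: (N) N1 Nn minN => [//|[|k]] _ kn minN; first by rewrite logsE; lra.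
  have h : eps < F (z k.+1) - F xs.
    rewrite ltNge; apply/negP => h; have := minN k.+1.
    by rewrite h andbT (ltnW kn) ltnn => /(_ isT).
  have h2 : 2 ^+ k.+1 <= 1 + Q by apply: le_trans (rate k R0gt (ltnW kn) h) _; rewrite lerDr.
  by have := exp2_le_ln _ _ h2; rewrite logsE -[k.+2%:R]natr1; lra.
have l_logs : l <= logs by rewrite logsE /l; lra.
have logs0 : 0 <= logs by lra.
have Xf0 : 0 < Xf by rewrite divr_gt0 // mulr_gt0 // powR_gt0.
have Xa0 : 0 < Xf `^ alpha by rewrite powR_gt0.
(* [small] turns Xf^alpha into max(Xf^alpha, 1), the form in which [outer_steps] bounds a step
   count. *)
have YE := small_arg_max _ Xa0; set Y := Num.max _ 1 in YE.
have r0 : 0 < r by lra.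
have steps k : (nsteps p Hf r sigma R0 k)%:R <= o * Y.
  exact: (outer_steps p r Lf sigma R0 k r0 hpr Lf0 s0 R0gt _ erefl).
have Jle k i : (k < N)%N -> (i < nsteps p Hf r sigma R0 k)%N -> (J k i)%:R <= c * l.
  move=> kN hi; have [xt [z' il]] := combination_inner p r f g Lf sigma Hin sigmain xs x0 z J
    n k i comb (leq_trans kN Nn) hi.
  exact: inner il.
have oY0 : 0 <= o * Y by rewrite mulr_ge0 ?le_max ?ler01 ?orbT //; lra.
pose rho := (Lg / Lf) `^ alpha.
have rho1 : 1 <= rho.
  have E1 : 1 `^ alpha = 1 :> R by rewrite powR1.
  rewrite -[leLHS]E1 /rho.
  by apply: ge0_ler_powR; rewrite ?nnegrE ?alpha_ge0 ?divr_ge0 ?(ltW Lf0) ?(ltW Lg0) //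
    ler_pdivlMr // mul1r ltW.
have Xg_rho : Xg `^ alpha = Xf `^ alpha * rho.
  rewrite /rho -powRM ?(ltW Xf0) ?divr_ge0 ?(ltW Lf0) ?(ltW Lg0) //; congr (_ `^ _).
  by rewrite /Xg /Xf; field; rewrite !gt_eqF.
have nin : (nsteps p Hin p.+1%:R sigmain 1 0)%:R <= q * rho by exact: inner_steps hk1 hk2.
(* Both oracles at once: T = 1 for f, and for g T = rho, the order of the length of an inner
   restart. *)
have count (t : nat -> nat -> nat) T : 0 <= T ->
    (forall k i, (k < N)%N -> (i < nsteps p Hf r sigma R0 k)%N ->
       (t k i)%:R <= (1 + 2 * c * q) * l * T) ->
    (\sum_(k < N) \sum_(i < nsteps p Hf r sigma R0 k) t k i)%N%:R <=
      2 * o * (1 + 2 * c * q) * logs ^+ 2 * (Y * T).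
  move=> T0 ht; have cq1 : 0 <= 1 + 2 * c * q by lra.
  have T'0 : 0 <= (1 + 2 * c * q) * l * T by rewrite !mulr_ge0 //; lra.
  apply: le_trans (sum_sum_le N _ t _ _ T'0 (fun k _ => steps k) ht) _.
  apply: le_trans (_ : 2 * logs * (o * Y * ((1 + 2 * c * q) * logs * T)) <= _); last first.
    by apply/ler_eq; ring.
  apply: ler_pM => //; first exact: mulr_ge0.
  by rewrite ler_wpM2l // ler_wpM2r // ler_wpM2l.
split => //.
- rewrite -mulrA YE -[Y]mulr1; apply: (count (fun k i => (1 + J k i)%N)) => // k i kN hi.
  rewrite natrD mulr1; apply: le_trans (lerD (lexx _) (Jle k i kN hi)) _.
  have := ler_wpM2r (le_trans ler01 l1) c_cq.
  have := ler_wpM2r (le_trans ler01 l1) (le_trans (ler0n R 9) cq0).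
  lra.
- have -> : 2 * o * (1 + 2 * c * q) * logs ^+ 2 * Xg `^ alpha * small =
    2 * o * (1 + 2 * c * q) * logs ^+ 2 * (Y * rho) by rewrite Xg_rho -YE -/small; ring.
  apply: (count (fun k i => (1 + J k i * (2 * nsteps p Hin p.+1%:R sigmain 1 0))%N)).
    exact: le_trans rho1.
  move=> k i kN hi; rewrite natrD !natrM.
  have h : (J k i)%:R * (2%:R * (nsteps p Hin p.+1%:R sigmain 1 0)%:R)
      <= c * l * (2 * (q * rho)).
    by apply: ler_pM; [exact: ler0n | exact: mulr_ge0 | exact: Jle | rewrite ler_wpM2l].
  have lr : 1 <= l * rho by exact: mulr_ege1.
  by move: h; move: (_ * (_ * _%:R)) => X h; lra.
Qed.
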